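(* Let $X=L/H$ be a connected homogeneous space with $\dim X=n\ge2$ ($L$ a connected Lie group, $H$ closed), and let $g=-\mathrm dt^2+h_t$, with $h_t$ $L$-invariant Riemannian metrics, be a spatially homogeneous solution of $\operatorname{Ein}(g)=T$ on $[t_0,\infty)\times X$. Suppose that $\theta(t_0)>0$ and $R(h_t)\le0$, where $\theta=\frac12\operatorname{tr}_{h_t}\dot h_t$ and $R(h_t)$ is the scalar curvature. With $\nu=\partial_t$, set $$\rho=T(\nu,\nu),\qquad S=T|_{TX\times TX},\qquad \mathfrak q=\frac{(n-2)\rho+\operatorname{tr}_{h_t}S}{n-1},$$ and assume along the solution that $0\le\mathfrak q\le2\rho$. Then every future causal geodesic (affine parameter $\lambda$, $E=\mathrm dt/\mathrm d\lambda$) satisfies $$E(t)\le E(t_0)\left(\frac{\theta(t_0)}{\theta(t)}\right)^{c_n},\qquad c_2=0,\quad c_3=\tfrac13,\quad c_n=\tfrac{\sqrt n-1}{2}\ (n\ge4).$$ Hence the spacetime is future timelike and null geodesically complete for $2\le n\le9$, as is every quotient by a freely and properly discontinuously acting group of common spatial isometries (isometries of all $h_t$). For a perfect fluid ($S=p\,h_t$), the condition $0\le\mathfrak q\le2\rho$ is precisely $$-\frac{n-2}{n}\rho\le p\le\rho .$$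
   Context: $\operatorname{Ein}(g)=\operatorname{Ric}(g)-\frac12R(g)g$ is the Einstein tensor (units with $8\pi G=1$); $T$ is a symmetric two-tensor. The existence of the solution for all $t\ge t_0$ is a hypothesis. ''Future timelike and null geodesically complete'' means every future-directed timelike or null geodesic extends to infinite affine parameter. *)

(* Defs.v *)
From HB Require Import structures.
From mathcomp Require Import all_boot all_order all_algebra.
From mathcomp Require Import all_classical all_reals all_analysis.

Set Implicit Arguments.
Unset Strict Implicit.
Unset Printing Implicit Defensive.

Import Order.TTheory GRing.Theory Num.Theory.
Import numFieldNormedType.Exports.

Local Open Scope classical_set_scope.
Local Open Scope ring_scope.

(** * Calculus *)

(* C^k on an open set U; in finite dimension this is the usual notion. *)
Fixpoint Ck (R : realType) (V W : normedModType R) (k : nat) (U : set V)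
    (f : V -> W) : Prop :=
  match k with
  | 0%N => forall x, U x -> {for x, continuous f}
  | k'.+1 => (forall x, U x -> differentiable f x) /\
             (forall v, Ck k' U (fun x => 'D_v f x))
  end.

(* Smoothness on an arbitrary set: f is locally the restriction of a smooth
   function on an open set.  This covers half-spaces (manifolds with boundary)
   and half-open intervals. *)
Definition smooth_on (R : realType) (V W : normedModType R) (A : set V)
    (f : V -> W) : Prop :=
  forall x, A x -> exists (U : set V) (F : V -> W),
    [/\ open U, U x, forall k, Ck k U F & forall y, A y -> U y -> F y = f y].

(* One-sided directional derivative at a along v.  For smooth functions it is
   the usual one; being one-sided it also makes sense for d/dt on the boundary
   {t = t0} of [t0, +oo[ x X and at the initial parameter of a curve. *)
Definition rder (R : realType) (V W : normedModType R) (f : V -> W) (a v : V)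
    : W :=
  lim ((fun s : R => s^-1 *: (f (a + s *: v) - f a)) @ 0^'+).

Definition pd (R : realType) (N : nat) (i : 'I_N) (f : 'rV[R]_N -> R^o)
    (z : 'rV[R]_N) : R :=
  rder f z (delta_mx 0 i).

(** * Curvature of a pseudo-Riemannian metric in coordinates *)

Section Curvature.
Context (R : realType) (N : nat) (G : 'rV[R]_N -> 'M[R]_N).

(* Gamma^k_(ij) *)
Definition christoffel (k i j : 'I_N) (z : 'rV[R]_N) : R :=
  2^-1 * \sum_l invmx (G z) k l *
    (pd i (fun y => G y j l) z + pd j (fun y => G y i l) z
     - pd l (fun y => G y i j) z).

Definition ricci (z : 'rV[R]_N) : 'M[R]_N := \matrix_(i, j)
  (\sum_k (pd k (christoffel k i j) z - pd j (christoffel k i k) z)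
   + \sum_k \sum_l (christoffel k k l z * christoffel l i j z
                    - christoffel k j l z * christoffel l i k z)).

Definition scalar_curvature (z : 'rV[R]_N) : R := \tr (invmx (G z) *m ricci z).

Definition einstein (z : 'rV[R]_N) : 'M[R]_N :=
  ricci z - (2^-1 * scalar_curvature z) *: G z.

End Curvature.

(** * Smooth manifolds *)

Record chart (R : realType) (n : nat) (X : topologicalType) := Chart {
  cdom : set X;
  cmap : X -> 'rV[R]_n;
  cinv : 'rV[R]_n -> X;
  cdom_open : open cdom;
  cimg_open : open (cmap @` cdom);
  cmapK : forall x, cdom x -> cinv (cmap x) = x;
  cmap_cont : forall x, cdom x -> {for x, continuous cmap};
  cinv_cont : forall y, (cmap @` cdom) y -> {for y, continuous cinv} }.

Record manifold (R : realType) (n : nat) (X : topologicalType) := Manifold {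
  atlas : set (chart R n X);
  chart_at : X -> chart R n X;
  chart_atP : forall x, atlas (chart_at x) /\ cdom (chart_at x) x;
  atlas_smooth : forall c d, atlas c -> atlas d ->
    smooth_on (cmap c @` (cdom c `&` cdom d)) (cmap d \o cinv c);
  mfd_hausdorff : hausdorff_space X;
  mfd_second_countable : @second_countable X }.

Definition smooth_map (R : realType) (m n : nat) (X Y : topologicalType)
    (MX : manifold R m X) (MY : manifold R n Y) (f : X -> Y) : Prop :=
  continuous f /\
  forall c d, atlas MX c -> atlas MY d ->
    smooth_on (cmap c @` (cdom c `&` f @^-1` cdom d)) (cmap d \o f \o cinv c).

(* Jacobian of f at x in the charts c, d.  As in the library, it acts on row
   vectors from the right: a tangent vector v at x is mapped to v *m jac. *)
Definition jac (R : realType) (m n : nat) (X Y : topologicalType)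
    (c : chart R m X) (d : chart R n Y) (f : X -> Y) (x : X) : 'M[R]_(m, n) :=
  jacobian (cmap d \o f \o cinv c) (cmap c x).

Definition submersion (R : realType) (m n : nat) (X Y : topologicalType)
    (MX : manifold R m X) (MY : manifold R n Y) (f : X -> Y) : Prop :=
  smooth_map MX MY f /\
  forall c d x, atlas MX c -> atlas MY d -> cdom c x -> cdom d (f x) ->
    row_full (jac c d f x).

(* Y is the quotient manifold X / e with projection f: the smooth structure on
   the quotient for which the projection is a submersion is unique. *)
Definition quotient_manifold (R : realType) (m n : nat) (X Y : topologicalType)
    (MX : manifold R m X) (MY : manifold R n Y) (e : X -> X -> Prop)
    (f : X -> Y) : Prop :=
  [/\ submersion MX MY f, forall y, exists x, f x = y &
      forall x x', f x = f x' <-> e x x'].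

(** * Lie groups and homogeneous spaces *)

#[short(type="topGroupType")]
HB.structure Definition TopGroup := {G of Topological G & Group G}.

Definition lie_group (R : realType) (m : nat) (L : topGroupType)
    (ML : manifold R m L) : Prop :=
  [/\ continuous (fun z : L * L => (z.1 * z.2)%g),
      forall c1 c2 d, atlas ML c1 -> atlas ML c2 -> atlas ML d ->
        smooth_on
          [set z : 'rV[R]_m * 'rV[R]_m |
            [/\ (cmap c1 @` cdom c1) z.1, (cmap c2 @` cdom c2) z.2 &
                cdom d (cinv c1 z.1 * cinv c2 z.2)%g]]
          (fun z : 'rV[R]_m * 'rV[R]_m =>
             cmap d (cinv c1 z.1 * cinv c2 z.2)%g) &
      smooth_map ML ML (fun a : L => (a^-1)%g)].

Definition closed_subgroup (L : topGroupType) (H : set L) : Prop :=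
  [/\ closed H, H 1%g & forall a b, H a -> H b -> H (a^-1 * b)%g].

(* X = L/H, with projection proj : L -> X, a |-> aH, and with act the action of
   L by left translations. *)
Definition homogeneous_space (R : realType) (m n : nat)
    (L : topGroupType) (ML : manifold R m L) (H : set L)
    (X : topologicalType) (MX : manifold R n X)
    (proj : L -> X) (act : L -> X -> X) : Prop :=
  [/\ lie_group ML, connected [set: L], closed_subgroup H,
      quotient_manifold ML MX (fun a b => H (a^-1 * b)%g) proj &
      forall a b, act a (proj b) = proj (a * b)%g].

(** * Covariant 2-tensors and Riemannian metrics *)

(* A covariant 2-tensor field is given by its matrix of components at each
   point in each chart. *)
Definition tensor2 (R : realType) (n : nat) (X : topologicalType) : Type :=
  chart R n X -> X -> 'M[R]_n.

(* f^* k = h *)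
Definition is_pullback (R : realType) (m n : nat) (X Y : topologicalType)
    (MX : manifold R m X) (MY : manifold R n Y)
    (f : X -> Y) (k : tensor2 R n Y) (h : tensor2 R m X) : Prop :=
  forall c d x, atlas MX c -> atlas MY d -> cdom c x -> cdom d (f x) ->
    h c x = jac c d f x *m k d (f x) *m (jac c d f x)^T.

(* h_t, t >= t0, is a smooth family of Riemannian metrics.  The first clause is
   the transformation law under changes of charts. *)
Definition metric_family (R : realType) (n : nat) (X : topologicalType)
    (MX : manifold R n X) (t0 : R) (h : R -> tensor2 R n X) : Prop :=
  [/\ forall t, t0 <= t -> is_pullback MX MX id (h t) (h t),
      forall t c x, t0 <= t -> atlas MX c -> cdom c x ->
        (h t c x)^T = h t c x,
      forall t c x (v : 'rV[R]_n), t0 <= t -> atlas MX c -> cdom c x ->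
        v != 0 -> 0 < (v *m h t c x *m v^T) 0 0 &
      forall c, atlas MX c ->
        smooth_on
          [set z : 'rV[R]_(1 + n) |
            t0 <= lsubmx z 0 0 /\ (cmap c @` cdom c) (rsubmx z)]
          (fun z => h (lsubmx z 0 0) c (cinv c (rsubmx z)))].

Definition is_isometry (R : realType) (n : nat) (X : topologicalType)
    (MX : manifold R n X) (h : tensor2 R n X) (f : X -> X) : Prop :=
  [/\ smooth_map MX MX f,
      exists2 f' : X -> X, smooth_map MX MX f' & cancel f f' /\ cancel f' f &
      is_pullback MX MX f h h].

(** * The spacetime [t0, +oo[ x X with g = - dt^2 + h_t *)

Section Spacetime.
Context (R : realType) (n : nat) (X : topologicalType) (MX : manifold R n X).

(* Coordinates of (t, x) in the chart induced by c: the coordinate 0 is t. *)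
Definition st_coord (c : chart R n X) (t : R) (x : X)
    : 'rV[R]_(1 + n) :=
  row_mx t%:M (cmap c x).

Definition st_metric (h : R -> tensor2 R n X) (c : chart R n X)
    (z : 'rV[R]_(1 + n)) : 'M[R]_(1 + n) :=
  block_mx (- 1)%:M 0 0 (h (lsubmx z 0 0) c (cinv c (rsubmx z))).

(* T is a symmetric 2-tensor on [t0, +oo[ x X, given by its components in the
   charts id x c. *)
Definition sym_st_tensor (t0 : R)
    (T : R -> chart R n X -> X -> 'M[R]_(1 + n)) : Prop :=
  (forall t c x, t0 <= t -> atlas MX c -> cdom c x ->
     (T t c x)^T = T t c x) /\
  (forall t c d x, t0 <= t -> atlas MX c -> atlas MX d ->
     cdom c x -> cdom d x ->
     let J : 'M[R]_(1 + n) := block_mx 1%:M 0 0 (jac c d id x) in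
     T t c x = J *m T t d x *m J^T).

Definition einstein_equation (t0 : R) (h : R -> tensor2 R n X)
    (T : R -> chart R n X -> X -> 'M[R]_(1 + n)) : Prop :=
  forall t c x, t0 <= t -> atlas MX c -> cdom c x ->
    einstein (st_metric h c) (st_coord c t x) = T t c x.

(** Scalars.  They do not depend on the chart around x. *)

Definition expansion (h : R -> tensor2 R n X) (t : R) (x : X) : R :=
  let c := chart_at MX x in
  2^-1 * \tr (invmx (h t c x) *m rder (fun s : R^o => h s c x) t 1).

Definition space_scalar_curvature (k : tensor2 R n X) (x : X) : R :=
  let c := chart_at MX x in
  scalar_curvature (fun y => k c (cinv c y)) (cmap c x).

Definition energy_density (T : R -> chart R n X -> X -> 'M[R]_(1 + n))
    (t : R) (x : X) : R :=
  ulsubmx (T t (chart_at MX x) x) 0 0.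

(* S, the components of T on TX x TX *)
Definition stress (T : R -> chart R n X -> X -> 'M[R]_(1 + n)) (t : R)
    : tensor2 R n X :=
  fun c x => drsubmx (T t c x).

Definition stress_trace (h : R -> tensor2 R n X)
    (T : R -> chart R n X -> X -> 'M[R]_(1 + n))
    (t : R) (x : X) : R :=
  let c := chart_at MX x in \tr (invmx (h t c x) *m stress T t c x).

Definition qfrak (h : R -> tensor2 R n X)
    (T : R -> chart R n X -> X -> 'M[R]_(1 + n))
    (t : R) (x : X) : R :=
  ((n%:R - 2) * energy_density T t x + stress_trace h T t x) / (n%:R - 1).

(** Geodesics *)

(* [a, b[, where b may be +oo *)
Definition ray (a : R) (b : \bar R) : set R :=
  [set l | a <= l /\ (l%:E < b)%E].

(* The affinely parametrized curve l |-> (tau l, xi l) on [a, b[, in the chart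
   c, with its first two derivatives *)
Definition st_curve (tau : R -> R) (xi : R -> X) (c : chart R n X)
    (l : R^o) : 'rV[R]_(1 + n) :=
  st_coord c (tau l) (xi l).

Definition velocity (tau : R -> R) (xi : R -> X) (c : chart R n X)
    (l : R^o) : 'rV[R]_(1 + n) :=
  rder (st_curve tau xi c) l 1.

Definition acceleration (tau : R -> R) (xi : R -> X) (c : chart R n X)
    (l : R^o) : 'rV[R]_(1 + n) :=
  rder (velocity tau xi c) l 1.

Definition geodesic (t0 : R) (h : R -> tensor2 R n X)
    (a : R) (b : \bar R) (tau : R -> R) (xi : R -> X) : Prop :=
  [/\ forall l, ray a b l -> t0 <= tau l,
      {within ray a b, continuous xi},
      forall c, atlas MX c ->
        smooth_on [set l : R^o | ray a b l /\ cdom c (xi l)]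
                  (st_curve tau xi c) &
      forall c l (k : 'I_(1 + n)), atlas MX c -> ray a b l -> cdom c (xi l) ->
        acceleration tau xi c l 0 k
        + \sum_i \sum_j christoffel (st_metric h c) k i j (st_curve tau xi c l)
            * velocity tau xi c l 0 i * velocity tau xi c l 0 j = 0].

(* E = dt / dlambda *)
Definition energy (tau : R -> R) (l : R) : R := rder (tau : R^o -> R^o) l 1.

Definition future_causal (h : R -> tensor2 R n X)
    (a : R) (b : \bar R) (tau : R -> R) (xi : R -> X) : Prop :=
  forall c l, atlas MX c -> ray a b l -> cdom c (xi l) ->
    let v := velocity tau xi c l in
    0 < energy tau l /\
    (v *m st_metric h c (st_curve tau xi c l) *m v^T) 0 0 <= 0.

Definition future_causal_geodesic (t0 : R) (h : R -> tensor2 R n X)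
    (a : R) (b : \bar R) (tau : R -> R) (xi : R -> X) : Prop :=
  [/\ (a%:E < b)%E, geodesic t0 h a b tau xi & future_causal h a b tau xi].

(* Future timelike and null geodesic completeness *)
Definition future_causally_complete (t0 : R) (h : R -> tensor2 R n X) : Prop :=
  forall (a : R) (b : \bar R) (tau : R -> R) (xi : R -> X),
    future_causal_geodesic t0 h a b tau xi ->
    exists (tau' : R -> R) (xi' : R -> X),
      future_causal_geodesic t0 h a +oo%E tau' xi' /\
      forall l, ray a b l -> tau' l = tau l /\ xi' l = xi l.

(** Groups of common spatial isometries *)

Definition common_isometry_group (t0 : R) (h : R -> tensor2 R n X)
    (Gam : set (X -> X)) : Prop :=
  [/\ Gam id,
      forall f f', Gam f -> Gam f' -> Gam (f \o f'),
      forall f, Gam f -> exists2 f', Gam f' & cancel f f' /\ cancel f' f &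
      forall f t, Gam f -> t0 <= t -> is_isometry MX (h t) f].

Definition free_action (Gam : set (X -> X)) : Prop :=
  forall f x, Gam f -> f x = x -> f = id.

Definition properly_discontinuous (Gam : set (X -> X)) : Prop :=
  forall K : set X, compact K ->
    finite_set [set f | Gam f /\ (f @` K) `&` K !=set0].

Definition orbit_rel (Gam : set (X -> X)) (x y : X) : Prop :=
  exists2 f, Gam f & y = f x.

End Spacetime.

Definition cexp (R : realType) (n : nat) : R :=
  match n with
  | 2%N => 0
  | 3%N => 3^-1
  | _ => (Num.sqrt n%:R - 1) / 2
  end.

(* Main.v *)
Require Import Defs.
From HB Require Import structures.
From mathcomp Require Import all_boot all_order all_algebra.
From mathcomp Require Import all_classical all_reals all_analysis.
From mathcomp Require Import ring lra.
Set Implicit Arguments.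
Unset Strict Implicit.
Unset Printing Implicit Defensive.
Import Order.TTheory GRing.Theory Num.Theory.
Import numFieldNormedType.Exports.
Local Open Scope classical_set_scope.
Local Open Scope ring_scope.

(* By homogeneity the expansion theta depends on t only. The Einstein equation of
   - dt^2 + h_t, with K = h_t' / 2 and |K|^2 = tr (h^-1 K h^-1 K), reads
     theta' = - |K|^2 - q   and   2 rho = R(h_t) + theta^2 - |K|^2,
   so that 0 <= q <= 2 rho and R(h_t) <= 0 give - theta^2 <= theta' <= 0: theta stays
   positive and decays at most like 1 / t. A causal geodesic with spatial velocity v
   has E' = - K(v, v) and h_t(v, v) <= E^2. Linear algebra for the h-self-adjoint
   endomorphism h^-1 K gives - K(v, v) theta <= c_n (|K|^2 + q) h(v, v), whence
   (log E)' <= - c_n (log theta)', which is the energy estimate.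
   For n <= 9 we have c_n <= 1 and E grows at most linearly in t, so t and E remain
   bounded on bounded parameter intervals. Local isometries psi carry a fixed chart
   of X around x0 to a neighbourhood of any point (left translations, composed with
   the projection for a quotient); since they preserve geodesics, every geodesic can
   be restarted from initial data at the base point of that chart, in a compact set
   of times and velocities. The existence time is then uniform, and no geodesic ends
   at a finite parameter. *)

(** * Calculus of C^k maps *)

(** The constant c_n solves an extremal problem. Write ka = - K(u,u) / h(u,u). With theta and ka
    fixed, |K|^2 is at least ka^2 + (theta + ka)^2 / (n - 1), and c_n is the largest value of ka
    theta / |K|^2 under the further constraint |K|^2 <= theta^2. The unconstrained maximum (sqrt n -
    1) / 2 is attained at ka = theta / sqrt n, where |K|^2 = 2 theta^2 / (n - sqrt n); this respects
    the constraint exactly when n >= 4, which is why n = 2 and n = 3 have their own constants. The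
    boundary t = t0 shapes the set-up: there, and at the initial parameter of a geodesic, only
    one-sided derivatives are available. The differential equations are therefore used at t > t0 and
    at interior parameters, where derivatives are two-sided, and the boundary values enter through
    right limits, computed from smooth extensions across the boundary. *)

Section DifferentiableExt.
Context (R : realType) (V W : normedModType R).

(** The differential is a chosen linear map, so the zero map is exhibited with remainder o(id) and
    identified with it by uniqueness. Locality of differentiability then follows by adding the
    locally vanishing difference of two functions. *)
Lemma near0_differentiable (f : V -> W) (x : V) :
  (\forall y \near x, f y = 0) -> differentiable f x.
Proof.
move=> f0; have fx0 : f x = 0 := nbhs_singleton f0.
have lin0 : linear (cst 0 : V -> W) by move=> a u v; rewrite /= scaler0 addr0.
pose l0 : {linear V -> W} := HB.pack (cst 0 : V -> W)
  (GRing.isLinear.Build _ _ _ _ _ lin0).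
have E : f \o shift x = cst (f x) + l0 +o_ 0 id.
  apply/eqaddoP => e e0 /=; rewrite fx0.
  have : \forall z \near (0 : V), f (z + x) = 0.
    by move: f0; rewrite (near_shift 0)/= subr0.
  apply: filterS => z fz.
  have -> : (f \o shift x - (cst 0 + cst 0)) z = f (z + x) - (0 + 0) by [].
  by rewrite fz addr0 subr0 normr0; exact: mulr_ge0 (ltW e0) (normr_ge0 _).
have D : 'd f x = l0 :> (V -> W) by apply: diff_unique => //; exact: cst_continuous.
apply/diff_locallyP; rewrite D; split => //.
exact: cst_continuous.
Qed.

Lemma near_eq_differentiable (f g : V -> W) (x : V) :
  (\forall y \near x, f y = g y) -> differentiable f x -> differentiable g x.
Proof.
move=> fg df; have -> : g = f + (g - f) by rewrite addrC subrK.
apply: differentiableD => //.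
apply: near0_differentiable; apply: filterS fg => y fgy.
by have -> : (g - f) y = g y - f y by []; rewrite fgy subrr.
Qed.

End DifferentiableExt.

Section CkGeneral.
Context (R : realType) (V W : normedModType R).
Implicit Types (U : set V) (f g : V -> W).

Lemma Ck_ext k U f g : open U -> (forall x, U x -> f x = g x) ->
  Ck k U f -> Ck k U g.
Proof.
move=> oU; elim: k f g => [|k IH] f g fg /=.
  move=> cf x Ux; move: (cf x Ux).
  rewrite /prop_for /continuous_at (fg _ Ux); apply: cvg_trans; apply: near_eq_cvg.
  by near=> y; apply/fg; near: y; exact: open_nbhs_nbhs.
have nfg x : U x -> \forall y \near x, f y = g y.
  by move=> Ux; near=> y; apply: fg; near: y; exact: open_nbhs_nbhs.
move=> [df Df]; split=> [x Ux|v].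
  exact: near_eq_differentiable (nfg x Ux) (df x Ux).
by apply: IH (Df v) => x Ux; apply: near_eq_derive; exact: nfg.
Unshelve. all: by end_near. Qed.

Lemma Ck_subset k U U' f : U' `<=` U -> Ck k U f -> Ck k U' f.
Proof.
move=> s; elim: k f => [|k IH] f /=; first by move=> cf x /s; exact: cf.
by move=> [df Df]; split=> [x /s|v]; [exact: df|exact/IH].
Qed.

Lemma Ck_local k U f :
  (forall x, U x -> exists2 U', U' x & Ck k U' f) -> Ck k U f.
Proof.
elim: k f => [|k IH] f H /=; first by move=> x /H[U' U'x]; exact.
split=> [x /H[U' U'x [+ _]]|v]; first exact.
by apply: IH => x /H[U' U'x [_ Df]]; exists U' => //; exact: Df.
Qed.

Lemma CkS k U f : Ck k.+1 U f -> Ck k U f.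
Proof.
elim: k f => [|k IH] f /= [df Df].
  by move=> x Ux; apply: differentiable_continuous; exact: df.
by split => // v; apply: IH; exact: Df.
Qed.

Lemma Ck_cst k U (w : W) : Ck k U (cst w).
Proof.
elim: k w => [|k IH] w /=; first by move=> x _; exact: cst_continuous.
split=> [x _|v]; first exact: differentiable_cst.
have -> : (fun x : V => 'D_v (cst w) x) = cst 0 by apply/funext=> x; rewrite derive_cst.
exact: IH.
Qed.

Lemma Ck_add k U f g : open U -> Ck k U f -> Ck k U g -> Ck k U (fun x => f x + g x).
Proof.
move=> oU; elim: k f g => [|k IH] f g /=.
  by move=> cf cg x Ux; apply: continuousD; [exact: cf|exact: cg].
move=> [df Df] [dg Dg]; split=> [x Ux|v].
  by apply: differentiableD; [exact: df|exact: dg].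
apply: Ck_ext (IH _ _ (Df v) (Dg v)) => // x Ux.
by rewrite -deriveD//; apply: diff_derivable; [exact: df|exact: dg].
Qed.

Lemma Ck_scale k U (a : R) f : open U -> Ck k U f -> Ck k U (fun x => a *: f x).
Proof.
move=> oU; elim: k f => [|k IH] f /=.
  by move=> cf x Ux; apply: (continuous_comp (cf x Ux)); exact: scaler_continuous.
move=> [df Df]; split=> [x Ux|v].
  by apply: differentiableZ; exact: df.
apply: Ck_ext (IH _ (Df v)) => // x Ux.
by rewrite -deriveZ//; apply: diff_derivable; exact: df.
Qed.

Lemma Ck_opp k U f : open U -> Ck k U f -> Ck k U (fun x => - f x).
Proof.
move=> oU Cf; apply: (@Ck_ext _ _ (fun x => -1 *: f x)) => //; last exact: Ck_scale.
by move=> x _; rewrite scaleN1r.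
Qed.

Lemma Ck_sub k U f g : open U -> Ck k U f -> Ck k U g -> Ck k U (fun x => f x - g x).
Proof. by move=> oU Cf Cg; apply: Ck_add => //; exact: Ck_opp. Qed.

Lemma Ck_sum k U (I : Type) (r : seq I) (P : pred I) (F : I -> V -> W) : open U ->
  (forall i, P i -> Ck k U (F i)) -> Ck k U (fun x => \sum_(i <- r | P i) F i x).
Proof.
move=> oU H; elim: r => [|i r IH].
  apply: Ck_ext (Ck_cst k U 0) => // x _; by rewrite big_nil.
have [Pi|nPi] := boolP (P i).
  apply: Ck_ext (Ck_add oU (H i Pi) IH) => // x _; by rewrite big_cons Pi.
by apply: Ck_ext IH => // x _; rewrite big_cons (negbTE nPi).
Qed.

Lemma Ck_linear k U (f : {linear V -> W}) : continuous f -> Ck k U f.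
Proof.
case: k => [|k] cf /=; first by move=> x _; exact: cf.
split=> [x _|v]; first exact: linear_differentiable.
have -> : (fun x : V => 'D_v f x) = cst (f v).
  apply/funext => x; rewrite deriveE; last exact: linear_differentiable.
  by rewrite diff_lin.
exact: Ck_cst.
Qed.

Lemma Ck_id k U' : Ck k (U' : set V) (fun x => x).
Proof.
case: k => [|k] /=; first by move=> x _; exact: cvg_id.
split=> [x _|v]; first exact: (@ex_diff _ _ _ _ _ _ id).
have -> : (fun x : V => 'D_v (fun x => x) x) = cst v by apply/funext => x; rewrite derive_id.
elim: k v => [|k IH] v /=; first by move=> x _; exact: cst_continuous.
split=> [x _|w]; first exact: differentiable_cst.
have -> : (fun x : V => 'D_w (cst v) x) = cst 0 by apply/funext=> x; rewrite derive_cst.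
exact: IH.
Qed.

End CkGeneral.

Section CkScalar.
Context (R : realType) (V : normedModType R).
Implicit Types (U : set V) (f g : V -> R).

Lemma Ck_mul k U f g : open U -> Ck k U f -> Ck k U g -> Ck k U (fun x => f x * g x).
Proof.
move=> oU; elim: k f g => [|k IH] f g.
  by move=> /= cf cg x Ux; apply: continuousM; [exact: cf|exact: cg].
move=> Cf Cg; move: (Cf) (Cg) => [df Df] [dg Dg]; split=> [x Ux|v].
  by apply: differentiableM; [exact: df|exact: dg].
apply: Ck_ext (Ck_add oU (IH _ _ (CkS Cf) (Dg v)) (IH _ _ (CkS Cg) (Df v))) => // x Ux.
by rewrite (deriveM (diff_derivable (df x Ux)) (diff_derivable (dg x Ux))).
Qed.

Lemma Ck_prod k U (I : Type) (r : seq I) (P : pred I) (F : I -> V -> R) : open U ->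
  (forall i, P i -> Ck k U (F i)) -> Ck k U (fun x => \prod_(i <- r | P i) F i x).
Proof.
move=> oU H; elim: r => [|i r IH].
  apply: Ck_ext (Ck_cst k U (1 : R)) => // x _; by rewrite big_nil.
have [Pi|nPi] := boolP (P i).
  apply: Ck_ext (Ck_mul oU (H i Pi) IH) => // x _; by rewrite big_cons Pi.
by apply: Ck_ext IH => // x _; rewrite big_cons (negbTE nPi).
Qed.

(** The derivative of the inverse is a product of [f'] and two copies of the inverse itself, so the
    induction on [k] closes. *)
Lemma Ck_inv k U f : open U -> (forall x, U x -> f x != 0) ->
  Ck k U f -> Ck k U (fun x => (f x)^-1).
Proof.
move=> oU f0; elim: k => [|k IH].
  by move=> /= cf x Ux; apply: continuousV; [exact: f0|exact: cf].
move=> Cf; move: (Cf) => [df Df]; split=> [x Ux|v].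
  by apply: differentiableV; [exact: df|exact: f0].
have Ci := IH (CkS Cf).
apply: Ck_ext (Ck_opp oU (Ck_mul oU (Ck_mul oU Ci Ci) (Df v))) => // x Ux.
rewrite deriveV; [|exact: f0|apply: diff_derivable; exact: df].
by rewrite scaleNr [in RHS]/GRing.scale /= expr2 invfM.
Qed.

End CkScalar.

Section CkMatrix.
Context (R : realType) (V : normedModType R) (m n : nat).
Implicit Types (U : set V) (f : V -> 'M[R]_(m, n)).

Lemma Ck_entry k U f i j : open U -> Ck k U f -> Ck k U (fun x => f x i j).
Proof.
move=> oU; elim: k f => [|k IH] f.
  move=> /= cf x Ux; apply: (@continuous_comp _ _ _ f (fun M => M i j)); first exact: cf.
  exact: coord_continuous.
move=> [df Df]; split=> [x Ux|v].
  apply: (@differentiable_comp _ _ _ _ f (fun M => M i j)); first exact: df.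
  exact: differentiable_coord.
apply: Ck_ext (IH _ (Df v)) => // x Ux.
by rewrite derive_mx ?mxE//; apply: diff_derivable; exact: df.
Qed.

Lemma Ck_scalel k U (f : V -> R) (w : 'M[R]_(m, n)) : open U ->
  Ck k U f -> Ck k U (fun x => f x *: w).
Proof.
move=> oU; elim: k f => [|k IH] f.
  move=> /= cf x Ux; apply: (@continuous_comp _ _ _ f (fun a => a *: w)); first exact: cf.
  exact: scalel_continuous.
move=> [df Df]; split=> [x Ux|v].
  by apply: differentiableZl; exact: df.
apply: Ck_ext (IH _ (Df v)) => // x Ux.
have dfx := df _ Ux.
by rewrite !deriveE ?diffZl //; exact: differentiableZl.
Qed.

Lemma Ck_mx k U f : open U -> (forall i j, Ck k U (fun x => f x i j)) -> Ck k U f.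
Proof.
move=> oU H.
apply: (@Ck_ext _ _ _ _ _ (fun x => \sum_i \sum_j f x i j *: delta_mx i j)) => //.
  by move=> x _; rewrite -matrix_sum_delta.
by do 2!(apply: Ck_sum => // ? _); exact: Ck_scalel.
Qed.

End CkMatrix.

Section DeriveEntries.
Context (R : realType) (V : normedModType R) (m n : nat).
Implicit Types (M : V -> 'M[R]_(m, n)).

Lemma is_derive_entry M dM x v i j :
  is_derive x v M dM -> is_derive x v (fun t => M t i j) (dM i j).
Proof.
move=> [dM1 <-]; split; first by move/derivable_mxP : dM1; exact.
by rewrite [in RHS]derive_mx// mxE.
Qed.

Lemma is_derive_mx M (dM : 'M[R]_(m, n)) x v :
  (forall i j, is_derive x v (fun t => M t i j) (dM i j)) -> is_derive x v M dM.
Proof.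
move=> H; have d : derivable M x v by apply/derivable_mxP => i j; have [] := H i j.
by split => //; apply/matrixP => i j; rewrite derive_mx// mxE; have [] := H i j.
Qed.

End DeriveEntries.

Section CkMatrixOps.
Context (R : realType) (V : normedModType R).
Implicit Types (U : set V).

Lemma Ck_mulmx k U m n p (f : V -> 'M[R]_(m, n)) (g : V -> 'M[R]_(n, p)) : open U ->
  Ck k U f -> Ck k U g -> Ck k U (fun x => f x *m g x).
Proof.
move=> oU Cf Cg; apply: Ck_mx => // i j.
apply: (@Ck_ext _ _ _ _ _ (fun x => \sum_l f x i l * g x l j)) => //.
  by move=> x _; rewrite mxE.
by apply: Ck_sum => // l _; apply: Ck_mul => //; exact: Ck_entry.
Qed.

Lemma Ck_trace k U n (f : V -> 'M[R]_n) : open U ->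
  Ck k U f -> Ck k U (fun x => \tr (f x)).
Proof.
move=> oU Cf; apply: (@Ck_ext _ _ _ _ _ (fun x => \sum_i f x i i)) => //.
by apply: Ck_sum => // i _; exact: Ck_entry.
Qed.

Lemma Ck_det k U n (f : V -> 'M[R]_n) : open U ->
  Ck k U f -> Ck k U (fun x => \det (f x)).
Proof.
move=> oU Cf; rewrite /determinant.
apply: Ck_sum => // s _; apply: Ck_mul => //; first exact: Ck_cst.
by apply: Ck_prod => // i _; exact: Ck_entry.
Qed.

Lemma Ck_invmx k U n (f : V -> 'M[R]_n) : open U ->
  (forall x, U x -> f x \in unitmx) -> Ck k U f -> Ck k U (fun x => invmx (f x)).
Proof.
move=> oU uf Cf; apply: Ck_mx => // i j.
(* Cramer's rule: each entry is a cofactor divided by the determinant. *)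
apply: (@Ck_ext _ _ _ _ _ (fun x => (\det (f x))^-1 *
   ((-1) ^+ (j + i) * \det (row' j (col' i (f x)))))) => //.
  by move=> x Ux; rewrite /invmx (uf _ Ux) !mxE.
apply: Ck_mul => //.
  by apply: Ck_inv => //; [move=> x /uf; rewrite unitmxE unitfE|exact: Ck_det].
apply: Ck_mul => //; first exact: Ck_cst.
apply: Ck_det => //; apply: Ck_mx => // a b.
apply: (@Ck_ext _ _ _ _ _ (fun x => f x (lift j a) (lift i b))) => //.
  by move=> x _; rewrite !mxE.
exact: Ck_entry.
Qed.

Lemma derive_comp_rV n (W : normedModType R) (f : V -> 'rV[R]_n) (g : 'rV[R]_n -> W) x v :
  differentiable f x -> differentiable g (f x) ->
  'D_v (g \o f) x = \sum_i 'D_v f x 0 i *: 'D_(delta_mx 0 i) g (f x).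
Proof.
move=> df dg; rewrite deriveE; last exact: differentiable_comp.
rewrite diff_comp //= -(deriveE _ df) {1}['D_v f x]row_sum_delta linear_sum.
by apply: eq_bigr => i _; rewrite linearZ /= -deriveE.
Qed.

(** For scalar [g] the chain rule in coordinates is a finite sum of products, and each partial
    derivative of [g] is again scalar valued, so the induction hypothesis applies to its composite
    with [f]. *)
Lemma Ck_comp_scalar k U n (U' : set 'rV[R]_n) (f : V -> 'rV[R]_n) (g : 'rV[R]_n -> R) :
  open U -> open U' -> (forall x, U x -> U' (f x)) ->
  Ck k U f -> Ck k U' g -> Ck k U (g \o f).
Proof.
move=> oU oU' s; elim: k g => [|k IH] g.
  by move=> cf cg x Ux; apply: continuous_comp; [exact: cf|exact/cg/s].
move=> Cf [dg Dg]; have [df Df] := Cf; split=> [x Ux|v].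
  by apply: differentiable_comp; [exact: df|exact/dg/s].
apply: (@Ck_ext _ _ _ _ _
  (fun x => \sum_i 'D_v f x 0 i * ('D_(delta_mx 0 i) g \o f) x)) => //.
  by move=> x Ux; rewrite derive_comp_rV //; [exact: df|exact/dg/s].
apply: Ck_sum => // i _; apply: Ck_mul => //; first exact: Ck_entry (Df v).
exact: IH (CkS Cf) (Dg _).
Qed.

Lemma Ck_comp k U n p q (U' : set 'rV[R]_n) (f : V -> 'rV[R]_n)
    (g : 'rV[R]_n -> 'M[R]_(p, q)) :
  open U -> open U' -> (forall x, U x -> U' (f x)) ->
  Ck k U f -> Ck k U' g -> Ck k U (g \o f).
Proof.
move=> oU oU' s Cf Cg; apply: Ck_mx => // i j.
exact: (Ck_comp_scalar oU oU' s Cf (Ck_entry i j oU' Cg)).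
Qed.

End CkMatrixOps.

(** * Directional derivatives along lines and Schwarz' theorem *)

Section Lines.
Context (R : realType) (V W : normedModType R).

Lemma is_derive_line (f : V -> W) (y u : V) (t : R) :
  derivable f (y + t *: u) u ->
  is_derive t 1 (fun r : R => f (y + r *: u)) ('D_u f (y + t *: u)).
Proof.
move=> df.
have E : (fun h : R => h^-1 *: (((fun r : R => f (y + r *: u)) \o shift t) (h *: (1 : R)) - f (y + t *: u)))
  = (fun h => h^-1 *: ((f \o shift (y + t *: u)) (h *: u) - f (y + t *: u))).
  apply/funext => h /=; congr (_ *: (f _ - _)).
  by rewrite scalerDl [X in X *: u]mulr1 addrCA.
by split; rewrite /derivable /derive E.
Qed.

(** A two-sided limit restricts to the right; this is the bridge from the one-sided derivatives of
    the definitions to ordinary calculus. *)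
Lemma rder_derive (f : V -> W) (a v : V) : derivable f a v -> rder f a v = 'D_v f a.
Proof.
move=> df; rewrite /rder; apply: cvg_lim => //.
have -> : (fun s : R => s^-1 *: (f (a + s *: v) - f a)) =
  (fun h => h^-1 *: ((f \o shift a) (h *: v) - f a)).
  by apply/funext => h /=; rewrite [a + _]addrC.
exact: cvg_dnbhs_at_right.
Qed.

End Lines.

Lemma smooth_on_Ck (R : realType) (V W : normedModType R) (U : set V) (f : V -> W) k :
  open U -> smooth_on U f -> Ck k U f.
Proof.
move=> oU sf; apply: Ck_local => x Ux; have [U' [F [oU' U'x CF FE]]] := sf _ Ux.
exists (U `&` U') => //; apply: (@Ck_ext _ _ _ _ _ F); first exact: openI.
  by move=> y [Uy U'y]; exact: FE.
by apply: Ck_subset (CF k) => y [].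
Qed.

Lemma MVT_open (R : realType) (f df : R -> R) (a b : R) : a < b ->
  (forall x, a <= x <= b -> is_derive x 1 f (df x)) ->
  exists2 c, a < c < b & f b - f a = df c * (b - a).
Proof.
move=> ab H; have [c + E] : exists2 c, c \in `]a, b[%R & f b - f a = df c * (b - a).
  apply: MVT => //.
    by move=> r; rewrite in_itv/= => /andP[r0 rs]; apply: H; rewrite !ltW.
  apply: derivable_within_continuous => r; rewrite in_itv/= => /H[]; exact.
by rewrite in_itv/= => cab; exists c.
Qed.

Section Schwarz.
Context (R : realType) (V : normedModType R) (U : set V) (f : V -> R).
Hypotheses (oU : open U) (Cf : Ck 2 U f).

(* Being symmetric in [u] and [v], the second difference is also computed by the
   other mixed derivative: letting [s] tend to 0 gives Schwarz' theorem. *)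
Lemma second_difference (x u v : V) (s : R) : 0 < s ->
  (forall a b, 0 <= a <= s -> 0 <= b <= s -> U (x + a *: u + b *: v)) ->
  exists a b, [/\ 0 <= a <= s, 0 <= b <= s &
    f (x + s *: u + s *: v) - f (x + s *: u) - f (x + s *: v) + f x =
    s ^+ 2 * 'D_v ('D_u f) (x + a *: u + b *: v)].
Proof.
move=> s0 H; have [df Df] := Cf.
have ss : 0 <= s <= s by rewrite (ltW s0) lexx.
have s00 : 0 <= (0 : R) <= s by apply/andP; split; [exact: lexx|exact: ltW].
pose g : R -> R := fun r => f (x + s *: v + r *: u) - f (x + r *: u).
have dg (r : R) : 0 <= r <= s ->
    is_derive r 1 g ('D_u f (x + s *: v + r *: u) - 'D_u f (x + r *: u)).
  move=> rs; apply: is_deriveB; apply: is_derive_line; apply: diff_derivable; apply: df.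
    by rewrite addrAC; exact: H.
  by have := H _ _ rs s00; rewrite scale0r addr0.
have [a /andP[a0 as_] ga] := MVT_open s0 dg.
have aI : 0 <= a <= s by rewrite !ltW.
pose k : R -> R := fun r => 'D_u f (x + a *: u + r *: v).
have dk (r : R) : 0 <= r <= s ->
    is_derive r 1 k ('D_v ('D_u f) (x + a *: u + r *: v)).
  move=> rs; apply: is_derive_line; apply: diff_derivable.
  by have [+ _] := Df u; apply; exact: H.
have [b /andP[b0 bs] kb] := MVT_open s0 dk.
exists a, b; split=> //; first by rewrite !ltW.
move: ga kb; rewrite /g /k !scale0r !addr0 !subr0 => ga kb.
rewrite [x + s *: v + a *: u]addrAC kb in ga.
rewrite -mulrA mulrC -expr2 in ga; rewrite -ga [x + s *: v + s *: u]addrAC.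
by rewrite opprB addrA [in RHS]addrAC.
Qed.

End Schwarz.

Lemma continuous_pair_ball (R : realType) (V : normedModType R) (U : set V)
  (f g : V -> R) (x : V) (e : R) : open U -> U x -> 0 < e ->
  {for x, continuous f} -> {for x, continuous g} ->
  exists2 d, 0 < d & forall y, ball x d y ->
    [/\ U y, `|f x - f y| < e & `|g x - g y| < e].
Proof.
move=> oU Ux e0 cf cg.
have n3 : \forall y \near x, U y by apply: open_nbhs_nbhs.
have n1 : \forall y \near x, `|f x - f y| < e by apply: (iffLR (cvgrPdist_lt _ _) cf).
have n2 : \forall y \near x, `|g x - g y| < e by apply: (iffLR (cvgrPdist_lt _ _) cg).
have : \forall y \near x, U y /\ (`|f x - f y| < e /\ `|g x - g y| < e).
  by apply: filterI => //; exact: filterI.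
move=> /nbhs_ballP[d /= d0 dN].
by exists d => // y /dN[? []].
Qed.

Lemma second_difference_inj (R : realType) (A A' B C D S p q : R) : S != 0 -> A = A' ->
  A - B - C + D = S * p -> A' - C - B + D = S * q -> p = q.
Proof. by move=> S0 -> h1; rewrite [_ - C - B]addrAC h1 => /(mulfI S0). Qed.

Lemma dist_le_half (R : realType) (e p q r s : R) : r = s ->
  `|p - r| < e / 2 -> `|q - s| < e / 2 -> `|q - p| <= e.
Proof.
move=> -> lp lq; have -> : q - p = (q - s) - (p - s) by rewrite opprB subrKA.
by rewrite (splitr e) (le_trans (ler_normB _ _))// lerD// ltW.
Qed.

Lemma derive_symmetric (R : realType) (V : normedModType R) (U : set V) (f : V -> R)
  (x u v : V) : open U -> Ck 2 U f -> U x -> 'D_u ('D_v f) x = 'D_v ('D_u f) x.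
Proof.
move=> oU Cf Ux; have [df Df] := Cf.
have [dfu Dfu] := Df u; have [dfv Dfv] := Df v.
apply/eqP; rewrite -subr_eq0 -normr_le0; apply/ler_addgt0Pr => e e0; rewrite add0r.
have e2 : 0 < e / 2 by rewrite divr_gt0.
have c1 := Dfu v _ Ux; have c2 := Dfv u _ Ux.
have [d d0 dN] := continuous_pair_ball oU Ux e2 c1 c2.
(* With this [s], every x + a u + b v with a and b in [0, s] lies in the ball of radius [d]. *)
pose s := d / 2 / (`|u| + `|v| + 1).
have D0 : 0 < `|u| + `|v| + 1 by rewrite ltr_wpDl// addr_ge0.
have s0 : 0 < s by rewrite !divr_gt0.
have H a b : 0 <= a <= s -> 0 <= b <= s -> ball x d (x + a *: u + b *: v).
  move=> /andP[a0 as_] /andP[b0 bs].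
  rewrite -ball_normE /= -addrA opprD addrA subrr sub0r normrN.
  apply: (le_lt_trans (ler_normD _ _)); rewrite !normrZ !ger0_norm//.
  apply: (@le_lt_trans _ _ (s * (`|u| + `|v| + 1))).
    by rewrite mulrDr mulr1 mulrDr ler_wpDr// ?(ltW s0)// lerD// ler_wpM2r.
  by rewrite /s -mulrA mulVf ?gt_eqF// mulr1 ltr_pdivrMr// ltr_pMr// ltr1n.
have [a [b [aI bI E1]]] := @second_difference _ _ _ _ Cf x u v s s0
  (fun a b ha hb => let: And3 h _ _ := dN _ (H a b ha hb) in h).
have H' a' b' : 0 <= a' <= s -> 0 <= b' <= s -> ball x d (x + a' *: v + b' *: u).
  by move=> ha hb; rewrite addrAC; exact: H.
have [a' [b' [aI' bI' E2]]] := @second_difference _ _ _ _ Cf x v u s s0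
  (fun a b ha hb => let: And3 h _ _ := dN _ (H' a b ha hb) in h).
have E3 : f (x + s *: u + s *: v) = f (x + s *: v + s *: u) by rewrite addrAC.
have E := second_difference_inj (expf_neq0 2 (lt0r_neq0 s0)) E3 E1 E2.
have [_ h1 _] := dN _ (H a b aI bI); have [_ _ h2] := dN _ (H' a' b' aI' bI').
exact: dist_le_half E h1 h2.
Qed.

(** * Positive definite forms and the energy exponent *)

Section PosDef.
Context (R : rcfType).

Definition posdef n (h : 'M[R]_n) := forall v : 'rV_n, v != 0 -> 0 < (v *m h *m v^T) 0 0.

Lemma posdef_unitmx n (h : 'M[R]_n) : posdef h -> h \in unitmx.
Proof.
move=> pd; rewrite -row_free_unit; apply: inj_row_free => v vh.
apply/eqP; apply: contraT => /pd; by rewrite vh mul0mx mxE ltxx.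
Qed.

(** Gaussian elimination by congruence: clearing the first row and column leaves the Schur
    complement [d']. It is positive definite because its value at w is that of [h] at the vector
    extending w by - w b^T / a; the pivot [a] is normalised by its square root. *)
Lemma posdef_congr1 n (h : 'M[R]_n) : h^T = h -> posdef h ->
  exists C : 'M[R]_n, C *m h *m C^T = 1%:M.
Proof.
elim: n h => [|n IH] h hs pd.
  by exists 1%:M; apply/matrixP => -[].
suff step (h' : 'M[R]_(1 + n)) : h'^T = h' -> posdef h' ->
  exists C : 'M[R]_(1 + n), C *m h' *m C^T = 1%:M by exact: step hs pd.
move: h' => {}h {}hs {}pd.
pose a := h 0 0; pose b : 'rV_n := ursubmx h; pose d : 'M[R]_n := drsubmx h.
have hE : h = block_mx a%:M b b^T d.
  rewrite -[LHS]submxK; congr block_mx; last by rewrite /b trmx_ursub hs.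
  by apply/matrixP => i j; rewrite !mxE !ord1 /= mulr1n; congr (h _ _); apply/val_inj.
have a0 : 0 < a.
  have := pd (delta_mx 0 0).
  rewrite -rowE trmx_delta -colE !mxE; apply; apply/eqP => /matrixP/(_ 0 0)/eqP.
  by rewrite !mxE !eqxx oner_eq0.
have aN : a != 0 by rewrite gt_eqF.
pose d' := d - a^-1 *: (b^T *m b).
have ds : d^T = d by rewrite /d -{2}hs; apply/matrixP => i j; rewrite !mxE.
have d's : d'^T = d' by rewrite /d' linearB linearZ /= trmx_mul trmxK ds.
have pd' : posdef d'.
  move=> w w0; have := pd (row_mx (- a^-1 *: (w *m b^T)) w).
  have -> : row_mx (- a^-1 *: (w *m b^T)) w *m h = row_mx (0 : 'M[R]_1) (w *m d').
    rewrite hE mul_row_block; congr row_mx.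
      by rewrite mul_mx_scalar scalerA mulrN mulfV// scaleN1r addNr.
    by rewrite /d' mulmxBr -scalemxAr -scalemxAl scaleNr mulmxA addrC.
  rewrite tr_row_mx mul_row_col mul0mx add0r; apply.
  by apply: contraNneq w0 => /eqP; rewrite row_mx_eq0 => /andP[].
have [C' C'E] := IH _ d's pd'.
pose s := (Num.sqrt a)^-1.
have sas : s * a * s = 1.
  rewrite /s -[in X in _ * X * _](sqr_sqrtr (ltW a0)) expr2 mulrA mulVf ?mul1r ?mulfV//;
  by rewrite gt_eqF// sqrtr_gt0.
exists (block_mx s%:M 0 (- a^-1 *: (C' *m b^T)) C').
rewrite hE mulmx_block tr_block_mx mulmx_block.
rewrite !trmx0 !tr_scalar_mx !mul0mx !mulmx0 !addr0.
have -> : - a^-1 *: (C' *m b^T) *m a%:M + C' *m b^T = 0.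
  by rewrite mul_mx_scalar scalerA mulrN mulfV// scaleN1r addNr.
have -> : - a^-1 *: (C' *m b^T) *m b + C' *m d = C' *m d'.
  by rewrite /d' mulmxBr -scalemxAr -scalemxAl scaleNr mulmxA addrC.
rewrite !mul0mx add0r C'E scalar_mx_block; congr block_mx.
- by rewrite -!scalar_mxM sas.
- rewrite linearZ /= trmx_mul trmxK -scalar_mxM mul_scalar_mx scalerA mul_scalar_mx -scalemxAl.
  by rewrite mulrN -mulrA mulfV// mulr1 scaleNr addNr.
Qed.

Lemma posdef_inv_square n (h : 'M[R]_n) : h^T = h -> posdef h ->
  exists C : 'M[R]_n, invmx h = C^T *m C.
Proof.
move=> hs pd; have [C CE] := posdef_congr1 hs pd; exists C.
have hu := posdef_unitmx pd.
apply: (can_inj (mulmxK hu)); rewrite mulVmx//.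
have CE' : C *m (h *m C^T) = 1%:M by rewrite mulmxA.
have := mulmx1C CE'; by rewrite -mulmxA => /mulmx1C ->.
Qed.

(** With h^-1 = C^T C the trace is that of the square of the symmetric matrix C W C^T, a sum of
    squares of entries. *)
Lemma mxtrace_sqr_ge0 n (h W : 'M[R]_n) : h^T = h -> posdef h -> W^T = W ->
  0 <= \tr (invmx h *m W *m (invmx h *m W)).
Proof.
move=> hs pd Ws; have [C ->] := posdef_inv_square hs pd.
set M := C *m W *m C^T.
have Ms : M^T = M by rewrite /M !trmx_mul trmxK Ws mulmxA.
have -> : \tr (C^T *m C *m W *m (C^T *m C *m W)) = \tr (M *m M^T).
  rewrite Ms /M -!mulmxA mxtrace_mulC !mulmxA; congr (\tr _).
rewrite /mxtrace; apply: sumr_ge0 => i _; rewrite mxE; apply: sumr_ge0 => j _.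
by rewrite [M^T _ _]mxE -expr2 sqr_ge0.
Qed.

(** Nonnegativity of the squared distance from h^-1 K to the minimiser of the norm among
    self-adjoint endomorphisms with trace [th] and value - ka on [u]. Its eigenvalues are - ka,
    once, and (th + ka) / (n - 1), n - 1 times, and its squared norm is the left-hand side. *)
Lemma mxtrace_sqr_ge n (h K : 'M[R]_n) (u : 'rV_n) :
  (1 < n)%N -> h^T = h -> posdef h -> K^T = K -> u != 0 ->
  let th := \tr (invmx h *m K) in
  let ka := - (u *m K *m u^T) 0 0 / (u *m h *m u^T) 0 0 in
  ka ^+ 2 + (th + ka) ^+ 2 / (n%:R - 1) <= \tr (invmx h *m K *m (invmx h *m K)).
Proof.
move=> n1 hs pd Ks u0; cbv zeta.
set th := \tr _; set ka := - _ / _.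
have hu := posdef_unitmx pd.
have nN : n%:R - 1 != 0 :> R by rewrite subr_eq0 pnatr_eq1 gtn_eqF.
set e := (u *m h *m u^T) 0 0; have e0 : 0 < e by exact: pd.
have eN : e != 0 by rewrite gt_eqF.
set A := invmx h *m K.
pose P : 'M[R]_n := e^-1 *: (u^T *m u *m h).
(* [B] agrees with the self-adjoint [A] in its trace and in its [u]-[u] entry [- ka],
   and is the scalar [mu] on the orthogonal complement of [u]. *)
pose mu := (th + ka) / (n%:R - 1).
pose B := mu *: 1%:M - (mu + ka) *: P.
have uhu : u *m h *m u^T = e%:M by rewrite [LHS]mx11_scalar.
have PP : P *m P = P.
  rewrite /P -scalemxAl -scalemxAr scalerA.
  have -> : u^T *m u *m h *m (u^T *m u *m h) = u^T *m (u *m h *m u^T) *m (u *m h).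
    by rewrite !mulmxA.
  by rewrite uhu mul_mx_scalar -scalemxAl scalerA mulfVK// mulmxA.
have trP : \tr P = 1.
  by rewrite /P mxtraceZ -mulmxA mxtrace_mulC uhu mxtrace_scalar mulr1n mulVf.
have trAP : \tr (A *m P) = - ka.
  rewrite /P -scalemxAr mxtraceZ /A mxtrace_mulC -!mulmxA (mulmxA h) mulmxV// mul1mx.
  rewrite mxtrace_mulC -mulmxA mulmxA [X in \tr X]mx11_scalar mxtrace_scalar mulr1n.
  by rewrite /ka mulNr opprK mulrC.
have trA : \tr A = th by [].
have trB (X Y : 'M[R]_n) : \tr (X - Y) = \tr X - \tr Y by exact: raddfB.
have W0 : 0 <= \tr ((A - B) *m (A - B)).
  (* [W] is A - B with its index lowered; the symmetry of [W] is the self-adjointness of A - B. *)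
  pose W := K - (mu *: h - ((mu + ka) / e) *: (h *m u^T *m u *m h)).
  have Ws : W^T = W.
    by rewrite /W !linearB /= !linearZ /= !trmx_mul trmxK hs Ks !mulmxA.
  suff -> : A - B = invmx h *m W by exact: mxtrace_sqr_ge0.
  rewrite /W /B /A mulmxBr; congr (_ - _).
  rewrite mulmxBr -!scalemxAr mulVmx//; congr (_ - _).
  by rewrite /P scalerA !mulmxA mulVmx// mul1mx.
clearbody P.
have trAB : \tr (A *m B) = mu * th + (mu + ka) * ka.
  by rewrite /B mulmxBr -!scalemxAr mulmx1 trB !mxtraceZ trAP trA mulrN opprK.
have trBB : \tr (B *m B) = mu ^+ 2 * n%:R - (mu ^+ 2 - ka ^+ 2).
  have -> : B *m B = mu ^+ 2 *: 1%:M - (mu ^+ 2 - ka ^+ 2) *: P.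
    rewrite {1}/B mulmxBl -!scalemxAl mul1mx {2}/B mulmxBr -scalemxAr mulmx1 -scalemxAr PP.
    rewrite /B !scalerBr !scalerA -[X in _ - X]scalerBl -addrA -opprD -scalerDl.
    by congr (_ *: _ - _ *: _); ring.
  by rewrite trB !mxtraceZ trP mxtrace1; ring.
clearbody B.
have E : \tr ((A - B) *m (A - B)) = \tr (A *m A) - 2 * \tr (A *m B) + \tr (B *m B).
  rewrite mulmxBl !mulmxBr !trB (mxtrace_mulC B A); ring.
move: W0; rewrite E trAB trBB -/A => W0.
suff -> : ka ^+ 2 + (th + ka) ^+ 2 / (n%:R - 1) =
  2 * (mu * th + (mu + ka) * ka) - (mu ^+ 2 * n%:R - (mu ^+ 2 - ka ^+ 2)) by lra.
by rewrite /mu; field.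
Qed.

End PosDef.

Section Exponent.
Context (R : realType).

Lemma cexp_ge0 n : (1 < n)%N -> 0 <= cexp R n.
Proof.
case: n => [|[|[|[|n]]]]// _; first by rewrite /= invr_ge0.
rewrite /cexp divr_ge0// subr_ge0 -{1}sqrtr1 ler_wsqrtr// ler1n //.
Qed.

(** The bound on the dimension enters here: (sqrt n - 1) / 2 <= 1 means sqrt n <= 3. *)
Lemma cexp_le1 n : (1 < n)%N -> (n <= 9)%N -> cexp R n <= 1.
Proof.
case: n => [|[|[|[|n]]]]// _ n9; first by rewrite /= invf_le1// ler1n.
rewrite /cexp ler_pdivrMr// mul1r lerBlDr.
have -> : 2 + 1 = Num.sqrt (3 ^+ 2) :> R by rewrite sqrtr_sqr ger0_norm// natr1.
by rewrite ler_wsqrtr// -natrX ler_nat.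
Qed.

(* For n >= 4 the gap is a square, (sqrt n * ka - th)^2 up to a positive factor; for
   n = 2, 3 the maximum is attained on the boundary N = th^2. *)
Lemma cexp_bound n (th ka N : R) : (1 < n)%N -> 0 < th ->
  ka ^+ 2 + (th + ka) ^+ 2 / (n%:R - 1) <= N -> N <= th ^+ 2 ->
  ka * th <= cexp R n * N.
Proof.
move=> n1 th0 H1 H2.
case: n n1 H1 => [|[|[|[|n]]]]// _ H1.
- have {}H1 : ka ^+ 2 + (th + ka) ^+ 2 <= N.
    move: H1; have -> : 2%:R - 1 = 1 :> R by ring.
    by rewrite divr1.
  by rewrite /cexp mul0r; nra.
- have {}H1 : ka ^+ 2 + (th + ka) ^+ 2 / 2 <= N.
    by move: H1; have -> : 3%:R - 1 = 2%:R :> R by ring.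
  rewrite /cexp.
  suff : 3 * (ka * th) <= N by lra.
  (* The two hypotheses combine to (3 ka - th) (ka + th) <= 0. Given ka <= th / 3, the claim follows
     from (3 ka - th) (ka - th) >= 0. *)
  have : ka <= th / 3 by nra.
  nra.
rewrite /cexp; set m := n.+4 in H1 *.
set s := Num.sqrt m%:R.
have sE : m%:R = s ^+ 2 by rewrite sqr_sqrtr.
have s1 : 1 < s by rewrite -sqrtr1 ltr_sqrt// ltr1n.
apply: (@le_trans _ _ ((s - 1) / 2 * (ka ^+ 2 + (th + ka) ^+ 2 / (m%:R - 1)))); last first.
  by rewrite ler_wpM2l// divr_ge0// subr_ge0 ltW.
rewrite sE -subr_ge0.
have -> : (s - 1) / 2 * (ka ^+ 2 + (th + ka) ^+ 2 / (s ^+ 2 - 1)) - ka * th =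
  (s * ka - th) ^+ 2 / (2 * (s + 1)).
  field; apply/andP; split => //; nra.
by rewrite divr_ge0 ?sqr_ge0// mulr_ge0//; lra.
Qed.

(** The source [q] is absorbed at no cost: N <= N + q <= th^2 supplies the constraint of
    [cexp_bound], and c_n N <= c_n (N + q) since c_n >= 0. *)
Lemma energy_rate_bound n (h K : 'M[R]_n) (v : 'rV_n) (q : R) :
  let th := \tr (invmx h *m K) in
  let N := \tr (invmx h *m K *m (invmx h *m K)) in
  (1 < n)%N -> h^T = h -> posdef h -> K^T = K -> 0 < th -> 0 <= q -> N + q <= th ^+ 2 ->
  - (v *m K *m v^T) 0 0 * th <= cexp R n * (N + q) * (v *m h *m v^T) 0 0.
Proof.
move=> th N n1 hs pd Ks th0 q0 Nq.
have [->|v0] := eqVneq v 0; first by rewrite !mul0mx mxE oppr0 !mul0r mulr0.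
have e0 := pd v v0.
have := mxtrace_sqr_ge n1 hs pd Ks v0.
rewrite /= -/th -/N => H.
have {}H := cexp_bound n1 th0 H (le_trans _ Nq).
rewrite -ler_pdivrMr// -mulrAC; apply: le_trans (H _) _; first by rewrite lerDl.
by rewrite mulrDr lerDl mulr_ge0// cexp_ge0.
Qed.

End Exponent.

(** * Ordinary differential equations: existence, uniqueness, dependence of the existence time *)

Section RowNorm.
Context (R : realType) (n : nat).
Implicit Types x y : 'rV[R]_n.

Lemma rV_norm_le x (c : R) : 0 <= c -> (`|x| <= c) <-> (forall i, `|x 0 i| <= c).
Proof.
move=> c0; rewrite {1}/Num.norm /= mx_normrE; split=> [/bigmax_leP[_ H] i|H].
  exact: (H (0, i) isT).
by apply/bigmax_leP; split=> // -[a i] _; rewrite (ord1 a); exact: H.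
Qed.

Lemma rV_coord_le x i : `|x 0 i| <= `|x|.
Proof. by apply: (iffLR (rV_norm_le x (normr_ge0 _))). Qed.

End RowNorm.

Section Clamp.
Context (R : realType).

(** For a <= b this is a 1-Lipschitz retraction of the line on [a, b]; composing with it extends
    functions from an interval, or in each coordinate from a cube, to the whole space. *)
Definition clamp (a b x : R) := Num.max a (Num.min b x).

Lemma clamp_id a b x : a <= x <= b -> clamp a b x = x.
Proof. by move=> /andP[ax xb]; rewrite /clamp (min_idPr xb) (max_idPr ax). Qed.

Lemma clamp_itv a b x : a <= b -> a <= clamp a b x <= b.
Proof. by move=> ab; rewrite /clamp le_max lexx /= ge_max ab ge_min lexx. Qed.

Lemma clamp_lip a b x y : `|clamp a b x - clamp a b y| <= `|x - y|.
Proof.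
have mx u v : `|Num.max a u - Num.max a v| <= `|u - v|.
  have := ler_norm (u - v); have := ler_norm (v - u); rewrite [`|v - u|]distrC.
  by rewrite ler_norml => *; apply/andP; case: (leP a u); case: (leP a v); split; lra.
have mn u v : `|Num.min b u - Num.min b v| <= `|u - v|.
  have := ler_norm (u - v); have := ler_norm (v - u); rewrite [`|v - u|]distrC.
  by rewrite ler_norml => *; apply/andP; case: (leP b u); case: (leP b v); split; lra.
exact: le_trans (mx _ _) (mn _ _).
Qed.

Lemma clamp_continuous a b : continuous (clamp a b).
Proof.
move=> x; apply/cvgrPdist_lt => e e0; near=> y.
apply: le_lt_trans (clamp_lip _ _ _ _) _; near: y.
by exists e.
Unshelve. all: by end_near. Qed.

End Clamp.

Section Antiderivative.
Context (R : realType).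

Lemma antiderivative (g : R -> R) (e : R) : 0 < e -> continuous g ->
  exists2 F : R -> R, F 0 = 0 & forall s, - e <= s <= e -> is_derive s 1 F (g s).
Proof.
move=> e0 cg.
(* The lower limit lies strictly below - e, so that the fundamental theorem applies at every point
   of [- e, e], endpoints included. *)
pose G y := (\int[@lebesgue_measure R]_(t in [set` `[- e - 1, y]]) (g t))%R.
exists (fun y => G y - G 0); first by rewrite subrr.
move=> s /andP[se1 se2].
have intg : (@lebesgue_measure R).-integrable `[- e - 1, e + 1] (EFin \o g).
  apply: continuous_compact_integrable; first exact: segment_compact.
  exact: continuous_subspaceT.
have h1 : s < e + 1 by lra.
have h2 : - e - 1 < s by lra.
have [dG EG] := continuous_FTC1_closed h1 intg h2 (cg s).
have dG' : is_derive s 1 G (g s) by split; [exact: dG|rewrite -derive1E; exact: EG].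
clearbody G; have -> : g s = g s - 0 by rewrite subr0.
exact: is_deriveB dG' (is_derive_cst (G 0) s 1).
Qed.

Lemma rV_antiderivative n (g : R -> 'rV[R]_n) (e : R) (p : 'rV[R]_n) : 0 < e -> continuous g ->
  exists2 F : R -> 'rV[R]_n, F 0 = p & forall s, - e <= s <= e -> is_derive s 1 F (g s).
Proof.
move=> e0 cg.
have H i : exists F : R -> R, F 0 = 0 /\ forall s, - e <= s <= e -> is_derive s 1 F (g s 0 i).
  have ci : continuous (fun s => g s 0 i).
    by move=> s; apply: (@continuous_comp _ _ _ g (fun M => M 0 i)); [exact: cg|exact: coord_continuous].
  by have [F F0 dF] := antiderivative e0 ci; exists F.
have [F HF] := choice H.
exists (fun s => p + \row_i F i s).
  by apply/rowP => i; rewrite !mxE (HF i).1 addr0.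
move=> s se; have -> : g s = 0 + g s by rewrite add0r.
apply: is_deriveD.
apply: is_derive_mx => a i.
have -> : (fun s0 : R => (\row_i F i s0) a i) = F i.
  by apply/funext => x; rewrite mxE.
by rewrite (ord1 a); exact: (HF i).2.
Qed.

(** For the maximum norm the mean value theorem is applied in each coordinate, without loss in the
    constant. *)
Lemma rV_mean_value n (u u' : R -> 'rV[R]_n) (a b B : R) :
  (forall x, a <= x <= b -> is_derive x 1 u (u' x)) ->
  (forall x, a <= x <= b -> `|u' x| <= B) ->
  forall s t, a <= s <= b -> a <= t <= b -> `|u s - u t| <= B * `|s - t|.
Proof.
move=> du Bu.
have main s t : a <= s -> s < t -> t <= b -> `|u s - u t| <= B * `|s - t|.
  move=> as_ st tb.
  have B0 : 0 <= B by apply: le_trans (Bu s _); rewrite ?normr_ge0// as_ (le_trans (ltW st)).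
  apply/rV_norm_le; first by rewrite mulr_ge0.
  move=> i; have dui x : s <= x <= t -> is_derive x 1 (fun y => u y 0 i) (u' x 0 i).
    move=> /andP[sx xt]; have xI : a <= x <= b by rewrite (le_trans as_)//= (le_trans xt).
    exact: is_derive_entry 0 i (du x xI).
  have [c /andP[sc ct] E] := MVT_open st dui.
  rewrite !mxE distrC E normrM [X in _ <= _ * X]distrC ler_wpM2r//.
  apply: le_trans (rV_coord_le _ _) (Bu _ _).
  by rewrite (le_trans as_ (ltW sc)) (le_trans (ltW ct)).
move=> s t /andP[as_ sb] /andP[at_ tb].
have [st|ts|->] := ltgtP s t; [exact: main|by rewrite distrC [X in _ * X]distrC; exact: main|].
by rewrite !subrr !normr0 mulr0.
Qed.

End Antiderivative.

Lemma geometric_small (R : realType) (C d : R) : 0 <= C -> 0 < d ->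
  exists k : nat, C / 2 ^+ k < d.
Proof.
move=> C0 d0; have : (fun k => C * (2^-1) ^+ k) @ \oo --> C * (0 : R).
  by apply: cvgMr; apply: cvg_expr; rewrite ger0_norm// invf_lt1 ?ltr1n.
rewrite mulr0 => /cvgr0Pnorm_lt /(_ _ d0)[K _ HK].
exists K; move: (HK K (leqnn _)); rewrite /= exprVn ger0_norm//.
by rewrite divr_ge0// exprn_ge0.
Qed.

Section GeometricCauchy.
Context (R : realType) (V : completeNormedModType R).

Lemma geometric_cauchy (x : nat -> V) (C : R) : 0 <= C ->
  (forall k, `|x k.+1 - x k| <= C / 2 ^+ k) ->
  exists2 l : V, x @ \oo --> l & forall k, `|l - x k| <= 2 * C / 2 ^+ k.
Proof.
move=> C0 H.
have H2 k j : `|x (k + j)%N - x k| <= 2 * C / 2 ^+ k.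
  (* Subtracting the tail turns the bound into a telescoping one, for which the induction on [j]
     closes. *)
  suff : `|x (k + j)%N - x k| <= 2 * C / 2 ^+ k - 2 * C / 2 ^+ (k + j).
    move=> h; apply: le_trans h _; rewrite gerBl divr_ge0// ?mulr_ge0// exprn_ge0//.
  elim: j => [|j IH]; first by rewrite addn0 !subrr normr0.
  rewrite addnS -(subrK (x (k + j)%N) (x (k + j).+1)) -addrA.
  apply: le_trans (ler_normD _ _) _; apply: le_trans (lerD (H _) IH) _.
  rewrite exprS invfM; set q := (2 ^+ (k + j))^-1; set r := (2 ^+ k)^-1; lra.
have cx : cvgn x.
  apply/cauchy_cvgP; apply/cauchy_ballP => e e0; near_simpl.
  have [K HK] := geometric_small (mulr_ge0 (ler0n R 2) C0) (divr_gt0 e0 (ltr0n R 2)).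
  pose A := [set k | (K <= k)%N].
  exists (A, A); first by split; exists K.
  move=> n [/= n1 n2]; rewrite -ball_normE /=.
  have h1 := H2 K (n.1 - K)%N; have h2 := H2 K (n.2 - K)%N.
  rewrite !subnKC// in h1 h2.
  rewrite -(subrKA (x K)) (splitr e); apply: le_lt_trans (ler_normD _ _) _.
  by apply: ltrD; [apply: le_lt_trans h1 HK|rewrite distrC; apply: le_lt_trans h2 HK].
exists (lim (x @ \oo)) => // k.
have cxk : (fun j => `|x j - x k|) @ \oo --> `|lim (x @ \oo) - x k|.
  by apply: cvg_norm; apply: cvgB => //; exact: cvg_cst.
rewrite -(cvg_lim _ cxk)//; apply: limr_le; first by apply/cvg_ex; exists (`|limn x - x k|).
by exists k => // j /= kj; rewrite -(subnKC kj).
Qed.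

End GeometricCauchy.

Lemma rV_geometric_cauchy (R : realType) n (x : nat -> 'rV[R]_n) (C : R) : 0 <= C ->
  (forall k, `|x k.+1 - x k| <= C / 2 ^+ k) ->
  exists l : 'rV[R]_n, forall k, `|l - x k| <= 2 * C / 2 ^+ k.
Proof.
move=> C0 H.
have /choice[l Hl] : forall i, exists l : R, forall k, `|l - x k 0 i| <= 2 * C / 2 ^+ k.
  move=> i; have [|l _ Hl] := geometric_cauchy (x := fun k => x k 0 i) C0; last by exists l.
  by move=> k; have := le_trans (rV_coord_le _ i) (H k); rewrite !mxE.
exists (\row_i l i) => k; apply/rV_norm_le.
  by rewrite divr_ge0 ?mulr_ge0// exprn_ge0.
by move=> i; rewrite !mxE.
Qed.

Lemma lipschitz_continuous (R : realType) (V W : normedModType R) (f : V -> W) (L : R) :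
  0 <= L -> (forall x y, `|f x - f y| <= L * `|x - y|) -> continuous f.
Proof.
move=> L0 flip x; apply/cvgrPdist_lt => d d0.
have L1 : 0 < L + 1 by rewrite ltr_wpDl.
have : \forall y \near x, ball x (d / (L + 1)) y.
  by apply: nbhsx_ballx; rewrite divr_gt0.
apply: filterS => y; rewrite -ball_normE /= => xy.
apply: (@le_lt_trans _ _ (L * `|x - y|)); first exact: flip.
apply: (@le_lt_trans _ _ ((L + 1) * `|x - y|)); first by rewrite ler_wpM2r// lerDl.
by rewrite mulrC -ltr_pdivlMr.
Qed.

Section Picard.
Context (R : realType) (n : nat) (f : 'rV[R]_n -> 'rV[R]_n) (L e : R) (p : 'rV[R]_n).
Hypotheses (L0 : 0 <= L) (e0 : 0 < e) (Le : L * e <= 2^-1).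
Hypothesis flip : forall x y, `|f x - f y| <= L * `|x - y|.

Let cf : continuous f.
Proof. exact: lipschitz_continuous L0 flip. Qed.

Let cl := clamp (- e) e.
Let clP s : - e <= cl s <= e.
Proof. by apply: clamp_itv; rewrite (@le_trans _ _ 0)// ?oppr_le0 ltW. Qed.

Let step (a : R -> 'rV[R]_n) : continuous a -> exists b : R -> 'rV[R]_n,
  continuous b /\ exists2 F : R -> 'rV[R]_n, F 0 = p /\ b = F \o cl &
    forall s, - e <= s <= e -> is_derive s 1 F (f (a s)).
Proof.
move=> ca; have cfa : continuous (f \o a).
  by move=> s; apply: continuous_comp; [exact: ca|exact: cf].
have [F F0 dF] := rV_antiderivative p e0 cfa.
exists (F \o cl); split; last by exists F.
move=> s; apply: continuous_comp; first exact: clamp_continuous.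
apply: differentiable_continuous; apply/derivable1_diffP.
by have [] := dF _ (clP s).
Qed.

(** Iterates are bundled with their continuity, which the antiderivative defining the next one
    requires. *)
Let next (a : {a : R -> 'rV[R]_n | continuous a}) : {a : R -> 'rV[R]_n | continuous a} :=
  let w := cid (step (proj2_sig a)) in exist _ (proj1_sig w) (proj1 (proj2_sig w)).

Let cp : continuous (cst p : R -> 'rV[R]_n).
Proof. by move=> x; exact: cst_continuous. Qed.

Let it k := proj1_sig (iter k next (exist (fun a : R -> 'rV[R]_n => continuous a) (cst p) cp)).

Let itS k : exists2 F : R -> 'rV[R]_n, F 0 = p /\ it k.+1 = F \o cl &
    forall s, - e <= s <= e -> is_derive s 1 F (f (it k s)).
Proof. by rewrite /it iterS /next /=; case: cid => /= b []. Qed.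

Let it_step k (B : R) : 0 <= B -> (forall s, `|it k.+1 s - it k s| <= B) ->
  forall s, `|it k.+2 s - it k.+1 s| <= B / 2.
Proof.
move=> B0 H s.
have [F [F0 ->] dF] := itS k.+1; have [G [G0 ->] dG] := itS k.
have z0 : - e <= (0 : R) <= e by rewrite oppr_le0 ltW.
have d x : - e <= x <= e -> is_derive x 1 (F - G) (f (it k.+1 x) - f (it k x)).
  by move=> xe; apply: is_deriveB; [exact: dF|exact: dG].
have := rV_mean_value d (B := L * B) _ (clP s) z0.
have -> : (F - G) (cl s) = F (cl s) - G (cl s) by [].
have -> : (F - G) 0 = 0 by rewrite -[LHS]/(F 0 - G 0) F0 G0 subrr.
rewrite !subr0 => h; apply: le_trans (h _) _.
  by move=> x _; apply: le_trans (flip _ _) _; rewrite ler_wpM2l.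
have : `|cl s| <= e by rewrite ler_norml.
move=> cle; apply: (@le_trans _ _ (L * B * e)); first by rewrite ler_wpM2l// mulr_ge0.
by rewrite mulrAC mulrC ler_wpM2l.
Qed.

(** Since L e <= 1/2, successive iterates approach each other geometrically and converge to a
    continuous [u]. The solution returned is the antiderivative [v] of f \o u, differentiable by
    construction; comparing [v] with the iterates shows that it equals [u] on the interval. *)
Lemma picard_local : exists2 u : R -> 'rV[R]_n, u 0 = p &
  forall s, - e < s < e -> is_derive s 1 u (f (u s)).
Proof.
have z0 : - e <= (0 : R) <= e by rewrite oppr_le0 ltW.
pose C := `|f p| * e.
have C0 : 0 <= C by rewrite mulr_ge0// ltW.
have H0 s : `|it 1 s - it 0 s| <= C.
  have [F [F0 ->] dF] := itS 0.
  have := rV_mean_value dF (B := `|f p|) _ (clP s) z0; rewrite F0 subr0 => h.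
  apply: le_trans (h _) _; first by move=> x _; rewrite /it.
  by rewrite ler_wpM2l// ler_norml.
have Hk k s : `|it k.+1 s - it k s| <= C / 2 ^+ k.
  elim: k s => [|k IH] s; first by rewrite expr0 divr1.
  have Ck : 0 <= C / 2 ^+ k by rewrite divr_ge0// exprn_ge0.
  by apply: le_trans (it_step Ck IH s) _; rewrite exprS invfM mulrA mulrAC.
have /choice[u Hu] : forall s, exists l : 'rV[R]_n,
    forall k, `|l - it k s| <= 2 * C / 2 ^+ k.
  by move=> s; exact: rV_geometric_cauchy C0 (fun k => Hk k s).
have small d : 0 < d -> exists k : nat, 2 * C / 2 ^+ k < d.
  by apply: geometric_small; rewrite mulr_ge0.
have itc k : continuous (it k) by rewrite /it; case: (iter _ _ _).
have cu : continuous u.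
  move=> s; apply/cvgrPdist_lt => d d0.
  have [k Hkd] := small (d / 3) (divr_gt0 d0 (ltr0n R 3)).
  have : \forall t \near s, `|it k s - it k t| < d / 3.
    by apply: (iffLR (cvgrPdist_lt _ _) (itc k s)); rewrite divr_gt0.
  apply: filterS => t ht.
  have -> : u s - u t = (u s - it k s) + (it k s - it k t) - (u t - it k t).
    by rewrite subrKA opprB subrKA.
  apply: le_lt_trans (ler_normB _ _) _.
  apply: le_lt_trans (lerD (ler_normD _ _) (lexx _)) _.
  have := Hu s k; have := Hu t k; lra.
have cfu : continuous (f \o u).
  by move=> s; apply: continuous_comp; [exact: cu|exact: cf].
have [v v0 dv] := rV_antiderivative p e0 cfu.
have uv s : - e <= s <= e -> v s = u s.
  move=> se; apply/eqP; rewrite -subr_eq0 -normr_le0; apply/ler_addgt0Pr => d d0; rewrite add0r.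
  have [k Hkd] := small (d / 2) (divr_gt0 d0 (ltr0n R 2)).
  have [F [F0 FE] dF] := itS k.
  have Fs : it k.+1 s = F s by rewrite FE /= /cl clamp_id.
  have dvF x : - e <= x <= e -> is_derive x 1 (v - F) (f (u x) - f (it k x)).
    by move=> xe; apply: is_deriveB; [exact: dv|exact: dF].
  have := rV_mean_value dvF (B := L * (2 * C / 2 ^+ k)) _ se z0.
  have -> : (v - F) s = v s - F s by [].
  have -> : (v - F) 0 = 0 by rewrite -[LHS]/(v 0 - F 0) v0 F0 subrr.
  rewrite !subr0 => h.
  have {}h : `|v s - F s| <= 2 * C / 2 ^+ k.
    apply: le_trans (h _) _.
      by move=> x _; apply: le_trans (flip _ _) _; rewrite ler_wpM2l.
    have se' : `|s| <= e by rewrite ler_norml.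
    set q := 2 * C / 2 ^+ k; have q0 : 0 <= q by rewrite /q divr_ge0// mulr_ge0.
    apply: (@le_trans _ _ (L * q * e)); first by rewrite ler_wpM2l// mulr_ge0.
    rewrite mulrAC; apply: (@le_trans _ _ (2^-1 * q)); first by rewrite ler_wpM2r.
    by rewrite ler_piMl// invf_le1// ler1n.
  have -> : v s - u s = (v s - F s) - (u s - it k.+1 s) by rewrite Fs opprB subrKA.
  apply: le_trans (ler_normB _ _) _.
  have h2 := Hu s k.+1.
  have : 2 * C / 2 ^+ k.+1 <= 2 * C / 2 ^+ k.
    have q0 : 0 <= 2 * C / 2 ^+ k by rewrite divr_ge0// mulr_ge0.
    by rewrite exprS invfM mulrCA ler_piMl// invf_le1// ler1n.
  lra.
exists v => // s /andP[se1 se2].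
have se : - e <= s <= e by rewrite !ltW.
by rewrite uv//; exact: dv.
Qed.

End Picard.

Section LocalFlow.
Context (R : realType) (n : nat).
Implicit Types (f : 'rV[R]_n -> 'rV[R]_n) (p : 'rV[R]_n).

(* Composing with the retraction on a cube makes a locally Lipschitz field globally
   Lipschitz, as [picard_local] requires. *)
Definition rV_clamp (p0 : 'rV[R]_n) (r : R) (x : 'rV[R]_n) : 'rV[R]_n :=
  \row_i clamp (p0 0 i - r) (p0 0 i + r) (x 0 i).

Lemma rV_clamp_lip p0 r x y : `|rV_clamp p0 r x - rV_clamp p0 r y| <= `|x - y|.
Proof.
apply/rV_norm_le => // i; rewrite !mxE; apply: le_trans (clamp_lip _ _ _ _) _.
by have := rV_coord_le (x - y) i; rewrite !mxE.
Qed.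

Lemma rV_clamp_in p0 r x : 0 <= r -> `|rV_clamp p0 r x - p0| <= r.
Proof.
move=> r0; apply/rV_norm_le => // i; rewrite !mxE ler_distl.
by apply: clamp_itv; rewrite lerBlDr -addrA lerDl addr_ge0.
Qed.

Lemma rV_clamp_id p0 r x : `|x - p0| <= r -> rV_clamp p0 r x = x.
Proof.
move=> xr; apply/rowP => i; rewrite mxE clamp_id// -ler_distl.
by have := le_trans (rV_coord_le _ i) xr; rewrite !mxE.
Qed.

(** L e <= 1/2 makes the iteration contract. M e <= r / 2 keeps a solution starting in the half ball
    inside the ball of radius [r], where clamping is the identity, so the clamped field may be
    replaced by [f]. The time [e] serves all initial values of the half ball. *)
Lemma ode_exists f p0 (r L M e : R) : 0 <= L -> 0 < e -> L * e <= 2^-1 -> M * e <= r / 2 ->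
  (forall x y, `|x - p0| <= r -> `|y - p0| <= r -> `|f x - f y| <= L * `|x - y|) ->
  (forall x, `|x - p0| <= r -> `|f x| <= M) ->
  forall p, `|p - p0| <= r / 2 -> exists2 u : R -> 'rV[R]_n, u 0 = p &
    forall s, - e < s < e -> `|u s - p0| <= r /\ is_derive s 1 u (f (u s)).
Proof.
move=> L0 e0 Le Me fl fM p pr.
have r0 : 0 <= r by have := le_trans (normr_ge0 _) pr; rewrite pmulr_lge0.
have gl x y : `|f (rV_clamp p0 r x) - f (rV_clamp p0 r y)| <= L * `|x - y|.
  apply: le_trans (fl _ _ _ _) _; [exact: rV_clamp_in|exact: rV_clamp_in|].
  by rewrite ler_wpM2l// rV_clamp_lip.
have [u u0 du] := picard_local p L0 e0 Le gl.
have M0 : 0 <= M by apply: le_trans (fM p0 _); rewrite ?normr_ge0// subrr normr0.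
have ur s : - e < s < e -> `|u s - p0| <= r.
  move=> /andP[s1 s2].
  have H x : - `|s| <= x <= `|s| -> - e < x < e.
    move=> /andP[x1 x2]; have := ltr_norml s e; rewrite s1 s2 => se.
    by rewrite (le_lt_trans x2 se) andbT (lt_le_trans _ x1)// ltrN2.
  have sI : - `|s| <= s <= `|s| by rewrite -ler_norml.
  have zI : - `|s| <= (0 : R) <= `|s| by rewrite oppr_le0 normr_ge0.
  have := rV_mean_value (fun x hx => du x (H x hx)) (B := M) _ sI zI.
  rewrite u0 subr0 => h.
  rewrite -(subrK p (u s)) -addrA (splitr r); apply: le_trans (ler_normD _ _) _.
  apply: lerD => //; apply: le_trans (h _) _; first by move=> x _; apply/fM/rV_clamp_in.
  by apply: le_trans Me; rewrite ler_wpM2l// ltW// ltr_norml s1 s2.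
exists u => // s se; split; first exact: ur.
by have := du s se; rewrite rV_clamp_id//; exact: ur.
Qed.

Lemma derive_rV (W : normedModType R) (g : 'rV[R]_n -> W) (x v : 'rV[R]_n) :
  differentiable g x -> 'D_v g x = \sum_j v 0 j *: 'D_(delta_mx 0 j) g x.
Proof.
move=> dg; rewrite deriveE// {1}(row_sum_delta v) linear_sum.
by apply: eq_bigr => j _; rewrite linearZ /= -deriveE.
Qed.

Lemma norm_le_add1 (W : normedModType R) (a b : W) : `|a - b| < 1 -> `|b| <= `|a| + 1.
Proof.
by rewrite distrC => h; rewrite -lerBlDl; exact: le_trans (lerB_dist _ _) (ltW h).
Qed.

(** Continuity of the partial derivatives bounds them on a small ball; by convexity the mean value
    inequality applies along its segments. *)
Lemma Ck1_lipschitz f (D : set 'rV[R]_n) p0 : open D -> Ck 1 D f -> D p0 ->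
  exists r L, [/\ 0 < r, 0 <= L, forall x, `|x - p0| <= r -> D x &
    forall x y, `|x - p0| <= r -> `|y - p0| <= r -> `|f x - f y| <= L * `|x - y|].
Proof.
move=> oD [df Df] Dp0.
pose B := \sum_j (`|'D_(delta_mx 0 j) f p0| + 1).
have : \forall x \near p0, D x /\ forall j, `|'D_(delta_mx 0 j) f x| <= `|'D_(delta_mx 0 j) f p0| + 1.
  apply: filterI; first exact: open_nbhs_nbhs.
  apply: (@filter_forall _ _ (fun j x => `|'D_(delta_mx 0 j) f x| <= `|'D_(delta_mx 0 j) f p0| + 1) _ (nbhs_filter p0)) => j.
  have := iffLR (cvgrPdist_lt _ _) (Df (delta_mx 0 j) p0 Dp0) _ (@ltr01 R).
  move=> /(_ _); apply: filterS => x hx.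
  exact: norm_le_add1 hx.
move=> /nbhs_ballP[d /= d0 dH].
have dH' x : `|x - p0| <= d / 2 -> ball p0 d x.
  move=> xr; rewrite -ball_normE /= distrC; apply: le_lt_trans xr _.
  by rewrite ltr_pdivrMr// ltr_pMr// ltr1n.
exists (d / 2), B; split; first by rewrite divr_gt0.
- by apply: sumr_ge0 => j _; rewrite addr_ge0.
- by move=> x /dH' /dH[].
move=> x y xr yr.
have sg (s : R) : 0 <= s <= 1 -> `|y + s *: (x - y) - p0| <= d / 2.
  move=> /andP[s0 s1].
  have -> : y + s *: (x - y) - p0 = (1 - s) *: (y - p0) + s *: (x - p0).
    by apply/rowP => i; rewrite !mxE; ring.
  apply: le_trans (ler_normD _ _) _; rewrite !normrZ !ger0_norm ?subr_ge0//.
  have -> : d / 2 = (1 - s) * (d / 2) + s * (d / 2) by ring.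
  by apply: lerD; rewrite ler_wpM2l// subr_ge0.
have dg (s : R) : 0 <= s <= 1 -> is_derive s 1 (fun s : R => f (y + s *: (x - y)))
     ('D_(x - y) f (y + s *: (x - y))).
  by move=> /sg/dH'/dH[Dz _]; apply: is_derive_line; apply: diff_derivable; exact: df.
have z1 : 0 <= (1 : R) <= 1 by rewrite ler01 lexx.
have z0 : 0 <= (0 : R) <= 1 by rewrite ler01 lexx.
have := rV_mean_value dg (B := B * `|x - y|) _ z1 z0.
rewrite scale1r scale0r addr0 subr0 normr1 mulr1 [y + _]addrC subrK; apply.
move=> s /sg/dH'/dH[Dz Hz]; rewrite derive_rV; last exact: df.
apply: le_trans (ler_norm_sum _ _ _) _; rewrite mulr_suml; apply: ler_sum => j _.
by rewrite normrZ mulrC ler_pM//; exact: rV_coord_le.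
Qed.

(** Existence is stated for every [d] in ]0, e]: it then holds for all [d] near 0+, the form in
    which compactness yields one time for a whole box. *)
Lemma ode_local f (D : set 'rV[R]_n) p0 : open D -> Ck 1 D f -> D p0 ->
  exists r L e, [/\ 0 < r, 0 <= L, 0 < e, (forall x, `|x - p0| <= r -> D x) /\
    (forall x y, `|x - p0| <= r -> `|y - p0| <= r -> `|f x - f y| <= L * `|x - y|) &
    forall d, 0 < d <= e -> forall p, `|p - p0| <= r / 2 ->
      exists2 u : R -> 'rV[R]_n, u 0 = p &
      forall s, - d < s < d -> `|u s - p0| <= r /\ is_derive s 1 u (f (u s))].
Proof.
move=> oD Cf Dp0; have [r [L [r0 L0 rD fl]]] := Ck1_lipschitz oD Cf Dp0.
pose M := `|f p0| + L * r.
have fM x : `|x - p0| <= r -> `|f x| <= M.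
  move=> xr; rewrite -(subrK (f p0) (f x)) addrC /M.
  apply: le_trans (ler_normD _ _) _; rewrite lerD2l.
  apply: le_trans (fl _ _ xr _) _; first by rewrite subrr normr0 ltW.
  by rewrite ler_wpM2l.
have M0 : 0 <= M by rewrite addr_ge0// mulr_ge0// ltW.
pose e := Num.min (2^-1 / (L + 1)) (r / 2 / (M + 1)).
have L1 : 0 < L + 1 by rewrite ltr_wpDl.
have M1 : 0 < M + 1 by rewrite ltr_wpDl.
have e0 : 0 < e by rewrite lt_min !divr_gt0// invr_gt0.
exists r, L, e; split => // d /andP[d0]; rewrite le_min => /andP[de1 de2] p pr.
apply: (ode_exists L0 d0 _ _ fl fM pr).
  apply: (@le_trans _ _ ((L + 1) * d)); first by rewrite ler_wpM2r ?lerDl// ltW.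
  by rewrite mulrC -ler_pdivlMr.
apply: (@le_trans _ _ ((M + 1) * d)); first by rewrite ler_wpM2r ?lerDl// ltW.
by rewrite mulrC -ler_pdivlMr.
Qed.

Lemma rV_norm_sqr_le (x : 'rV[R]_n) : `|x| ^+ 2 <= \sum_i x 0 i ^+ 2.
Proof.
have S0 : 0 <= \sum_i x 0 i ^+ 2 by apply: sumr_ge0 => i _; exact: sqr_ge0.
rewrite -[leRHS](sqr_sqrtr S0) ler_pXn2r ?nnegrE ?sqrtr_ge0//.
apply/rV_norm_le; first exact: sqrtr_ge0.
move=> i; rewrite -sqrtr_sqr ler_wsqrtr// (bigD1 i)//= lerDl.
by apply: sumr_ge0 => j _; exact: sqr_ge0.
Qed.

(** Gronwall for the squared Euclidean distance [N], which is differentiable, unlike the maximum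
    norm. From |N'| <= C N, the function N exp (C s) is nondecreasing and N exp (- C s)
    nonincreasing, so the zero at [s0] spreads to both sides. *)
Lemma ode_unique f (B : set 'rV[R]_n) (L a b s0 : R) (u w : R -> 'rV[R]_n) :
  0 <= L -> (forall x y, B x -> B y -> `|f x - f y| <= L * `|x - y|) ->
  (forall s, a < s < b -> [/\ B (u s), B (w s), is_derive s 1 u (f (u s)) &
    is_derive s 1 w (f (w s))]) ->
  a < s0 < b -> u s0 = w s0 -> forall s, a < s < b -> u s = w s.
Proof.
move=> L0 fl H s0I us0.
pose N s := \sum_i (u s 0 i - w s 0 i) ^+ 2.
pose C := 2 * n%:R * L.
have N0 s : 0 <= N s by apply: sumr_ge0 => i _; exact: sqr_ge0.
have Ns0 : N s0 = 0 by rewrite /N us0 big1// => i _; rewrite subrr expr0n.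
have dN s : a < s < b -> exists2 N', is_derive s 1 N N' & `|N'| <= C * N s.
  move=> /H[Bu Bw du dw].
  have dc i : is_derive s 1 (fun t => u t 0 i - w t 0 i) (f (u s) 0 i - f (w s) 0 i).
    exact: is_deriveB (is_derive_entry 0 i du) (is_derive_entry 0 i dw).
  exists (\sum_i ((u s 0 i - w s 0 i) * (f (u s) 0 i - f (w s) 0 i) *+ 2)).
    have -> : N = \sum_i (fun t => (u t 0 i - w t 0 i) * (u t 0 i - w t 0 i)).
      by apply/funext => t; rewrite fct_sumE; apply: eq_bigr => i _; rewrite expr2.
    apply: is_derive_sum => i.
    apply: (is_derive_eq (is_deriveM (dc i) (dc i))).
    by rewrite mulr2n.
  apply: le_trans (ler_norm_sum _ _ _) _.
  have -> : C * N s = \sum_(i < n) (L * N s) *+ 2.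
    by rewrite sumr_const card_ord -mulrnA -[RHS]mulr_natl natrM /C; ring.
  apply: ler_sum => i _; rewrite normrMn lerMn2r /= normrM.
  have nN : `|u s - w s| ^+ 2 <= N s.
    apply: le_trans (rV_norm_sqr_le _) _; rewrite le_eqVlt; apply/orP; left; apply/eqP.
    by apply: eq_bigr => j _; rewrite !mxE.
  apply: (@le_trans _ _ (`|u s - w s| * (L * `|u s - w s|))).
    apply: ler_pM => //.
      by have := rV_coord_le (u s - w s) i; rewrite !mxE.
    by apply: le_trans (fl _ _ Bu Bw); have := rV_coord_le (f (u s) - f (w s)) i; rewrite !mxE.
  by rewrite mulrCA -expr2 ler_wpM2l.
have [N' dN'] : exists N' : R -> R, forall s, a < s < b -> is_derive s 1 N (N' s) /\ `|N' s| <= C * N s.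
  have /choice[N' HN'] : forall s, exists N's : R, a < s < b -> is_derive s 1 N N's /\ `|N's| <= C * N s.
    move=> s; have [/dN[x h1 h2]|_] := boolP (a < s < b); last by exists 0.
    by exists x.
  by exists N'.
have dE (k s : R) : is_derive s 1 (fun t => expR (k * t)) (k * expR (k * s)).
  have dk : is_derive s 1 (fun t : R => k * t) k.
    apply: (is_derive_eq (is_deriveZ k (is_derive_id s (1 : R)))).
    by rewrite [LHS]mulr1.
  apply: (is_derive_eq (is_derive1_comp (is_derive_expR (k * s)) dk)).
  by rewrite mulrC.
have dP (k s : R) : a < s < b ->
    is_derive s 1 (fun t => N t * expR (k * t)) ((N' s + k * N s) * expR (k * s)).
  move=> sI; apply: (is_derive_eq (is_deriveM (dN' s sI).1 (dE k s))).
  by rewrite /GRing.scale /=; ring.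
have key s : a < s < b -> N s <= 0.
  move=> sI; have [ss0|ss0|->] := ltgtP s s0; last by rewrite Ns0.
    have I x : s <= x <= s0 -> a < x < b by case/andP: sI; case/andP: s0I; lra.
    have [c /andP[c1 c2] E] := MVT_open ss0 (fun x hx => dP C x (I x hx)).
    have cI := I c _; rewrite !ltW// in cI.
    have /andP[h1 h2] : - (C * N c) <= N' c <= C * N c by rewrite -ler_norml (dN' c (cI isT)).2.
    rewrite Ns0 mul0r sub0r in E.
    have : 0 <= (N' c + C * N c) * expR (C * c) * (s0 - s).
      have h3 : 0 <= N' c + C * N c by lra.
      by apply: mulr_ge0; [exact: mulr_ge0 h3 (expR_ge0 _)|rewrite subr_ge0 ltW].
    rewrite -E oppr_ge0 pmulr_lle0// expR_gt0 //.
  have I x : s0 <= x <= s -> a < x < b by case/andP: sI; case/andP: s0I; lra.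
  have [c /andP[c1 c2] E] := MVT_open ss0 (fun x hx => dP (- C) x (I x hx)).
  have cI := I c _; rewrite !ltW// in cI.
  have /andP[h1 h2] : - (C * N c) <= N' c <= C * N c by rewrite -ler_norml (dN' c (cI isT)).2.
  rewrite Ns0 mul0r subr0 in E.
  have : (N' c + - C * N c) * expR (- C * c) * (s - s0) <= 0.
    have h3 : N' c + - C * N c <= 0 by lra.
    apply: mulr_le0_ge0; first exact: mulr_le0_ge0 h3 (expR_ge0 _).
    by rewrite subr_ge0 ltW.
  by rewrite -E pmulr_lle0// expR_gt0.
move=> s sI; apply/rowP => i; apply/eqP; rewrite -subr_eq0 -sqrf_eq0 eq_le sqr_ge0 andbT.
apply: le_trans (key s sI); rewrite /N (bigD1 i)//= lerDl.
by apply: sumr_ge0 => j _; exact: sqr_ge0.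
Qed.

End LocalFlow.

(** * Curvature of - dt^2 + h_t *)

Lemma rder_congr (R : realType) (V V' W : normedModType R) (f : V -> W) (f' : V' -> W)
  (a v : V) (a' v' : V') : (forall s, f (a + s *: v) = f' (a' + s *: v')) ->
  rder f a v = rder f' a' v'.
Proof.
move=> H; have H0 := H 0; rewrite !scale0r !addr0 in H0.
rewrite /rder; have -> // : (fun s : R => s^-1 *: (f (a + s *: v) - f a)) =
  (fun s : R => s^-1 *: (f' (a' + s *: v') - f' a')).
by apply/funext => s; rewrite H H0.
Qed.

Section BlockMetric.
Context (R : realType) (n : nat) (G : R -> 'rV[R]_n -> 'M[R]_n).

Definition block_metric (z : 'rV[R]_(1 + n)) : 'M[R]_(1 + n) :=
  block_mx (- 1)%:M 0 0 (G (lsubmx z 0 0) (rsubmx z)).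

Local Notation g := block_metric.
Local Notation i0 := (lshift n (ord0 : 'I_1)).
Local Notation r := (@rshift 1 n).

Lemma rder_cst (V W : normedModType R) (w : W) (a v : V) : rder (fun _ => w) a v = 0.
Proof.
rewrite /rder; apply: cvg_lim => //.
have -> : (fun s : R => s^-1 *: (w - w)) = fun=> 0.
  by apply/funext => s; rewrite subrr scaler0.
exact: cvg_cst.
Qed.

Lemma pd_time (f : 'rV[R]_(1 + n) -> R^o) (t : R) y :
  pd i0 f (row_mx t%:M y) = rder (fun s : R^o => f (row_mx s%:M y) : R^o) t 1.
Proof.
apply: rder_congr => s; congr f.
apply/rowP => i; case: (split_ordP i) => j ->.
  by rewrite mxE !row_mxEl !mxE eq_lshift !ord1 !eqxx !mulr1n.
by rewrite mxE !row_mxEr !mxE eq_rlshift mulr0 addr0.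
Qed.

Lemma pd_space (i : 'I_n) (f : 'rV[R]_(1 + n) -> R^o) (t : R) y :
  pd (r i) f (row_mx t%:M y) = pd i (fun y' => f (row_mx t%:M y') : R^o) y.
Proof.
apply: rder_congr => s; congr f.
apply/rowP => k; case: (split_ordP k) => j ->.
  by rewrite mxE !row_mxEl !mxE eq_lrshift mulr0 addr0.
by rewrite mxE !row_mxEr !mxE eq_rshift.
Qed.

Lemma block_metricE z i j : g z (r i) (r j) = G (lsubmx z 0 0) (rsubmx z) i j.
Proof. by rewrite /g block_mxEdr. Qed.

Lemma block_metric00 z : g z i0 i0 = -1.
Proof. by rewrite /g block_mxEul mxE eqxx. Qed.

Lemma block_metric0r z j : g z i0 (r j) = 0.
Proof. by rewrite /g block_mxEur mxE. Qed.

Lemma block_metricr0 z j : g z (r j) i0 = 0.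
Proof. by rewrite /g block_mxEdl mxE. Qed.

Lemma invmx_block_metric z :
  invmx (g z) = block_mx (- 1)%:M 0 0 (invmx (G (lsubmx z 0 0) (rsubmx z))).
Proof.
set D := G _ _; rewrite /g -/D.
have [uD|nD] := boolP (D \in unitmx); last first.
  (* For singular [D] both inverses take the default value of [invmx], its argument, and the formula
     persists. *)
  rewrite (invmx_out nD) invmx_out//.
  rewrite inE unitmxE det_lblock det_scalar unitrM negb_and; apply/orP; right.
  by rewrite -unitmxE.
have E : block_mx (- 1)%:M 0 0 (invmx D) *m block_mx (- 1)%:M 0 0 D = 1%:M :> 'M[R]_(1 + n).
  rewrite mulmx_block !mul0mx !mulmx0 !addr0 add0r mulVmx// -scalar_mxM mulrNN mulr1.
  by rewrite -scalar_mx_block.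
have [u1 u2] := mulmx1_unit E.
by apply: (can_inj (mulmxK u2)); rewrite mulVmx// E.
Qed.

Lemma inv_block00 z : invmx (g z) i0 i0 = -1.
Proof. by rewrite invmx_block_metric block_mxEul mxE eqxx. Qed.

Lemma inv_block0r z j : invmx (g z) i0 (r j) = 0.
Proof. by rewrite invmx_block_metric block_mxEur mxE. Qed.

Lemma inv_blockr0 z j : invmx (g z) (r j) i0 = 0.
Proof. by rewrite invmx_block_metric block_mxEdl mxE. Qed.

Lemma inv_blockrr z i j : invmx (g z) (r i) (r j) = invmx (G (lsubmx z 0 0) (rsubmx z)) i j.
Proof. by rewrite invmx_block_metric block_mxEdr. Qed.

Lemma pd_block00 k z : pd k (fun y => g y i0 i0) z = 0.
Proof. by rewrite /pd; under eq_fun do rewrite block_metric00; rewrite rder_cst. Qed.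

Lemma pd_block0r k j z : pd k (fun y => g y i0 (r j)) z = 0.
Proof. by rewrite /pd; under eq_fun do rewrite block_metric0r; rewrite rder_cst. Qed.

Lemma pd_blockr0 k j z : pd k (fun y => g y (r j) i0) z = 0.
Proof. by rewrite /pd; under eq_fun do rewrite block_metricr0; rewrite rder_cst. Qed.

Definition time_pd (i j : 'I_n) z := pd i0 (fun y => g y (r i) (r j)) z.

Local Notation pdE := (pd_block00, pd_block0r, pd_blockr0).
Local Notation invE := (inv_block00, inv_block0r, inv_blockr0).

Lemma christoffel_000 z : christoffel g i0 i0 i0 z = 0.
Proof.
rewrite /christoffel big_split_ord /= big_ord1 !pdE big1 => [|l _]; rewrite ?invE; ring.
Qed.

Lemma christoffel_00r j z : christoffel g i0 i0 (r j) z = 0.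
Proof.
rewrite /christoffel big_split_ord /= big_ord1 !pdE big1 => [|l _]; rewrite ?invE; ring.
Qed.

Lemma christoffel_0r0 j z : christoffel g i0 (r j) i0 z = 0.
Proof.
rewrite /christoffel big_split_ord /= big_ord1 !pdE big1 => [|l _]; rewrite ?invE; ring.
Qed.

Lemma christoffel_0rr i j z : christoffel g i0 (r i) (r j) z = 2^-1 * time_pd i j z.
Proof.
rewrite /christoffel big_split_ord /= big_ord1 !pdE big1 => [|l _]; rewrite ?invE /time_pd; ring.
Qed.

Lemma christoffel_r00 k z : christoffel g (r k) i0 i0 z = 0.
Proof.
rewrite /christoffel big_split_ord /= big_ord1 !pdE big1 => [|l _]; rewrite ?invE ?pdE; ring.
Qed.

Lemma christoffel_r0r k j z : christoffel g (r k) i0 (r j) z =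
  2^-1 * \sum_l invmx (G (lsubmx z 0 0) (rsubmx z)) k l * time_pd j l z.
Proof.
rewrite /christoffel big_split_ord /= big_ord1 !pdE invE mul0r add0r; congr (_ * _).
by apply: eq_bigr => l _; rewrite !pdE inv_blockrr /time_pd addr0 subr0.
Qed.

Lemma christoffel_rr0 k j z : christoffel g (r k) (r j) i0 z =
  2^-1 * \sum_l invmx (G (lsubmx z 0 0) (rsubmx z)) k l * time_pd j l z.
Proof.
rewrite /christoffel big_split_ord /= big_ord1 !pdE invE mul0r add0r; congr (_ * _).
by apply: eq_bigr => l _; rewrite !pdE inv_blockrr /time_pd add0r subr0.
Qed.

Lemma christoffel_rrr k i j t y :
  christoffel g (r k) (r i) (r j) (row_mx t%:M y) = christoffel (G t) k i j y.
Proof.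
have E a b : (fun y' => g (row_mx t%:M y') (r a) (r b) : R^o) = fun y' => G t y' a b.
  by apply/funext => y'; rewrite block_metricE row_mxKl row_mxKr mxE mulr1n.
rewrite /christoffel big_split_ord /= big_ord1 invE mul0r add0r; congr (_ * _).
by apply: eq_bigr => l _; rewrite !pd_space !E inv_blockrr row_mxKl row_mxKr mxE mulr1n.
Qed.

End BlockMetric.

Lemma rder_near (R : realType) (V W : normedModType R) (f g : V -> W) (a v : V) :
  (\forall x \near a, g x = f x) -> derivable g a v -> rder f a v = 'D_v g a.
Proof.
move=> gf dg; rewrite rder_derive; first exact/esym/near_eq_derive.
exact: near_eq_derivable gf dg.
Qed.

Lemma is_derive_mulmx (R : realType) (V : normedModType R) m n p
  (A : V -> 'M[R]_(m, n)) (B : V -> 'M[R]_(n, p)) x v (dA : 'M[R]_(m, n)) (dB : 'M[R]_(n, p)) :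
  is_derive x v A dA -> is_derive x v B dB ->
  is_derive x v (fun s => A s *m B s) (dA *m B x + A x *m dB).
Proof.
move=> hA hB; apply: is_derive_mx => i j.
have -> : (fun s => (A s *m B s) i j) = \sum_k (fun s => A s i k * B s k j).
  by apply/funext => s; rewrite mxE fct_sumE.
rewrite !mxE -big_split /=; apply: is_derive_sum => k.
apply: (is_derive_eq (is_deriveM (is_derive_entry i k hA) (is_derive_entry k j hB))).
by rewrite addrC; congr (_ + _); exact: mulrC.
Qed.

Lemma is_derive_trace (R : realType) (V : normedModType R) n
  (A : V -> 'M[R]_n) x v (dA : 'M[R]_n) :
  is_derive x v A dA -> is_derive x v (fun s => \tr (A s)) (\tr dA).
Proof.
move=> hA; have -> : (fun s => \tr (A s)) = \sum_k (fun s => A s k k).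
  by apply/funext => s; rewrite fct_sumE.
by apply: is_derive_sum => k; exact: is_derive_entry.
Qed.

Lemma Ck_derivable (R : realType) (V W : normedModType R) k (U : set V) (f : V -> W) x v :
  Ck k.+1 U f -> U x -> is_derive x v f ('D_v f x).
Proof. by move=> [df _] Ux; apply: derivableP; apply: diff_derivable; exact: df. Qed.

Lemma Ck_derivable1 (R : realType) (W : normedModType R) k (U : set R) (f : R -> W) x :
  Ck k.+1 U f -> U x -> is_derive x 1 f ('D_1 f x).
Proof. exact: Ck_derivable. Qed.

Section TimeCurve.
Context (R : realType) (n : nat) (H : R -> 'M[R]_n) (U : set R).
Hypotheses (oU : open U) (CH : forall k, Ck k U H).
Hypotheses (Hsym : forall s, U s -> (H s)^T = H s) (Hunit : forall s, U s -> H s \in unitmx).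

Definition second_form s := 2^-1 *: 'D_1 H s.
Definition mean_curvature s := \tr (invmx (H s) *m second_form s).

Lemma near_open s : U s -> \forall x \near s, U x.
Proof. by move=> Us; exact: open_nbhs_nbhs. Qed.

Lemma Ck_second_form k : Ck k U second_form.
Proof. by apply: Ck_scale => //; have [_] := CH k.+1; exact. Qed.

Lemma second_form_sym s : U s -> (second_form s)^T = second_form s.
Proof.
move=> Us; rewrite /second_form linearZ /=; congr (_ *: _).
have d := Ck_derivable1 (CH 1) Us.
apply/matrixP => i j; rewrite mxE !derive_mx ?mxE; try by case: d.
apply: near_eq_derive; apply: filterS (near_open Us) => x Ux.
by rewrite -{1}(Hsym Ux) mxE.
Qed.

(** Differentiate H^-1 H = 1, valid on all of [U]; the factor 2 comes from H' = 2 K. *)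
Lemma is_derive_invmx s : U s ->
  is_derive s 1 (fun x => invmx (H x)) (- 2 *: (invmx (H s) *m second_form s *m invmx (H s))).
Proof.
move=> Us; have dH := Ck_derivable1 (CH 1) Us.
have dI := Ck_derivable1 (Ck_invmx oU Hunit (CH 1)) Us.
set D := 'D_1 _ s in dI.
have := is_derive_mulmx dI dH; move=> [_ E].
have E1 : 'D_1 (fun x => invmx (H x) *m H x) s = 'D_1 (cst 1%:M : R -> 'M[R]_n) s.
  apply: near_eq_derive; apply: filterS (near_open Us) => x Ux.
  by rewrite mulVmx//; exact: Hunit.
move: E; rewrite E1 derive_cst => /esym/(congr1 (mulmx^~ (invmx (H s)))).
rewrite mul0mx mulmxDl mulmxK ?Hunit// => /eqP; rewrite addr_eq0 => /eqP DE.
suff <- : D = - 2 *: (invmx (H s) *m second_form s *m invmx (H s)) by [].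
rewrite DE /second_form -scalemxAr -scalemxAl scalerA mulNr mulfV// scaleN1r//.
Qed.

Lemma is_derive_mean_curvature s : U s ->
  is_derive s 1 mean_curvature
    (- 2 * \tr (invmx (H s) *m second_form s *m (invmx (H s) *m second_form s))
     + \tr (invmx (H s) *m 'D_1 second_form s)).
Proof.
move=> Us; have dK := Ck_derivable1 (Ck_second_form 1) Us.
have := is_derive_trace (is_derive_mulmx (is_derive_invmx Us) dK).
by rewrite mxtraceD -scalemxAl mxtraceZ mulmxA.
Qed.

End TimeCurve.

Lemma mx_subZE (R : pzRingType) m n (P Q : 'M[R]_(m, n)) c i j :
  (P - c *: Q) i j = P i j - c * Q i j.
Proof. by rewrite !mxE. Qed.

Lemma mxtrace_mul_lin (R : comPzRingType) n (A P Q S V : 'M[R]_n) a b :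
  \tr (A *m (P + Q + a *: S - b *: V)) =
  \tr (A *m P) + \tr (A *m Q) + a * \tr (A *m S) - b * \tr (A *m V).
Proof. by rewrite mulmxBr !mulmxDr -!scalemxAr raddfB /= !mxtraceD !mxtraceZ. Qed.

Section RicciBlock.
Context (R : realType) (n : nat) (G : R -> 'rV[R]_n -> 'M[R]_n) (y : 'rV[R]_n) (U : set R).
Let H s := G s y.
Hypotheses (oU : open U) (CH : forall k, Ck k U H).
Hypotheses (Hsym : forall s, U s -> (H s)^T = H s) (Hunit : forall s, U s -> H s \in unitmx).

Local Notation g := (block_metric G).
Local Notation i0 := (lshift n (ord0 : 'I_1)).
Local Notation r := (@rshift 1 n).
Let K := second_form H.
Let Hi s := invmx (H s).
Let th := mean_curvature H.

Lemma time_pdE s i j : U s -> 2^-1 * time_pd G i j (row_mx s%:M y) = K s i j.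
Proof.
move=> Us; rewrite /time_pd pd_time /K /second_form [in RHS]mxE; congr (_ * _).
have d := Ck_derivable1 (CH 1) Us.
have E : (fun s0 : R => g (row_mx s0%:M y) (r i) (r j)) = fun s0 => H s0 i j.
  by apply/funext => x; rewrite block_metricE row_mxKl row_mxKr mxE mulr1n.
rewrite E; have [d1 d2] := is_derive_entry i j d.
by rewrite rder_derive.
Qed.

Lemma mixed_christoffelE s k j : U s ->
  2^-1 * (\sum_l invmx (G (lsubmx (row_mx s%:M y) 0 0) (rsubmx (row_mx s%:M y))) k l *
          time_pd G j l (row_mx s%:M y)) = (Hi s *m K s) k j.
Proof.
move=> Us; rewrite mulr_sumr [RHS]mxE; apply: eq_bigr => l _.
rewrite mulrCA (time_pdE _ _ Us) row_mxKl row_mxKr mxE mulr1n; congr (_ * _).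
by have /matrixP/(_ l j) := second_form_sym oU CH Hsym Us; rewrite mxE.
Qed.

(** All symbols with two lower time indices vanish. The mixed symbols form the matrix [Hi *m K]: its
    trace is differentiated in time, and its square supplies the quadratic term. *)
Lemma ricci_block00 s : U s -> ricci g (row_mx s%:M y) i0 i0 =
  - 'D_1 th s - \tr (Hi s *m K s *m (Hi s *m K s)).
Proof.
move=> Us; rewrite mxE big_split_ord /= big_ord1.
have c0 (f : 'rV[R]_(1 + n) -> R^o) i z : (forall z, f z = 0) -> pd i f z = 0.
  by move=> f0; rewrite (_ : f = fun=> 0) /pd ?rder_cst//; exact/funext.
rewrite !c0; try exact: christoffel_000.
rewrite subrr add0r; congr (_ + _).
  have -> : \sum_(i < n) (pd (r i) (christoffel g (r i) i0 i0) (row_mx s%:M y) -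
      pd i0 (christoffel g (r i) i0 (r i)) (row_mx s%:M y)) =
      \sum_(i < n) - 'D_1 (fun x => (Hi x *m K x) i i) s.
    apply: eq_bigr => k _; rewrite c0 ?sub0r; last by move=> z; exact: christoffel_r00.
    rewrite pd_time; congr (- _); apply: rder_near.
      apply: filterS (near_open oU Us) => x Ux.
      by rewrite christoffel_r0r mixed_christoffelE.
    have C1 : Ck 1 U (fun x => Hi x *m K x).
      by apply: Ck_mulmx => //; [exact: Ck_invmx|exact: Ck_second_form].
    by have [] := is_derive_entry k k (Ck_derivable1 C1 Us).
  rewrite sumrN; congr (- _).
  have C1 : Ck 1 U (fun x => Hi x *m K x).
    by apply: Ck_mulmx => //; [exact: Ck_invmx|exact: Ck_second_form].
  have [_ E] := is_derive_trace (Ck_derivable1 C1 Us).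
  rewrite -[RHS]/('D_1 (fun x => \tr (Hi x *m K x)) s) E.
  have [+ _] := Ck_derivable1 C1 Us.
  by move=> d; rewrite derive_mx//; apply: eq_bigr => i _; rewrite mxE.
rewrite -sumrN big_split_ord /= big_ord1 big_split_ord /= big_ord1.
rewrite !christoffel_000 !mul0r subrr add0r big1; last first.
  by move=> l _; rewrite christoffel_00r christoffel_r00 !(mul0r, mulr0) subrr.
rewrite add0r /mxtrace; apply: eq_bigr => k _.
rewrite big_split_ord /= big_ord1 !christoffel_r00 christoffel_000 !(mul0r, mulr0) subrr add0r.
rewrite mxE -sumrN; apply: eq_bigr => l _.
by rewrite christoffel_r00 mulr0 sub0r !christoffel_r0r !mixed_christoffelE.
Qed.

(** The purely spatial symbols reassemble into the Ricci tensor of [G s]. The term K h^-1 K occurs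
    twice, once for each position of the time index in the subtracted product of symbols, hence the
    coefficient 2. *)
Lemma ricci_blockrr s i j : U s -> ricci g (row_mx s%:M y) (r i) (r j) =
  ricci (G s) y i j + 'D_1 K s i j + th s * K s i j - 2 * (K s *m Hi s *m K s) i j.
Proof.
move=> Us; rewrite mxE big_split_ord /= big_ord1.
have c0 (f : 'rV[R]_(1 + n) -> R^o) a z : (forall z, f z = 0) -> pd a f z = 0.
  by move=> f0; rewrite (_ : f = fun=> 0) /pd ?rder_cst//; exact/funext.
rewrite (c0 (christoffel g i0 (r i) i0)); last by move=> z; exact: christoffel_0r0.
rewrite subr0.
have -> : pd i0 (christoffel g i0 (r i) (r j)) (row_mx s%:M y) = 'D_1 K s i j.
  have dK := Ck_derivable1 (Ck_second_form oU CH 1) Us.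
  have [d1 <-] := is_derive_entry i j dK.
  rewrite pd_time; apply: rder_near => //.
  by apply: filterS (near_open oU Us) => x Ux; rewrite christoffel_0rr time_pdE.
have -> : \sum_(k < n) (pd (r k) (christoffel g (r k) (r i) (r j)) (row_mx s%:M y) -
     pd (r j) (christoffel g (r k) (r i) (r k)) (row_mx s%:M y)) =
   \sum_k (pd k (christoffel (G s) k i j) y - pd j (christoffel (G s) k i k) y).
  apply: eq_bigr => k _; rewrite !pd_space.
  have spE a b : (fun y' => christoffel g (r k) (r a) (r b) (row_mx s%:M y')) =
    christoffel (G s) k a b by apply/funext => y'; rewrite christoffel_rrr.
  by rewrite !spE.
rewrite big_split_ord /= big_ord1 big_split_ord /= big_ord1.
rewrite !christoffel_000 !christoffel_0r0 !(mul0r, mulr0) subrr add0r.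
have KHKs : (K s *m Hi s *m K s)^T = K s *m Hi s *m K s.
  have Ks := second_form_sym oU CH Hsym Us.
  by rewrite !trmx_mul Ks /Hi trmx_inv Hsym// mulmxA.
have -> : \sum_(l < n) (christoffel g i0 i0 (r l) (row_mx s%:M y) * christoffel g (r l) (r i) (r j) (row_mx s%:M y)
   - christoffel g i0 (r j) (r l) (row_mx s%:M y) * christoffel g (r l) (r i) i0 (row_mx s%:M y))
   = - (K s *m Hi s *m K s) i j.
  rewrite -KHKs -mulmxA [in RHS]mxE [in RHS]mxE -sumrN; apply: eq_bigr => l _.
  by rewrite christoffel_00r mul0r sub0r christoffel_0rr time_pdE// christoffel_rr0 mixed_christoffelE.
have -> : \sum_(k < n) \sum_(l < 1 + n)
   (christoffel g (r k) (r k) l (row_mx s%:M y) * christoffel g l (r i) (r j) (row_mx s%:M y) -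
    christoffel g (r k) (r j) l (row_mx s%:M y) * christoffel g l (r i) (r k) (row_mx s%:M y)) =
   \sum_k ((Hi s *m K s) k k * K s i j - K s i k * (Hi s *m K s) k j) +
   \sum_k \sum_l (christoffel (G s) k k l y * christoffel (G s) l i j y -
     christoffel (G s) k j l y * christoffel (G s) l i k y).
  rewrite -big_split /=; apply: eq_bigr => k _; rewrite big_split_ord /= big_ord1; congr (_ + _).
    rewrite !christoffel_rr0 !mixed_christoffelE// !christoffel_0rr !time_pdE//.
    by congr (_ - _); exact: mulrC.
  by apply: eq_bigr => l _; rewrite !christoffel_rrr.
have -> : \sum_k ((Hi s *m K s) k k * K s i j - K s i k * (Hi s *m K s) k j) =
    th s * K s i j - (K s *m Hi s *m K s) i j.
  rewrite sumrB -mulr_suml; congr (_ - _).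
  by rewrite -mulmxA [in RHS]mxE.
rewrite [ricci (G s) y i j]mxE; ring.
Qed.

(** Writing R0 for Ric(nu, nu) and A for the trace of the spatial Ricci block, T_00 = (R0 + A) / 2
    and tr S = A - n (A - R0) / 2, so that the combination q is exactly R0: this explains its
    definition, and the first identity is Raychaudhuri's equation. In R0 + A the derivatives of K
    cancel, which leaves the Hamiltonian constraint. *)
Lemma einstein_block s : (1 < n)%N -> U s ->
  let T := einstein g (row_mx s%:M y) in
  let N := \tr (Hi s *m K s *m (Hi s *m K s)) in
  ((n%:R - 2) * ulsubmx T 0 0 + \tr (Hi s *m drsubmx T)) / (n%:R - 1) = - 'D_1 th s - N /\
  2 * ulsubmx T 0 0 = scalar_curvature (G s) y + th s ^+ 2 - N.
Proof.
move=> n1 Us T N.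
pose Rs := drsubmx (ricci g (row_mx s%:M y)).
pose R0 := ricci g (row_mx s%:M y) i0 i0.
pose A := \tr (Hi s *m Rs).
have gE : invmx (g (row_mx s%:M y)) = block_mx (- 1)%:M 0 0 (Hi s).
  by rewrite invmx_block_metric row_mxKl row_mxKr mxE mulr1n.
have sc : scalar_curvature g (row_mx s%:M y) = A - R0.
  rewrite /scalar_curvature gE -[ricci g _]submxK mulmx_block mxtrace_block.
  rewrite !mul0mx addr0 add0r mul_scalar_mx scaleN1r addrC; congr (_ + _).
  by rewrite /mxtrace big_ord1 mxE /R0 -[in RHS](submxK (ricci _ _)) block_mxEul.
have T0 : ulsubmx T 0 0 = 2^-1 * (R0 + A).
  rewrite -[ulsubmx T 0 0](block_mxEul (ulsubmx T) (ursubmx T) (dlsubmx T) (drsubmx T)) submxK.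
  rewrite /T /einstein mx_subZE sc.
  by rewrite block_metric00 -/R0; field.
have TS : \tr (Hi s *m drsubmx T) = A - 2^-1 * (A - R0) * n%:R.
  have -> : drsubmx T = Rs - (2^-1 * (A - R0)) *: H s.
    have drE (P : 'M[R]_(1 + n)) i j : drsubmx P i j = P (r i) (r j) by rewrite !mxE.
    apply/matrixP => i j; rewrite drE /T /einstein mx_subZE sc block_metricE row_mxKl row_mxKr.
    by rewrite [_%:M _ _]mxE mulr1n mx_subZE drE.
  rewrite mulmxBr -scalemxAr mulVmx ?Hunit// raddfB /= mxtraceZ mxtrace1.
  by [].
have AE : A = scalar_curvature (G s) y + \tr (Hi s *m 'D_1 K s) + th s ^+ 2 - 2 * N.
  have -> : A = \tr (Hi s *m (ricci (G s) y + 'D_1 K s + th s *: K s - 2 *: (K s *m Hi s *m K s))).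
    rewrite /A; congr (\tr (_ *m _)); apply/matrixP => i j.
    by rewrite /Rs [drsubmx _ i j]mxE mxE ricci_blockrr// !mxE.
  rewrite mxtrace_mul_lin.
  by rewrite -[\tr (Hi s *m K s)]/(th s) /N !mulmxA expr2.
have [_ dth] := is_derive_mean_curvature oU CH Hunit Us.
have R0E := ricci_block00 Us.
rewrite -/R0 -/N in R0E; rewrite -/th -/K -/(Hi s) -/N in dth.
have nN : n%:R - 1 != 0 :> R by rewrite subr_eq0 pnatr_eq1 gtn_eqF.
split.
  by rewrite T0 TS -R0E; field.
by rewrite T0 R0E AE dth; field.
Qed.

End RicciBlock.

(** * Riccati comparison and energy estimate *)

Section Monotone.
Context (R : realType).
Implicit Types (f df : R -> R).

Lemma is_derive_continuous f (x d : R) : is_derive x 1 f d -> {for x, continuous f}.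
Proof. by move=> [dv _]; apply: differentiable_continuous; apply/derivable1_diffP. Qed.

Lemma le_of_derive_le0 f df (a b : R) : a <= b ->
  (forall x, a <= x <= b -> is_derive x 1 f (df x)) ->
  (forall x, a <= x <= b -> df x <= 0) -> f b <= f a.
Proof.
rewrite le_eqVlt => /predU1P[-> //|ab] H H0.
have [c /andP[ac cb] E] := MVT_open ab H.
rewrite -subr_le0 E; apply: mulr_le0_ge0; last by rewrite subr_ge0 ltW.
by apply: H0; rewrite !ltW.
Qed.

End Monotone.

Section RiccatiBound.
Context (R : realType) (th dth : R -> R) (t0 : R).
Hypotheses (th_right : th x @[x --> t0^'+] --> th t0)
  (dthP : forall t, t0 < t -> is_derive t 1 th (dth t))
  (dth_ge : forall t, t0 < t -> - th t ^+ 2 <= dth t)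
  (dth_le : forall t, t0 < t -> dth t <= 0) (th0 : 0 < th t0).

Lemma riccati_nonincreasing s t : t0 < s -> s <= t -> th t <= th s.
Proof.
move=> s0 st; apply: (le_of_derive_le0 (df := dth)) => // x /andP[sx xt].
  by apply: dthP; exact: lt_le_trans sx.
by apply: dth_le; exact: lt_le_trans sx.
Qed.

Lemma riccati_gt0 t : t0 <= t -> 0 < th t.
Proof.
rewrite le_eqVlt => /predU1P[<- //|t0t].
(* Differentiability is available only after [t0]; right continuity moves the positive value to some
   s1 > t0. *)
have : \forall x \near t0^'+, 0 < th x by apply: (cvgr_gt _ th_right).
move=> pos; have [s1 [t0s1 s1t ths1]] : exists s1, [/\ t0 < s1, s1 <= t & 0 < th s1].
  near t0^'+ => s1; exists s1; split.
  - near: s1; exact: nbhs_right_gt.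
  - near: s1; exact: nbhs_right_le.
  - near: s1; exact: pos.
rewrite ltNge; apply/negP => tht.
have ct : {within `[s1, t], continuous th}.
  apply: derivable_within_continuous => x; rewrite in_itv/= => /andP[s1x _].
  by have [] := dthP (lt_le_trans t0s1 s1x).
have [z zI thz] : exists2 c, c \in `[s1, t] & th c = 0.
  by apply: IVT => //; rewrite ge_min le_max tht (ltW ths1) orbT.
move: zI; rewrite in_itv/= => /andP[s1z zt].
(* Up to the first zero of [th], [- k * th <= - th ^+ 2 <= dth], so that
   [th * expR (k * x)] is nondecreasing and cannot vanish. *)
pose k := th s1.
have dphi x : s1 <= x <= z ->
    is_derive x 1 (fun x => - (th x * expR (k * x))) (- ((dth x + k * th x) * expR (k * x))).
  move=> /andP[s1x xz]; apply: is_deriveN.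
  have dk : is_derive x 1 (fun t : R => k * t) k.
    by apply: (is_derive_eq (is_deriveZ k (is_derive_id x (1 : R)))); rewrite [LHS]mulr1.
  have dE := is_derive1_comp (is_derive_expR (k * x)) dk.
  apply: (is_derive_eq (is_deriveM (dthP (lt_le_trans t0s1 s1x)) dE)).
  by rewrite /GRing.scale /=; ring.
have := le_of_derive_le0 s1z dphi; rewrite thz mul0r oppr0.
suff H : forall x, s1 <= x <= z -> - ((dth x + k * th x) * expR (k * x)) <= 0.
  move=> /(_ H); rewrite oppr_ge0 leNgt => /negP; apply.
  by rewrite mulr_gt0// expR_gt0.
move=> x /andP[s1x xz]; rewrite oppr_le0 mulr_ge0 ?expR_ge0//.
have x0 : t0 < x := lt_le_trans t0s1 s1x.
have h1 : 0 <= th x by rewrite -thz; exact: riccati_nonincreasing.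
have h2 : th x <= k by exact: riccati_nonincreasing.
have := dth_ge x0; nra.
Unshelve. all: by end_near. Qed.

(** th' >= - th^2 says that 1 / th - t is nonincreasing; the resulting inequality is cleared of
    denominators. *)
Lemma riccati_decay s t : t0 < s -> s <= t -> th s <= th t * (1 + th s * (t - s)).
Proof.
move=> s0 st.
have p x : t0 < x -> 0 < th x by move=> /ltW; exact: riccati_gt0.
have t0t : t0 < t := lt_le_trans s0 st.
have d x : s <= x <= t -> is_derive x 1 (fun x => (th x)^-1 - x) (- (th x) ^- 2 * dth x - 1).
  move=> /andP[sx xt]; have x0 : t0 < x := lt_le_trans s0 sx.
  have thx : th x != 0 by rewrite gt_eqF// p.
  exact: is_deriveB (is_deriveV thx (dthP x0)) (is_derive_id x (1 : R)).
have := le_of_derive_le0 st d.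
suff H x : s <= x <= t -> - (th x) ^- 2 * dth x - 1 <= 0.
  move=> /(_ H); have ps := p s s0; have pt := p t t0t.
  have e1 : (th s)^-1 * th s = 1 by rewrite mulVf// gt_eqF.
  have e2 : (th t)^-1 * th t = 1 by rewrite mulVf// gt_eqF.
  move=> h; have : ((th t)^-1 - t) * (th s * th t) <= ((th s)^-1 - s) * (th s * th t).
    by rewrite ler_wpM2r// mulr_ge0// ltW.
  have -> : ((th t)^-1 - t) * (th s * th t) = th s * ((th t)^-1 * th t) - t * th s * th t by ring.
  have -> : ((th s)^-1 - s) * (th s * th t) = th t * ((th s)^-1 * th s) - s * th s * th t by ring.
  rewrite e1 e2; lra.
move=> /andP[sx xt]; have x0 : t0 < x := lt_le_trans s0 sx.
rewrite subr_le0 mulNr -mulrN mulrC ler_pdivrMr ?exprn_gt0 ?p// mul1r.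
by rewrite lerNl; exact: dth_ge.
Qed.

End RiccatiBound.

Section EnergyBound.
Context (R : realType) (th dth : R -> R) (t0 : R).
Hypotheses (th_right : th x @[x --> t0^'+] --> th t0)
  (dthP : forall t, t0 < t -> is_derive t 1 th (dth t))
  (dth_ge : forall t, t0 < t -> - th t ^+ 2 <= dth t)
  (dth_le : forall t, t0 < t -> dth t <= 0) (th0 : 0 < th t0).
Context (c : R) (c0 : 0 <= c).
Context (a : R) (I : set R) (tau E dE : R -> R).
Hypotheses (Icc : forall x y z, I x -> I z -> x <= y <= z -> I y).
Hypotheses (tauP : forall l, I l -> is_derive l 1 tau (E l))
  (EP : forall l, I l -> is_derive l 1 E (dE l))
  (E0 : forall l, I l -> 0 < E l) (tau0 : forall l, I l -> t0 < tau l)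
  (rate : forall l, I l -> dE l * th (tau l) <= c * (- dth (tau l)) * E l ^+ 2).

Let thp t : t0 <= t -> 0 < th t.
Proof. exact: riccati_gt0 th_right dthP dth_ge dth_le th0 t. Qed.

Let phi l := ln (E l) + c * ln (th (tau l)).

Lemma log_energy_nonincreasing l l' : I l -> I l' -> l <= l' -> phi l' <= phi l.
Proof.
move=> Il Il' ll'.
have d x : l <= x <= l' -> is_derive x 1 phi
    (dE x / E x + c * (dth (tau x) * E x / th (tau x))).
  move=> /(Icc Il Il') Ix.
  have t0x := tau0 Ix; have px := thp (ltW t0x).
  have d1 := is_derive1_comp (is_derive1_ln (E0 Ix)) (EP Ix).
  have d2 := is_derive1_comp (is_derive1_ln px) (is_derive1_comp (dthP t0x) (tauP Ix)).
  apply: (is_derive_eq (is_deriveD d1 (is_deriveZ c d2))).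
  by rewrite /GRing.scale /=; congr (_ + c * _); rewrite mulrC // mulrAC.
apply: (le_of_derive_le0 ll' d) => x /(Icc Il Il') Ix.
have px := thp (ltW (tau0 Ix)); have Ex := E0 Ix; have := rate Ix.
have -> : dE x / E x + c * (dth (tau x) * E x / th (tau x)) =
   (dE x * th (tau x) - c * (- dth (tau x)) * E x ^+ 2) / (E x * th (tau x)).
  by field; rewrite !gt_eqF.
by move=> h; rewrite mulr_le0_ge0 ?subr_le0// invr_ge0 mulr_ge0// ltW.
Qed.

Lemma energy_le_of_log l l' : 0 < E l -> 0 < E l' -> 0 < th (tau l) -> 0 < th (tau l') ->
  phi l' <= phi l -> E l' <= E l * (th (tau l) / th (tau l')) `^ c.
Proof.
move=> El El' tl tl' h.
rewrite -ler_ln ?posrE//; last by rewrite mulr_gt0// powR_gt0// divr_gt0.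
rewrite lnM ?posrE ?powR_gt0 ?divr_gt0// ln_powR lnM ?posrE ?invr_gt0// lnV ?posrE//.
by move: h; rewrite /phi; lra.
Qed.

Lemma energy_le l l' : I l -> I l' -> l <= l' ->
  E l' <= E l * (th (tau l) / th (tau l')) `^ c.
Proof.
move=> Il Il' ll'; apply: energy_le_of_log; rewrite ?E0//; try (by apply: thp; apply: ltW; exact: tau0).
exact: log_energy_nonincreasing.
Qed.

(** The starting point may lie on the boundary t = t0, outside the reach of the differential
    inequality; the comparison from x > a passes to the limit as x tends to [a] from the right. *)
Lemma energy_le_right l : I l -> a < l -> (forall x, a < x <= l -> I x) ->
  0 < E a -> t0 <= tau a ->
  E x @[x --> a^'+] --> E a -> th (tau x) @[x --> a^'+] --> th (tau a) ->
  E l <= E a * (th (tau a) / th (tau l)) `^ c.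
Proof.
move=> Il al Ia Ea ta cE cth.
apply: energy_le_of_log => //; [exact: E0|exact: thp|by apply: thp; apply: ltW; exact: tau0|].
have cphi : phi x @[x --> a^'+] --> phi a.
  apply: cvgD; first by apply: continuous_cvg => //; exact: continuous_ln.
  apply: cvgMr; apply: continuous_cvg => //; apply: continuous_ln; exact: thp.
apply: (cvgr_to_ge cphi); near=> x.
have ax : a < x by near: x; exact: nbhs_right_gt.
have xl : x <= l by near: x; exact: nbhs_right_le.
by apply: log_energy_nonincreasing => //; apply: Ia; rewrite ax.
Unshelve. all: by end_near. Qed.

(* [E * th ^ c] is nonincreasing and [c <= 1], so [E <= E l0 * th (tau l0) / th (tau l)],
   which [riccati_decay] bounds by an affine function of [tau]: Gronwall. *)
Lemma energy_time_bounded l0 b : c <= 1 -> I l0 -> (forall l, l0 <= l < b -> I l) ->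
  exists T B, forall l, l0 <= l < b -> tau l <= T /\ E l <= B.
Proof.
move=> c1 Il0 Ib.
pose k := th (tau l0); pose w l := 1 + k * (tau l - tau l0).
have k0 : 0 < k by apply: thp; apply: ltW; exact: tau0.
have tau_mono l : l0 <= l < b -> tau l0 <= tau l.
  move=> /andP[l0l lb]; rewrite -lerN2.
  apply: (le_of_derive_le0 (f := fun x => - tau x) (df := fun x => - E x)) => // x /andP[l0x xl].
    by apply: is_deriveN; apply: tauP; apply: Ib; rewrite l0x (le_lt_trans xl).
  by rewrite oppr_le0 ltW// E0//; apply: Ib; rewrite l0x (le_lt_trans xl).
have EB l : l0 <= l < b -> E l <= E l0 * w l.
  move=> lI; have Il := Ib _ lI; have /andP[l0l lb] := lI.
  apply: le_trans (energy_le Il0 Il l0l) _; rewrite ler_wpM2l ?(ltW (E0 Il0))//.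
  have pl : 0 < th (tau l) by apply: thp; apply: ltW; exact: tau0.
  have tl := tau_mono l lI.
  have r1 : 1 <= th (tau l0) / th (tau l).
    rewrite ler_pdivlMr// mul1r.
    exact: (riccati_nonincreasing dthP dth_le (tau0 Il0)).
  apply: (@le_trans _ _ (th (tau l0) / th (tau l))).
    rewrite -[leRHS]powRr1; last exact: le_trans r1.
    exact: ler_powR.
  rewrite ler_pdivrMr// mulrC.
  exact: (riccati_decay th_right dthP dth_ge dth_le th0 (tau0 Il0) tl).
(* The derivative of [w] is k E <= K w, so that w exp (- K (l - l0)) is nonincreasing. *)
pose K := k * E l0.
have K0 : 0 <= K by rewrite mulr_ge0 ?ltW// E0.
have wB l : l0 <= l < b -> w l <= expR (K * (l - l0)).
  move=> /andP[l0l lb].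
  have d x : l0 <= x <= l -> is_derive x 1 (fun x => w x * expR (- K * (x - l0)))
      ((k * E x - K * w x) * expR (- K * (x - l0))).
    move=> /andP[l0x xl]; have Ix : I x by apply: Ib; rewrite l0x (le_lt_trans xl).
    have dw : is_derive x 1 w (k * E x).
      have dt := is_deriveZ k (is_deriveB (tauP Ix) (is_derive_cst (tau l0) x 1)).
      apply: (is_derive_eq (is_deriveD (is_derive_cst (1 : R) x (1 : R)) dt)).
      by rewrite add0r subr0.
    have dk : is_derive x 1 (fun t : R => - K * (t - l0)) (- K).
      apply: (is_derive_eq (is_deriveZ (- K) (is_deriveB (is_derive_id x (1 : R)) (is_derive_cst l0 x (1 : R))))).
      by rewrite subr0 [LHS]mulr1.
    have dX := is_derive1_comp (g := fun t => - K * (t - l0)) (is_derive_expR _) dk.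
    apply: (is_derive_eq (is_deriveM dw dX)).
    by rewrite /GRing.scale /=; ring.
  have := le_of_derive_le0 l0l d.
  suff H x : l0 <= x <= l -> (k * E x - K * w x) * expR (- K * (x - l0)) <= 0.
    move=> /(_ H); rewrite /w !subrr !mulr0 addr0 mul1r expR0 mulNr expRN.
    by rewrite ler_pdivrMr ?expR_gt0// mul1r.
  move=> /andP[l0x xl]; rewrite mulr_le0_ge0 ?expR_ge0// subr_le0 /K -mulrA ler_wpM2l ?(ltW k0)//.
  by apply: EB; rewrite l0x (le_lt_trans xl).
pose W := expR (K * (b - l0)).
have wW l : l0 <= l < b -> w l <= W.
  move=> lI; apply: le_trans (wB l lI) _; rewrite ler_expR ler_wpM2l// lerD2r ltW//.
  by case/andP: lI.
exists (tau l0 + (W - 1) / k), (E l0 * W) => l lI; split.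
  rewrite -lerBlDl ler_pdivlMr// mulrC; have := wW l lI; rewrite /w; lra.
by apply: le_trans (EB l lI) _; rewrite ler_wpM2l ?wW// ltW// E0.
Qed.

End EnergyBound.

(** * Covariance of the geodesic equation *)

Lemma pd_derive (R : realType) N (D : set 'rV[R]_N) (f : 'rV[R]_N -> R) i z :
  Ck 1 D f -> D z -> pd i f z = 'D_(delta_mx 0 i) f z.
Proof. by move=> Cf Dz; apply: rder_derive; have [] := Ck_derivable (delta_mx 0 i) Cf Dz. Qed.

Section GeodesicField.
Context (R : realType) (N : nat) (G : 'rV[R]_N -> 'M[R]_N) (D : set 'rV[R]_N).
Hypotheses (oD : open D) (CG : forall k, Ck k D G) (uG : forall z, D z -> G z \in unitmx).

Lemma pd_metric i j l z : D z -> pd i (fun y => G y j l) z = 'D_(delta_mx 0 i) G z j l.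
Proof.
move=> Dz; rewrite (pd_derive i (Ck_entry j l oD (CG 1)) Dz).
by have [_ ->] := is_derive_entry j l (Ck_derivable (delta_mx 0 i) (CG 1) Dz).
Qed.

Lemma Ck_christoffel k a i j : Ck k D (christoffel G a i j).
Proof.
apply: (@Ck_ext _ _ _ _ _ (fun z => 2^-1 * \sum_l invmx (G z) a l *
  ('D_(delta_mx 0 i) G z j l + 'D_(delta_mx 0 j) G z i l - 'D_(delta_mx 0 l) G z i j))) => //.
  move=> z Dz; rewrite /christoffel; congr (_ * _); apply: eq_bigr => l _.
  by rewrite !pd_metric.
have CD b : Ck k D (fun z => 'D_b G z) by have [_] := CG k.+1; exact.
apply: Ck_mul => //; first exact: Ck_cst.
apply: Ck_sum => // l _; apply: Ck_mul => //.
  by apply: (Ck_entry a l oD); exact: Ck_invmx.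
apply: Ck_sub => //; first apply: Ck_add => //.
- exact: (Ck_entry j l oD (CD _)).
- exact: (Ck_entry i l oD (CD _)).
- exact: (Ck_entry i j oD (CD _)).
Qed.

Definition geo_accel (z v : 'rV[R]_N) : 'rV[R]_N :=
  - \row_k \sum_i \sum_j christoffel G k i j z * v 0 i * v 0 j.

Definition geo_field (x : 'rV[R]_(N + N)) : 'rV[R]_(N + N) :=
  row_mx (rsubmx x) (geo_accel (lsubmx x) (rsubmx x)).

Definition geo_domain : set 'rV[R]_(N + N) := [set x | D (lsubmx x)].

Lemma open_geo_domain : open geo_domain.
Proof. by apply: open_comp => // x _; exact: continuous_lsubmx. Qed.

Lemma Ck_geo_field k : Ck k geo_domain geo_field.
Proof.
have oD' := open_geo_domain.
have Cl : Ck k geo_domain (fun x : 'rV[R]_(N + N) => lsubmx x).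
  by apply: Ck_linear; exact: continuous_lsubmx.
have Cr : Ck k geo_domain (fun x : 'rV[R]_(N + N) => rsubmx x).
  by apply: Ck_linear; exact: continuous_rsubmx.
apply: Ck_mx => // a b; rewrite (ord1 a); case: (split_ordP b) => j ->.
  apply: (@Ck_ext _ _ _ _ _ (fun x => rsubmx x 0 j)) => //.
    by move=> x _; rewrite /geo_field row_mxEl.
  exact: Ck_entry.
apply: (@Ck_ext _ _ _ _ _ (fun x : 'rV[R]_(N + N) => - \sum_i \sum_l
   (christoffel G j i l \o (fun x => lsubmx x)) x * rsubmx x 0 i * rsubmx x 0 l)) => //.
  by move=> x _; rewrite /geo_field row_mxEr !mxE.
apply: Ck_opp => //; apply: Ck_sum => // i _; apply: Ck_sum => // l _.
apply: Ck_mul => //; last exact: (Ck_entry 0 l oD' Cr).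
apply: Ck_mul => //; last exact: (Ck_entry 0 i oD' Cr).
exact: (Ck_comp_scalar oD' oD _ Cl (Ck_christoffel k j i l)).
Qed.

End GeodesicField.

(** Bootstrapping: u' = f \o u is of class C^k as soon as [u] is. *)
Lemma Ck_ode (R : realType) M (f : 'rV[R]_M -> 'rV[R]_M) (D : set 'rV[R]_M)
    (I : set R) (u : R -> 'rV[R]_M) : open D -> open I -> (forall k, Ck k D f) ->
  (forall s, I s -> D (u s)) -> (forall s, I s -> is_derive s 1 u (f (u s))) ->
  forall k, Ck k I u.
Proof.
move=> oD oI Cf Du du; have dfu s : I s -> differentiable u s.
  by move=> /du[+ _]; move/derivable1_diffP.
elim=> [|k IH]; first by move=> s Is; apply: differentiable_continuous; exact: dfu.
split=> // v; apply: (@Ck_ext _ _ _ _ _ (fun s => v *: (f \o u) s)) => //.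
  move=> s Is; have [_ E] := du s Is; rewrite /= -E !deriveE; try exact: dfu.
  by rewrite -linearZ /= -[v *: 1]/(v * 1) mulr1.
by apply: Ck_scale => //; exact: Ck_comp (Cf k).
Qed.

Lemma mx_addE (R : pzRingType) m n (P Q : 'M[R]_(m, n)) i j : (P + Q) i j = P i j + Q i j.
Proof. by rewrite mxE. Qed.

Lemma mx_scaleE (R : pzRingType) m n c (P : 'M[R]_(m, n)) i j : (c *: P) i j = c * P i j.
Proof. by rewrite mxE. Qed.

Lemma mx_rowE (R : pzRingType) m n (A : 'M[R]_(m, n)) i j :
  ((delta_mx 0 i : 'rV[R]_m) *m A) 0 j = A i j.
Proof. by rewrite -rowE mxE. Qed.

Lemma mx11_tr (R : pzRingType) (P : 'M[R]_1) : P 0 0 = P^T 0 0.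
Proof. by rewrite mxE. Qed.

Section EulerLagrange.
Context (R : realType) (N : nat).

(* The geodesic equation with lowered index, d/ds (v G) - dG(v, v) / 2 = 0: unlike
   the Christoffel symbols it transforms as a covector. *)
Definition euler_lagrange (G : 'rV[R]_N -> 'M[R]_N) (z v a : 'rV[R]_N) : 'rV[R]_N :=
  a *m G z + v *m 'D_v G z - 2^-1 *: \row_p (v *m 'D_(delta_mx 0 p) G z *m v^T) 0 0.

Section Metric.
Context (G : 'rV[R]_N -> 'M[R]_N) (D : set 'rV[R]_N).
Hypotheses (oD : open D) (CG : forall k, Ck k D G) (uG : forall z, D z -> G z \in unitmx)
  (sG : forall z, D z -> (G z)^T = G z).

Lemma derive_metricE z v : D z -> 'D_v G z = \sum_i v 0 i *: 'D_(delta_mx 0 i) G z.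
Proof. by move=> Dz; apply: derive_rV; have [+ _] := CG 1; exact. Qed.

Lemma quad_formE (A : 'M[R]_N) (v : 'rV[R]_N) :
  (v *m A *m v^T) 0 0 = \sum_i \sum_j A i j * v 0 i * v 0 j.
Proof.
rewrite mxE exchange_big /=; apply: eq_bigr => j _; rewrite mxE mulr_suml.
by apply: eq_bigr => i _; rewrite !mxE [v 0 i * _]mulrC.
Qed.

(** Lowering the index cancels the inverse metric in the Christoffel symbols. Contracted twice with
    [v], their first two terms give the same sum, whence [v *m 'D_v G] with coefficient 1. *)
Lemma geo_accel_el z v : D z ->
  - geo_accel G z v *m G z = v *m 'D_v G z - 2^-1 *: \row_p (v *m 'D_(delta_mx 0 p) G z *m v^T) 0 0.
Proof.
move=> Dz; set w := RHS.
have wE l : w 0 l = \sum_i \sum_j 2^-1 * ('D_(delta_mx 0 i) G z j l + 'D_(delta_mx 0 j) G z i l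
    - 'D_(delta_mx 0 l) G z i j) * v 0 i * v 0 j.
  have e1 : (v *m 'D_v G z) 0 l = \sum_i \sum_j 'D_(delta_mx 0 i) G z j l * v 0 i * v 0 j.
    rewrite derive_metricE// mulmx_sumr summxE; apply: eq_bigr => i _.
    by rewrite -scalemxAr mxE mxE mulr_sumr; apply: eq_bigr => j _; ring.
  rewrite /w mx_subZE e1 mxE quad_formE.
  have e2 : \sum_i \sum_j 'D_(delta_mx 0 i) G z j l * v 0 i * v 0 j =
      \sum_i \sum_j 'D_(delta_mx 0 j) G z i l * v 0 i * v 0 j.
    by rewrite exchange_big; apply: eq_bigr => i _; apply: eq_bigr => j _; rewrite mulrAC.
  set A := \sum_i _ in e1 e2 *; set B := \sum_i _ in e2; set C := \sum_i _.
  have -> : A - 2^-1 * C = 2^-1 * (A + B - C) by rewrite -e2; field.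
  rewrite /A /B /C -big_split -sumrB mulr_sumr; apply: eq_bigr => i _.
  rewrite -big_split -sumrB mulr_sumr; apply: eq_bigr => j _ /=; ring.
rewrite -[w](mulmxKV (uG Dz)); congr (_ *m _).
apply/rowP => k; rewrite /geo_accel opprK !mxE.
under [RHS]eq_bigr => l _ do rewrite wE mulr_suml.
rewrite [RHS]exchange_big /=; apply: eq_bigr => i _.
under [RHS]eq_bigr => l _ do rewrite mulr_suml.
rewrite [RHS]exchange_big /=; apply: eq_bigr => j _.
rewrite /christoffel mulr_sumr mulr_suml mulr_suml; apply: eq_bigr => l _.
have -> : invmx (G z) k l = invmx (G z) l k by rewrite -{1}(sG Dz) -trmx_inv mxE.
by rewrite !(pd_metric oD CG)//; ring.
Qed.

Lemma el_geodesic z v a : D z -> euler_lagrange G z v a = 0 <-> a = geo_accel G z v.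
Proof.
move=> Dz; rewrite /euler_lagrange -addrA -geo_accel_el// -mulmxDl.
split=> [|->]; last by rewrite subrr mul0mx.
move/(congr1 (mulmx^~ (invmx (G z)))); rewrite mulmxK ?uG// mul0mx => /eqP.
by rewrite subr_eq0 => /eqP.
Qed.

(** The Euler-Lagrange covector is paired with [v]. Along a curve with velocity [v] and acceleration
    [a], the left-hand side is the derivative of the squared norm of the velocity. *)
Lemma el_conserved z v a : D z -> euler_lagrange G z v a = 0 ->
  2 * (a *m G z *m v^T) 0 0 + (v *m 'D_v G z *m v^T) 0 0 = 0.
Proof.
move=> Dz /(congr1 (mulmx^~ v^T)); rewrite mul0mx => /matrixP/(_ 0 0).
have e : (v *m 'D_v G z *m v^T) 0 0 = (\row_p (v *m 'D_(delta_mx 0 p) G z *m v^T) 0 0 *m v^T) 0 0.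
  rewrite derive_metricE// mulmx_sumr mulmx_suml summxE mxE; apply: eq_bigr => i _.
  by rewrite -scalemxAr -scalemxAl mxE mulrC !mxE.
rewrite /euler_lagrange mulmxBl mulmxDl -scalemxAl mx_subZE -e mx_addE [RHS in _ = RHS -> _]mxE.
lra.
Qed.

End Metric.

Section Covariance.
Context (phi : 'rV[R]_N -> 'rV[R]_N) (G1 G2 : 'rV[R]_N -> 'M[R]_N) (D1 D2 : set 'rV[R]_N).
Hypotheses (oD1 : open D1) (oD2 : open D2) (Cphi : forall k, Ck k D1 phi)
  (CG2 : forall k, Ck k D2 G2) (phiD : forall z, D1 z -> D2 (phi z))
  (sG2 : forall z, D2 z -> (G2 z)^T = G2 z).
Let J z := jacobian phi z.
Hypothesis pull : forall z, D1 z -> G1 z = J z *m G2 (phi z) *m (J z)^T.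

Let dphi z : D1 z -> differentiable phi z.
Proof. by have [+ _] := Cphi 1; exact. Qed.

Lemma jacobianE z i m : D1 z -> J z i m = 'D_(delta_mx 0 i) phi z 0 m.
Proof. move=> Dz; rewrite deriveEjacobian; last exact: dphi.
by rewrite mx_rowE. Qed.

Lemma Ck_jacobian k : Ck k D1 J.
Proof.
apply: Ck_mx => // i m; apply: (@Ck_ext _ _ _ _ _ (fun z => 'D_(delta_mx 0 i) phi z 0 m)) => //.
  by move=> z Dz; rewrite jacobianE.
by apply: Ck_entry => //; have [_] := Cphi k.+1; exact.
Qed.

(** Schwarz' theorem: both sides are mixed second derivatives of [phi] in the directions [v] and
    e_p. *)
Lemma derive_jacobian_sym z v p : D1 z ->
  row p ('D_v J z) = v *m 'D_(delta_mx 0 p) J z.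
Proof.
move=> Dz; apply/rowP => m.
have dJ w i : 'D_w J z i m = 'D_w (fun x => 'D_(delta_mx 0 i) phi x 0 m) z.
  have [_ <-] := is_derive_entry i m (Ck_derivable w (Ck_jacobian 1) Dz).
  apply: near_eq_derive; apply: filterS (open_nbhs_nbhs (conj oD1 Dz)) => x Dx.
  exact: jacobianE.
have ent w x : D1 x -> 'D_w phi x 0 m = 'D_w (fun y => phi y 0 m) x.
  by move=> Dx; have [_ ->] := is_derive_entry 0 m (Ck_derivable w (Cphi 1) Dx).
have dJ2 w i : 'D_w J z i m = 'D_w ('D_(delta_mx 0 i) (fun y => phi y 0 m)) z.
  rewrite dJ; apply: near_eq_derive.
  by apply: filterS (open_nbhs_nbhs (conj oD1 Dz)) => x Dx; exact: ent.
have C2 := Ck_entry 0 m oD1 (Cphi 2).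
have d2 i : differentiable ('D_(delta_mx 0 i) (fun y => phi y 0 m)) z.
  by have [_ /(_ (delta_mx 0 i))[+ _]] := C2; exact.
rewrite mxE dJ2 derive_rV// mxE; apply: eq_bigr => i _.
by rewrite dJ2 -(derive_symmetric _ _ oD1 C2 Dz).
Qed.

Lemma derive_metric_comp z v : D1 z ->
  'D_v (G2 \o phi) z = 'D_(v *m J z) G2 (phi z).
Proof.
move=> Dz; have dG : differentiable G2 (phi z) by have [+ _] := CG2 1; apply; exact: phiD.
rewrite deriveE; last by apply: differentiable_comp => //; exact: dphi.
have df := dphi Dz.
by rewrite diff_comp//= -(deriveE _ df) -(deriveE _ dG) (deriveEjacobian _ df).
Qed.

Lemma derive_pullback z v : D1 z -> 'D_v G1 z =
  'D_v J z *m G2 (phi z) *m (J z)^T + J z *m 'D_(v *m J z) G2 (phi z) *m (J z)^T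
  + J z *m G2 (phi z) *m ('D_v J z)^T.
Proof.
move=> Dz; have dJ := Ck_derivable v (Ck_jacobian 1) Dz.
have dJT : is_derive z v (fun x => (J x)^T) ('D_v J z)^T.
  apply: is_derive_mx => i j; rewrite mxE.
  have -> : (fun x => (J x)^T i j) = fun x => J x j i by apply/funext => x; rewrite mxE.
  exact: is_derive_entry.
have CG2p : Ck 1 D1 (G2 \o phi) by exact: Ck_comp (CG2 1).
have dG := Ck_derivable v CG2p Dz; rewrite derive_metric_comp// in dG.
transitivity ('D_v (fun x => J x *m (G2 \o phi) x *m (J x)^T) z); last first.
  by have [_ ->] := is_derive_mulmx (is_derive_mulmx dJ dG) dJT; rewrite mulmxDl.
apply: near_eq_derive; apply: filterS (open_nbhs_nbhs (conj oD1 Dz)) => x Dx.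
  exact: pull.
Qed.

(** The inhomogeneous term v *m 'D_v J of the transformed acceleration accounts for one derivative
    of J in the pulled back metric. The remaining ones cancel between the two metric terms by the
    symmetry of second derivatives, which leaves the law of a covector. *)
Lemma el_covariant z v a : D1 z ->
  euler_lagrange G1 z v a =
  euler_lagrange G2 (phi z) (v *m J z) (a *m J z + v *m 'D_v J z) *m (J z)^T.
Proof.
move=> Dz; have sg := sG2 (phiD Dz).
rewrite /euler_lagrange.
set g := G2 (phi z) in sg *; set w := v *m J z.
have -> : \row_p (v *m 'D_(delta_mx 0 p) G1 z *m v^T) 0 0 =
   2 *: (w *m g *m ('D_v J z)^T) + \row_p (w *m 'D_(delta_mx 0 p) G2 (phi z) *m w^T) 0 0 *m (J z)^T.
  apply/rowP => p.
  have -> : (2 *: (w *m g *m ('D_v J z)^T) + \row_p0 (w *m 'D_(delta_mx 0 p0) G2 (phi z) *m w^T) 0 0 *m (J z)^T) 0 p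
    = 2 * (w *m g *m ('D_v J z)^T) 0 p + (w *m 'D_(delta_mx 0 p *m J z) G2 (phi z) *m w^T) 0 0.
    rewrite mx_addE mx_scaleE; congr (_ + _).
    rewrite derive_rV; last by have [+ _] := CG2 1; apply; exact: phiD.
    rewrite mulmx_sumr mulmx_suml summxE mxE; apply: eq_bigr => m _.
    by rewrite -scalemxAr -scalemxAl mx_scaleE mx_rowE mulrC [(J z)^T m p]mxE; congr (_ * _); rewrite mxE.
  have sch : (w *m g *m ('D_v J z)^T) 0 p = (v *m 'D_(delta_mx 0 p) J z *m g *m w^T) 0 0.
    have -> : (w *m g *m ('D_v J z)^T) 0 p = (row p ('D_v J z) *m g *m w^T) 0 0.
      have -> : (w *m g *m ('D_v J z)^T) 0 p = (w *m g *m (row p ('D_v J z))^T) 0 0.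
        by rewrite !mxE; apply: eq_bigr => j _; rewrite !mxE.
      by rewrite mx11_tr !trmx_mul trmxK sg mulmxA.
    by rewrite derive_jacobian_sym.
  rewrite sch [LHS]mxE derive_pullback// -/g.
  rewrite !(mulmxDr, mulmxDl) -/w.
  have e1 : (v *m ('D_(delta_mx 0 p) J z *m g *m (J z)^T) *m v^T) 0 0 =
    (v *m 'D_(delta_mx 0 p) J z *m g *m w^T) 0 0 by rewrite /w trmx_mul !mulmxA.
  have e2 : (v *m (J z *m 'D_(delta_mx 0 p *m J z) G2 (phi z) *m (J z)^T) *m v^T) 0 0 =
    (w *m 'D_(delta_mx 0 p *m J z) G2 (phi z) *m w^T) 0 0 by rewrite /w trmx_mul !mulmxA.
  have e3 : (v *m (J z *m g *m ('D_(delta_mx 0 p) J z)^T) *m v^T) 0 0 =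
    (v *m 'D_(delta_mx 0 p) J z *m g *m w^T) 0 0.
    by rewrite mx11_tr /w !trmx_mul !trmxK sg !mulmxA.
  by rewrite !mx_addE e1 e2 e3; ring.
rewrite derive_pullback// pull// -/g -/w.
rewrite scalerDr scalerA mulVf// scale1r opprD addrA.
rewrite scalemxAl mulmxBl !(mulmxDr, mulmxDl) !mulmxA -/w.
by rewrite !addrA addrK.
Qed.

End Covariance.
End EulerLagrange.

(** * Causal geodesics *)

Section OneSided.
Context (R : realType).

Lemma Ck_derive (V W : normedModType R) k (U : set V) (f : V -> W) v :
  Ck k.+1 U f -> Ck k U ('D_v f).
Proof. by move=> [_]; exact. Qed.

Lemma Ck_derive1 (W : normedModType R) k (U : set R) (f : R -> W) :
  Ck k.+1 U f -> Ck k U ('D_1 f).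
Proof. exact: Ck_derive. Qed.

Lemma smooth_on_subset (V W : normedModType R) (A A' : set V) (f : V -> W) :
  A' `<=` A -> smooth_on A f -> smooth_on A' f.
Proof.
move=> s sf x /s /sf[U [F [oU Ux CF FE]]]; exists U, F; split=> // y /s; exact: FE.
Qed.

(** The two difference quotients have the same limits, so the value chosen by [lim] is the same,
    whether or not a limit exists. *)
Lemma rder_right_ext (W : normedModType R) (f g : R -> W) (l : R) :
  (\forall s \near 0^'+, f (l + s) = g (l + s)) -> f l = g l ->
  rder (f : R^o -> W) l 1 = rder (g : R^o -> W) l 1.
Proof.
move=> fg fl; rewrite /rder /lim; congr (get _).
have E (s : R) : s *: (1 : R^o) = s by rewrite /GRing.scale /= mulr1.
have H (f' g' : R -> W) : (\forall s \near 0^'+, f' (l + s) = g' (l + s)) -> f' l = g' l ->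
  forall p : W, (s^-1 *: (f' (l + s *: (1 : R^o)) - f' l)) @[s --> 0^'+] --> p ->
    (s^-1 *: (g' (l + s *: (1 : R^o)) - g' l)) @[s --> 0^'+] --> p.
  move=> fg' fl' p; apply: cvg_trans; apply: near_eq_cvg.
  by apply: filterS fg' => s; rewrite E fl' => ->.
apply/funext => p; apply/propext; split; apply: H => //.
by apply: filterS fg => s ->.
Qed.

Lemma ray_right (a : R) (b : \bar R) (l : R) : ray a b l -> \forall s \near 0^'+, ray a b (l + s).
Proof.
move=> [al]; case: b => [b'| |] //= lb; near=> s.
all: have s0 : 0 < s by near: s; exact: nbhs_right_gt.
all: (split; first by rewrite (le_trans al)// lerDl ltW).
  rewrite !lte_fin addrC -ltrBrDr; near: s; apply: nbhs_right_lt.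
  by rewrite subr_gt0 -lte_fin.
exact: ltry.
Unshelve. all: by end_near. Qed.

Lemma open_right (U : set R) (l : R) : open U -> U l -> \forall s \near 0^'+, U (l + s).
Proof.
move=> oU Ul; have /nbhs_ballP[e /= e0 He] : nbhs l U by exact: open_nbhs_nbhs.
near=> s; apply: He; rewrite -ball_normE /= opprD addrA subrr sub0r normrN.
have s0 : 0 < s by near: s; exact: nbhs_right_gt.
by rewrite gtr0_norm//; near: s; exact: nbhs_right_lt.
Unshelve. all: by end_near. Qed.

End OneSided.

Section ManifoldBasics.
Context (R : realType) (n : nat) (M : topologicalType) (MM : manifold R n M).

Lemma cinv_in (c : chart R n M) y : (cmap c @` cdom c) y ->
  cdom c (cinv c y) /\ cmap c (cinv c y) = y.
Proof. by move=> [x cx <-]; rewrite cmapK. Qed.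

(** The strict inequality removes the boundary t = t0: the domain is open, and the metric is of
    class C^k there in the two-sided sense. *)
Definition half_dom (t0 : R) (Om : set 'rV[R]_n) : set 'rV[R]_(1 + n) :=
  [set z | t0 < lsubmx z 0 0 /\ Om (rsubmx z)].

Lemma open_half_dom t0 Om : open Om -> open (half_dom t0 Om).
Proof.
move=> oOm.
have o1 : open [set z : 'rV[R]_(1 + n) | t0 < lsubmx z 0 0].
  apply: (@open_comp _ _ (fun z : 'rV[R]_(1 + n) => lsubmx z 0 0) [set t | t0 < t]).
    move=> z _; apply: (@continuous_comp _ _ _ (fun z : 'rV[R]_(1 + n) => lsubmx z) (fun A => A 0 0)).
      exact: continuous_lsubmx.
    exact: coord_continuous.
  exact: open_gt.
have o2 : open [set z : 'rV[R]_(1 + n) | Om (rsubmx z)].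
  by apply: open_comp => // z _; exact: continuous_rsubmx.
exact: openI o1 o2.
Qed.

Lemma Ck_block_metric k (D : set 'rV[R]_(1 + n)) (G : R -> 'rV[R]_n -> 'M[R]_n) : open D ->
  Ck k D (fun z => G (lsubmx z 0 0) (rsubmx z)) -> Ck k D (block_metric G).
Proof.
move=> oD CG; apply: Ck_mx => // i j.
case: (split_ordP i) => i' ->; case: (split_ordP j) => j' ->.
- apply: Ck_ext (Ck_cst k D ((-1)%:M i' j' : R)) => // z _.
  by rewrite /block_metric block_mxEul.
- apply: Ck_ext (Ck_cst k D (0 : R)) => // z _.
  by rewrite /block_metric block_mxEur mxE.
- apply: Ck_ext (Ck_cst k D (0 : R)) => // z _.
  by rewrite /block_metric block_mxEdl mxE.
- apply: Ck_ext (Ck_entry i' j' oD CG) => // z _.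
  by rewrite block_metricE.
Qed.

Lemma block_metric_sym (G : R -> 'rV[R]_n -> 'M[R]_n) z :
  (G (lsubmx z 0 0) (rsubmx z))^T = G (lsubmx z 0 0) (rsubmx z) ->
  (block_metric G z)^T = block_metric G z.
Proof. by move=> s; rewrite /block_metric tr_block_mx s !trmx0 tr_scalar_mx. Qed.

Lemma block_metric_unit (G : R -> 'rV[R]_n -> 'M[R]_n) z :
  G (lsubmx z 0 0) (rsubmx z) \in unitmx -> block_metric G z \in unitmx.
Proof.
move=> u; rewrite unitmxE det_lblock det_scalar unitrM -unitmxE u andbT.
by rewrite expr1 unitrN unitr1.
Qed.

Lemma block_metric_quad (G : R -> 'rV[R]_n -> 'M[R]_n) z (v : 'rV[R]_(1 + n)) :
  (v *m block_metric G z *m v^T) 0 0 = - (v 0 (lshift n 0)) ^+ 2 +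
  (rsubmx v *m G (lsubmx z 0 0) (rsubmx z) *m (rsubmx v)^T) 0 0.
Proof.
rewrite -[in LHS](hsubmxK v) /block_metric mul_row_block !mulmx0 addr0 add0r tr_row_mx.
rewrite mul_row_col mx_addE; congr (_ + _).
by rewrite mul_mx_scalar scaleN1r mulNmx mxE mxE big_ord1 !mxE expr2.
Qed.

Section MetricFamily.
Context (t0 : R) (k : R -> tensor2 R n M) (hk : metric_family MM t0 k).

Definition chart_metric (c : chart R n M) (t : R) (y : 'rV[R]_n) := k t c (cinv c y).

Lemma st_metricE c : st_metric k c = block_metric (chart_metric c).
Proof. by []. Qed.

Definition st_dom (c : chart R n M) := half_dom t0 (cmap c @` cdom c).

Lemma open_st_dom c : open (st_dom c).
Proof. by apply: open_half_dom; exact: cimg_open. Qed.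

Lemma Ck_chart_metric c j : atlas MM c ->
  Ck j (st_dom c) (fun z => chart_metric c (lsubmx z 0 0) (rsubmx z)).
Proof.
move=> ac; have [_ _ _ /(_ c ac) sm] := hk.
apply: smooth_on_Ck; first exact: open_st_dom.
by apply: smooth_on_subset sm => z [/ltW].
Qed.

Lemma Ck_st_metric c j : atlas MM c -> Ck j (st_dom c) (st_metric k c).
Proof. move=> ac; rewrite st_metricE.
by apply: (@Ck_block_metric _ _ (chart_metric c)); [exact: open_st_dom|exact: Ck_chart_metric]. Qed.

Lemma chart_metric_sym c t x : atlas MM c -> t0 <= t -> cdom c x -> (k t c x)^T = k t c x.
Proof. by move=> ac tt cx; have [_ + _ _] := hk; exact. Qed.

Lemma chart_metric_posdef c t x : atlas MM c -> t0 <= t -> cdom c x -> posdef (k t c x).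
Proof. by move=> ac tt cx v v0; have [_ _ + _] := hk; exact. Qed.

Lemma st_metric_sym c z : atlas MM c -> st_dom c z -> (st_metric k c z)^T = st_metric k c z.
Proof.
move=> ac [/ltW t1 /cinv_in[cz _]]; apply: (@block_metric_sym (chart_metric c)).
exact: chart_metric_sym.
Qed.

Lemma st_metric_unit c z : atlas MM c -> st_dom c z -> st_metric k c z \in unitmx.
Proof.
move=> ac [/ltW t1 /cinv_in[cz _]]; apply: (@block_metric_unit (chart_metric c)).
apply: posdef_unitmx; exact: chart_metric_posdef.
Qed.

Lemma st_coord_dom c t x : t0 < t -> cdom c x -> st_dom c (st_coord c t x).
Proof.
move=> tt cx; split; first by rewrite /st_coord row_mxKl mxE mulr1n.
by rewrite /st_coord row_mxKr; exists x.
Qed.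

End MetricFamily.
End ManifoldBasics.

Section RayCurve.
Context (R : realType) (n : nat) (M : topologicalType) (c : chart R n M).
Context (a : R) (b : \bar R) (tau : R -> R) (xi : R -> M) (l : R).
Hypotheses (cxi : {within ray a b, continuous xi})
  (sm : smooth_on [set l : R^o | ray a b l /\ cdom c (xi l)] (st_curve tau xi c))
  (rl : ray a b l) (cl : cdom c (xi l)).

Lemma ray_chart_near : \forall l' \near l, ray a b l' -> cdom c (xi l').
Proof.
have := (iffLR (subspace_continuousP _ _) cxi) l rl.
move=> /(_ (cdom c)); apply.
by apply: open_nbhs_nbhs; split => //; exact: cdom_open.
Qed.

(** [F] extends the curve smoothly to a full neighbourhood of [l], also when [l] is the initial
    parameter; the one-sided velocity, acceleration and energy on the ray become ordinary
    derivatives of [F]. *)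
Lemma ray_curve : exists U (F : R -> 'rV[R]_(1 + n)),
  [/\ open U, U l, forall k, Ck k U F & forall l', U l' -> ray a b l' ->
    [/\ cdom c (xi l'), F l' = st_curve tau xi c l', velocity tau xi c l' = 'D_1 F l',
      acceleration tau xi c l' = 'D_1 ('D_1 F) l' & energy tau l' = 'D_1 F l' 0 (lshift n 0)]].
Proof.
have [U0 [F [oU0 U0l CF FE]]] : exists (U : set R) (F : R -> 'rV[R]_(1 + n)),
    [/\ open U, U l, forall k, Ck k U F &
      forall y, ray a b y /\ cdom c (xi y) -> U y -> F y = st_curve tau xi c y].
  exact: sm (conj rl cl).
have := ray_chart_near; rewrite -nbhs_nearE nbhsE => -[W [oW Wl] WH].
pose U := U0 `&` W.
have oU : open U by exact: openI.
have CFU k : Ck k U F by apply: Ck_subset (CF k) => ? [].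
have FS l' : U l' -> ray a b l' -> cdom c (xi l') /\ F l' = st_curve tau xi c l'.
  by move=> [U0l' /WH Wl'] rl'; split; [exact: Wl'|apply: FE => //; split => //; exact: Wl'].
have near' l' : U l' -> ray a b l' -> \forall s \near 0^'+, U (l' + s) /\ ray a b (l' + s).
  by move=> Ul' rl'; apply: filterI; [exact: open_right|exact: ray_right].
have vE l' : U l' -> ray a b l' -> velocity tau xi c l' = 'D_1 F l'.
  move=> Ul' rl'; rewrite /velocity (@rder_right_ext _ _ _ F).
  - by apply: rder_derive; have [] := Ck_derivable1 (CFU 1) Ul'.
  - by apply: filterS (near' _ Ul' rl') => s [Us rs]; have [_ ->] := FS _ Us rs.
  - by have [_ ->] := FS _ Ul' rl'.
exists U, F; split; [exact: oU|split; [exact: U0l|exact: Wl]|exact: CFU|move=> l' Ul' rl'].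
have [cl' Fl'] := FS _ Ul' rl'; split; [exact: cl'|exact: Fl'|exact: vE| |].
  rewrite /acceleration (@rder_right_ext _ _ _ ('D_1 F)).
  - by apply: rder_derive; have [] := Ck_derivable1 (Ck_derive1 (CFU 2)) Ul'.
  - by apply: filterS (near' _ Ul' rl') => s [Us rs]; exact: vE.
  - exact: vE.
have tE l'' : U l'' -> ray a b l'' -> tau l'' = F l'' 0 (lshift n 0).
  by move=> U1 r1; have [_ ->] := FS _ U1 r1; rewrite /st_curve /st_coord row_mxEl mxE mulr1n.
rewrite /energy (@rder_right_ext _ _ _ (fun s => F s 0 (lshift n 0))).
- have [d1 d2] := is_derive_entry 0 (lshift n 0) (Ck_derivable1 (CFU 1) Ul').
  by rewrite -d2; exact: rder_derive.
- by apply: filterS (near' _ Ul' rl') => s [Us rs]; exact: tE.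
- exact: tE.
Qed.

End RayCurve.

Section GeodesicLocality.
Context (R : realType) (n : nat) (M : topologicalType) (MM : manifold R n M).
Context (t0 : R) (k : R -> tensor2 R n M).

Lemma near_right (P : R -> Prop) (l : R) : (\forall l' \near l, P l') -> \forall s \near 0^'+, P (l + s).
Proof.
rewrite -nbhs_nearE nbhsE => -[U [oU Ul] UP].
by apply: filterS (open_right oU Ul) => s /UP.
Qed.

Lemma near_near (P : R -> Prop) (l : R) : (\forall l' \near l, P l') ->
  \forall l' \near l, \forall l'' \near l', P l''.
Proof. by move=> N; apply: nbhs_interior. Qed.

(** The gluing principle for geodesics. Agreement is required near [l] relative to the ray, so that
    the initial parameter is treated like the others. *)
Lemma fcg_local (a : R) (b : \bar R) (tau : R -> R) (xi : R -> M) : (a%:E < b)%E ->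
  (forall l, ray a b l -> exists a' b' tau' xi', [/\ future_causal_geodesic MM t0 k a' b' tau' xi',
     ray a' b' l & \forall l' \near l, ray a b l' -> [/\ ray a' b' l', tau l' = tau' l' & xi l' = xi' l']]) ->
  future_causal_geodesic MM t0 k a b tau xi.
Proof.
move=> ab H.
have right_eq l (P : R -> Prop) : ray a b l -> (\forall l' \near l, ray a b l' -> P l') ->
    P l /\ \forall s \near 0^'+, P (l + s).
  move=> rl N; split; first exact: nbhs_singleton N rl.
  by apply: filterS2 (near_right N) (ray_right rl) => s; apply.
have main l : ray a b l -> exists a' b' tau' xi', [/\ future_causal_geodesic MM t0 k a' b' tau' xi',
     ray a' b' l, \forall l' \near l, ray a b l' -> [/\ ray a' b' l', tau l' = tau' l' & xi l' = xi' l'],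
     (tau l = tau' l /\ xi l = xi' l) &
     forall c : chart R n M, [/\ velocity tau xi c l = velocity tau' xi' c l,
       acceleration tau xi c l = acceleration tau' xi' c l & energy tau l = energy tau' l]].
  move=> rl; have [a' [b' [tau' [xi' [fg rl' N]]]]] := H l rl.
  have e0 : tau l = tau' l /\ xi l = xi' l by have [_ ? ?] := nbhs_singleton N rl.
  exists a', b', tau', xi'; split; [exact: fg|exact: rl'|exact: N|exact: e0|].
  have vE (c : chart R n M) l1 : ray a b l1 -> (\forall l' \near l1, ray a b l' -> [/\ ray a' b' l', tau l' = tau' l' & xi l' = xi' l']) ->
      velocity tau xi c l1 = velocity tau' xi' c l1.
    move=> rl1 N1; have [[_ e1 e2] N2] := right_eq _ _ rl1 N1.
    apply: rder_right_ext; last by rewrite /st_curve e1 e2.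
    by apply: filterS N2 => s [_ f1 f2]; rewrite /st_curve f1 f2.
  move=> c; split; first exact: vE.
    have N3 : \forall l' \near l, ray a b l' -> velocity tau xi c l' = velocity tau' xi' c l'.
      by apply: filterS (near_near N) => l1 N1 rl1; exact: vE.
    by have [e1 N4] := right_eq _ _ rl N3; apply: rder_right_ext; [exact: N4|exact: e1].
  have [[_ e1 e2] N2] := right_eq _ _ rl N.
  apply: rder_right_ext; last exact: e1.
  by apply: filterS N2 => s [].
split; [exact: ab|split|].
- move=> l rl; have [a' [b' [tau' [xi' [[_ [h1 _ _ _] _] rl' _ [-> _] _]]]]] := main l rl.
  exact: h1.
- apply/subspace_continuousP => l rl.
  have [a' [b' [tau' [xi' [[_ [_ h2 _ _] _] rl' N [_ xE] _]]]]] := main l rl.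
  have c2 : xi' x @[x --> within (ray a' b') (nbhs l)] --> xi' l.
    exact: (iffLR (subspace_continuousP _ _) h2).
  suff : xi x @[x --> within (ray a b) (nbhs l)] --> xi l by [].
  rewrite xE; apply: cvg_trans c2.
  move=> A /= HA; have {}HA : \forall l' \near l, ray a' b' l' -> A (xi' l') := HA.
  have : \forall l' \near l, ray a b l' -> A (xi l'); last by [].
  by apply: filterS2 N HA => l1 e1 e2 r1; have [r2 _ ->] := e1 r1; exact: e2.
- move=> c ac l [rl cl].
  have [a' [b' [tau' [xi' [[_ [_ _ h3 _] _] rl' N [_ xE] _]]]]] := main l rl.
  have cl' : cdom c (xi' l) by rewrite -xE.
  have [U [F [oU Ul CF FE]]] : exists (U : set R) (F : R -> 'rV[R]_(1 + n)),
    [/\ open U, U l, forall k, Ck k U F &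
      forall y, ray a' b' y /\ cdom c (xi' y) -> U y -> F y = st_curve tau' xi' c y].
    exact: h3 c ac l (conj rl' cl').
  move: N; rewrite -nbhs_nearE nbhsE => -[W [oW Wl] WH].
  exists (U `&` W : set R), F; split.
  + exact: openI.
  + by split.
  + by move=> j; apply: (@Ck_subset R R _ j U) (CF j) => y [].
  + move=> y [ry cy] [Uy Wy]; have [r1 e1 e2] := WH y Wy ry.
    by rewrite /st_curve e1 e2; apply: FE => //; split => //; rewrite -e2.
- move=> c l i ac rl cl.
  have [a' [b' [tau' [xi' [[_ [_ _ _ h4] _] rl' N [tE xE] E]]]]] := main l rl.
  have [-> -> _] := E c; rewrite /st_curve tE xE; apply: h4 => //.
  by rewrite -xE.
- move=> c l ac rl cl.
  have [a' [b' [tau' [xi' [[_ _ h5] rl' N [tE xE] E]]]]] := main l rl.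
  have [-> _ ->] := E c; rewrite /st_curve tE xE; apply: h5 => //.
  by rewrite -xE.
Qed.

End GeodesicLocality.

(** * Uniqueness of causal geodesics *)

Lemma real_induction (R : realType) (S : R -> Prop) (l0 b : R) : S l0 ->
  (forall l, l0 <= l < b -> S l -> exists2 d, 0 < d & forall l', l <= l' < l + d -> l' < b -> S l') ->
  (forall l, l0 < l < b -> (forall l', l0 <= l' < l -> S l') -> S l) ->
  forall l, l0 <= l < b -> S l.
Proof.
move=> S0 Sr Sl l1 /andP[l01 l1b]; apply: contrapT => nS.
pose A := [set l | l0 <= l <= l1 /\ forall l', l0 <= l' <= l -> S l'].
have A0 : A l0.
  split; first by rewrite lexx.
  by move=> l' /andP[h1 h2]; have -> : l' = l0 by apply/eqP; rewrite eq_le h1 h2.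
have sA : has_sup A by split; [exists l0|exists l1 => l [/andP[]]].
pose s := sup A.
have s0 : l0 <= s by apply: ub_le_sup => //; exact: (proj2 sA).
have s1 : s <= l1 by apply: ge_sup; [exists l0|move=> l [/andP[]]].
have below l' : l0 <= l' < s -> S l'.
  move=> /andP[h1 h2]; have e : 0 < s - l' by rewrite subr_gt0.
  have [l [Al AS] l'l] := sup_adherent e sA.
  by apply: AS; rewrite h1 ltW//; move: l'l; rewrite opprB addrC subrK.
have Ss : S s.
  move: s0; rewrite le_eqVlt => /predU1P[<- //|s0].
  by apply: Sl => //; rewrite s0 (le_lt_trans s1).
have sl1 : s < l1 by rewrite lt_neqAle s1 andbT; apply/eqP => E; apply: nS; rewrite -E.
have [d d0 Hd] := Sr s (introT andP (conj s0 (lt_trans sl1 l1b))) Ss.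
pose m := Num.min (d / 2) (l1 - s).
have m0 : 0 < m by rewrite lt_min divr_gt0//= subr_gt0.
have : A (s + m).
  split; first by rewrite (le_trans s0) ?lerDl ?(ltW m0)//= addrC -lerBrDr ge_min lexx orbT.
  move=> l' /andP[h1 h2]; have [l's|sl'] := ltP l' s; first by apply: below; rewrite h1.
  have ml1 : s + m <= l1 by rewrite addrC -lerBrDr ge_min lexx orbT.
  have md : m < d by apply: (@le_lt_trans _ _ (d / 2)); rewrite ?ge_min ?lexx// ltr_pdivrMr// ltr_pMr// ltr1n.
  apply: Hd; first by rewrite sl' (le_lt_trans h2)// ltrD2l.
  exact: le_lt_trans (le_trans h2 ml1) l1b.
move=> /(ub_le_sup (proj2 sA)); rewrite -/s leNgt => /negP; apply.
by rewrite ltrDl.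
Qed.

Lemma is_derive_row_mx (R : realType) (V : normedModType R) m n1 n2
  (A : V -> 'M[R]_(m, n1)) (B : V -> 'M[R]_(m, n2)) x v (dA : 'M[R]_(m, n1)) (dB : 'M[R]_(m, n2)) :
  is_derive x v A dA -> is_derive x v B dB ->
  is_derive x v (fun s => row_mx (A s) (B s)) (row_mx dA dB).
Proof.
move=> hA hB; apply: is_derive_mx => i j; case: (split_ordP j) => j' ->.
  rewrite row_mxEl; have -> : (fun s => row_mx (A s) (B s) i (lshift n2 j')) = fun s => A s i j'.
    by apply/funext => s; rewrite row_mxEl.
  exact: is_derive_entry.
rewrite row_mxEr; have -> : (fun s => row_mx (A s) (B s) i (rshift n1 j')) = fun s => B s i j'.
  by apply/funext => s; rewrite row_mxEr.
exact: is_derive_entry.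
Qed.

Lemma derive1_left_eq (R : realType) (V : normedModType R) (f g : R -> V) (l d : R) : 0 < d ->
  derivable f l 1 -> derivable g l 1 -> (forall l', l - d < l' <= l -> f l' = g l') ->
  'D_1 f l = 'D_1 g l.
Proof.
move=> d0 df dg fg.
have ff : (h^-1 *: ((f \o shift l) (h *: (1 : R)) - f l)) @[h --> 0^'-] --> 'D_1 f l.
  by apply: cvg_dnbhs_at_left; exact: df.
have gg : (h^-1 *: ((g \o shift l) (h *: (1 : R)) - g l)) @[h --> 0^'-] --> 'D_1 g l.
  by apply: cvg_dnbhs_at_left; exact: dg.
apply: (cvg_unique _ ff); first exact: norm_hausdorff.
apply: cvg_trans gg; apply: near_eq_cvg; near=> h.
have h0 : h < 0 by near: h; exact: nbhs_left_lt.
have hd : - d < h by near: h; apply: nbhs_left_gt; rewrite oppr_lt0.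
have E : h *: (1 : R) = h by rewrite /GRing.scale /= mulr1.
rewrite /= E !fg//; first by rewrite lexx andbT; lra.
by apply/andP; split; lra.
Unshelve. all: by end_near. Qed.

Lemma near_norm_le (R : realType) (V W : normedModType R) (u : V -> W) x (r : R) : 0 < r ->
  {for x, continuous u} -> \forall s \near x, `|u s - u x| <= r.
Proof.
move=> r0 cu; have := iffLR (cvgrPdist_lt _ _) cu r r0; move=> /(_ _).
by apply: filterS => s; rewrite distrC => /ltW.
Qed.

Lemma left_limit_eq (R : realType) (T : topologicalType) (f g : R -> T) (l0 l : R) :
  hausdorff_space T -> l0 < l -> {for l, continuous f} -> {for l, continuous g} ->
  (forall s : R, l0 <= s < l -> f s = g s) -> f l = g l.
Proof.
move=> hT l0l cf cg fg.
have cf' : f x @[x --> l^'-] --> f l by exact: cvg_at_left_filter.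
have cg' : g x @[x --> l^'-] --> g l by exact: cvg_at_left_filter.
apply: (cvg_unique hT cf'); apply: cvg_trans cg'; apply: near_eq_cvg; near=> s.
apply/esym/fg/andP; split; first by near: s; exact: nbhs_left_ge.
by near: s; exact: nbhs_left_lt.
Unshelve. all: by end_near. Qed.

Lemma derivable_left_limit_eq (R : realType) (W : normedModType R) (f g : R -> W) (l0 l : R) :
  l0 < l -> derivable f l 1 -> derivable g l 1 ->
  (forall s : R, l0 <= s < l -> f s = g s) -> f l = g l.
Proof.
move=> l0l df dg; apply: (left_limit_eq (@norm_hausdorff _ W) l0l).
  by apply: differentiable_continuous; apply/derivable1_diffP.
by apply: differentiable_continuous; apply/derivable1_diffP.
Qed.

Section InteriorGeodesics.
Context (R : realType) (n : nat) (M : topologicalType) (MM : manifold R n M).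
Context (t0 : R) (k : R -> tensor2 R n M) (hk : metric_family MM t0 k).

Definition crv (tau : R -> R) (xi : R -> M) (c : chart R n M) (s : R) : 'rV[R]_(1 + n) :=
  st_coord c (tau s) (xi s).

(* At an interior parameter the one-sided derivatives are two-sided; [geo_int] and
   [causal_int] are the conditions of a future causal geodesic at such a parameter. *)
Definition geo_int (tau : R -> R) (xi : R -> M) (l : R) := [/\ t0 < tau l, {for l, continuous xi} &
  forall c, atlas MM c -> cdom c (xi l) -> exists U : set R, [/\ open U, U l,
    forall j, Ck j U (crv tau xi c) &
    'D_1 ('D_1 (crv tau xi c)) l =
      geo_accel (st_metric k c) (crv tau xi c l) ('D_1 (crv tau xi c) l)]].

Definition causal_int (tau : R -> R) (xi : R -> M) (l : R) := forall c, atlas MM c -> cdom c (xi l) ->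
  0 < 'D_1 (tau : R -> R) l /\
  ('D_1 (crv tau xi c) l *m st_metric k c (crv tau xi c l) *m ('D_1 (crv tau xi c) l)^T) 0 0 <= 0.

(** Comparing velocities in a single chart is enough: with the position they are the initial data of
    the first order system in that chart. *)
Definition same_state (tau1 : R -> R) (xi1 : R -> M) (tau2 : R -> R) (xi2 : R -> M) (l : R) :=
  [/\ tau1 l = tau2 l, xi1 l = xi2 l & exists c, [/\ atlas MM c, cdom c (xi1 l) &
    'D_1 (crv tau1 xi1 c) l = 'D_1 (crv tau2 xi2 c) l]].

Lemma crv_tau tau xi c s : crv tau xi c s 0 (lshift n 0) = tau s.
Proof. by rewrite /crv /st_coord row_mxEl mxE mulr1n. Qed.

Lemma crv_state tau xi l c : geo_int tau xi l -> atlas MM c -> cdom c (xi l) ->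
  is_derive l 1 (fun s => row_mx (crv tau xi c s) ('D_1 (crv tau xi c) s))
    (geo_field (st_metric k c) (row_mx (crv tau xi c l) ('D_1 (crv tau xi c) l))).
Proof.
move=> [_ _ /(_ c)] H ac cl; have [U [oU Ul CU E]] := H ac cl.
rewrite /geo_field row_mxKl row_mxKr -E.
exact: is_derive_row_mx (Ck_derivable1 (CU 1) Ul) (Ck_derivable1 (Ck_derive1 (CU 2)) Ul).
Qed.

(** In a chart around the common point both curves, with their velocities, solve the first order
    system of [geo_field]; by continuity they stay for a while in a ball where that field is
    Lipschitz. *)
Lemma geodesic_unique_near (a b : R) tau1 xi1 tau2 xi2 (l : R) :
  (forall s, a < s < b -> geo_int tau1 xi1 s) -> (forall s, a < s < b -> geo_int tau2 xi2 s) ->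
  a < l < b -> same_state tau1 xi1 tau2 xi2 l ->
  exists2 d, 0 < d & forall s, l - d < s < l + d -> same_state tau1 xi1 tau2 xi2 s.
Proof.
move=> g1 g2 lI [tl xl [c [ac cl vl]]].
pose f := geo_field (st_metric k c).
pose D := geo_domain (st_dom t0 c).
have oS : open (st_dom t0 c) by exact: open_st_dom.
have Cf : Ck 1 D f.
  exact: (Ck_geo_field oS (fun j => Ck_st_metric hk j ac) (fun z => st_metric_unit hk ac) 1).
have cl2 : cdom c (xi2 l) by rewrite -xl.
pose u1 s := row_mx (crv tau1 xi1 c s) ('D_1 (crv tau1 xi1 c) s).
pose u2 s := row_mx (crv tau2 xi2 c s) ('D_1 (crv tau2 xi2 c) s).
have ul : u1 l = u2 l by rewrite /u1 /u2 vl /crv tl xl.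
have Dp : D (u1 l).
  rewrite /D /geo_domain /= /u1 row_mxKl; apply: st_coord_dom; last exact: cl.
  by have [] := g1 l lI.
have [r [L [r0 L0 rD fl]]] := Ck1_lipschitz (open_geo_domain oS) Cf Dp.
have N1 : \forall s \near l, a < s < b.
  have : \forall s \near l, s \in `]a, b[ by exact: near_in_itvoo.
  by apply: filterS => s; rewrite in_itv.
have Nc tau xi : geo_int tau xi l -> cdom c (xi l) -> \forall s \near l, cdom c (xi s).
  by move=> [_ cx _] cxl; apply: cx; apply: open_nbhs_nbhs; split; [exact: cdom_open|exact: cxl].
have Nu tau xi : geo_int tau xi l -> cdom c (xi l) ->
    row_mx (crv tau xi c l) ('D_1 (crv tau xi c) l) = u1 l ->
    \forall s \near l, `|row_mx (crv tau xi c s) ('D_1 (crv tau xi c) s) - u1 l| <= r.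
  move=> g cxl E; have [d _] := crv_state g ac cxl; rewrite -E.
  exact: near_norm_le r0 (differentiable_continuous (iffLR (derivable1_diffP _ _) d)).
pose I := @filterI _ _ (nbhs_filter l).
have NA := I _ _ N1 (I _ _ (I _ _ (Nc _ _ (g1 l lI) cl) (Nc _ _ (g2 l lI) cl2))
  (I _ _ (Nu _ _ (g1 l lI) cl erefl) (Nu _ _ (g2 l lI) cl2 (esym ul)))).
have [d /= d0 Hd] := iffLR (nbhs_ballP _ _) NA.
have dI s : l - d < s < l + d -> ball l d s.
  by move=> /andP[h1 h2]; rewrite -ball_normE /= ltr_distl; apply/andP; split; lra.
exists d; [exact: d0|move=> s sI].
have lI' : l - d < l < l + d by apply/andP; split; lra.
have U := @ode_unique R _ f [set x | `|x - u1 l| <= r] L (l - d) (l + d) l u1 u2 L0 fl _ lI' ul.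
have {}U : forall s, l - d < s < l + d -> u1 s = u2 s.
  apply: U => s' /dI/Hd[s'I [[c1 c2] [h1 h2]]].
  by split; [exact: h1|exact: h2|exact: (crv_state (g1 _ s'I) ac c1)|exact: (crv_state (g2 _ s'I) ac c2)].
have Es := U s sI; have [_ [[c1 c2] _]] := Hd _ (dI s sI).
have [E1 E2] := eq_row_mx Es.
have [E3 E4] := eq_row_mx E1.
split.
- by rewrite -(crv_tau tau1 xi1 c) E1 crv_tau.
- by rewrite -(cmapK c1) E4 cmapK.
- by exists c; split; [exact: ac|exact: c1|exact: E2].
Qed.

(** The points agree at [l] because the manifold is Hausdorff, the velocities because a derivative
    can be computed from the left. *)
Lemma same_state_closed (a b : R) tau1 xi1 tau2 xi2 (l0 l : R) :
  (forall s, a < s < b -> geo_int tau1 xi1 s) -> (forall s, a < s < b -> geo_int tau2 xi2 s) ->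
  a < l < b -> l0 < l -> (forall s, l0 <= s < l -> same_state tau1 xi1 tau2 xi2 s) ->
  same_state tau1 xi1 tau2 xi2 l.
Proof.
move=> g1 g2 lI l0l H.
have [t1 cx1 h1] := g1 l lI; have [t2 cx2 h2] := g2 l lI.
have xE : xi1 l = xi2 l.
  by apply: (left_limit_eq (mfd_hausdorff MM) l0l cx1 cx2) => s /H[].
pose c := chart_at MM (xi1 l); have [ac cl1] := chart_atP MM (xi1 l).
have cl2 : cdom c (xi2 l) by rewrite -xE.
have [U1 [oU1 U1l C1 _]] := h1 c ac cl1; have [U2 [oU2 U2l C2 _]] := h2 c ac cl2.
have d1 := Ck_derivable1 (C1 1) U1l; have d2 := Ck_derivable1 (C2 1) U2l.
have crvE s : l0 <= s < l -> crv tau1 xi1 c s = crv tau2 xi2 c s.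
  by move=> /H[e1 e2 _]; rewrite /crv e1 e2.
have crvl : crv tau1 xi1 c l = crv tau2 xi2 c l.
  by apply: (derivable_left_limit_eq l0l _ _ crvE); [have [] := d1|have [] := d2].
split; [by rewrite -(crv_tau tau1 xi1 c) crvl crv_tau|exact: xE|].
exists c; split; [exact: ac|exact: cl1|]; apply: (@derive1_left_eq _ _ _ _ _ (l - l0)).
- by rewrite subr_gt0.
- by have [] := d1.
- by have [] := d2.
move=> s /andP[]; rewrite le_eqVlt => h3 /predU1P[-> //|h4].
by apply: crvE; apply/andP; split; lra.
Qed.

Lemma geodesic_unique (a b : R) tau1 xi1 tau2 xi2 (l0 : R) :
  (forall s, a < s < b -> geo_int tau1 xi1 s) -> (forall s, a < s < b -> geo_int tau2 xi2 s) ->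
  a < l0 < b -> same_state tau1 xi1 tau2 xi2 l0 ->
  forall l, l0 <= l < b -> tau1 l = tau2 l /\ xi1 l = xi2 l.
Proof.
move=> g1 g2 /andP[al0 l0b] S0 l lI.
suff [] : same_state tau1 xi1 tau2 xi2 l by [].
apply: (real_induction S0 _ _ lI).
- move=> s /andP[l0s sb] Ss.
  have sI : a < s < b by rewrite (lt_le_trans al0).
  have [d d0 Hd] := geodesic_unique_near g1 g2 sI Ss.
  exists d; [exact: d0|move=> s' /andP[h1 h2] _; apply: Hd; rewrite h2 andbT].
  by rewrite (lt_le_trans _ h1)// gtrBl.
- move=> s /andP[l0s sb] Hs; apply: (same_state_closed g1 g2 _ l0s Hs).
  by rewrite (lt_trans al0).
Qed.

Lemma same_state_near tau1 xi1 tau2 xi2 (l : R) :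
  (\forall s \near l, tau1 s = tau2 s /\ xi1 s = xi2 s) -> same_state tau1 xi1 tau2 xi2 l.
Proof.
move=> N; have [e1 e2] := nbhs_singleton N; split; [exact: e1|exact: e2|].
exists (chart_at MM (xi1 l)); have [ac cl] := chart_atP MM (xi1 l); split; [exact: ac|exact: cl|].
by apply: near_eq_derive; apply: filterS N => s [f1 f2]; rewrite /crv f1 f2.
Qed.

End InteriorGeodesics.

Section InteriorEquivalence.
Context (R : realType) (n : nat) (M : topologicalType) (MM : manifold R n M).
Context (t0 : R) (k : R -> tensor2 R n M).

Lemma geo_accelE (c : chart R n M) (z v a : 'rV[R]_(1 + n)) :
  (forall p, a 0 p + \sum_i \sum_j christoffel (st_metric k c) p i j z * v 0 i * v 0 j = 0) <->
  a = geo_accel (st_metric k c) z v.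
Proof.
split=> [H|-> p]; last by rewrite !mxE addNr.
by apply/rowP => p; have /eqP := H p; rewrite addr_eq0 => /eqP ->; rewrite !mxE.
Qed.

Lemma ray_near (a : R) (b : \bar R) (l : R) : a < l -> (l%:E < b)%E ->
  \forall l' \near l, a < l' /\ (l'%:E < b)%E.
Proof.
move=> al lb; apply: filterI; first by apply: open_nbhs_nbhs; split; [exact: open_gt|exact: al].
case: b lb => [b'| |] lb.
- have lb' : l < b' by rewrite -lte_fin.
  have : \forall l' \near l, l' < b' by apply: open_nbhs_nbhs; split; [exact: open_lt|exact: lb'].
  by apply: filterS => l'; rewrite lte_fin.
- by apply: (@filterS _ (nbhs l) _ setT); [move=> x _; exact: ltry|exact: filterT].
- by [].
Qed.

Lemma near_shrink (P : R -> Prop) (l : R) : (\forall l' \near l, P l') ->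
  exists U : set R, [/\ open U, U l & forall l', U l' -> P l'].
Proof. by rewrite -nbhs_nearE nbhsE => -[U [oU Ul] UP]; exists U; split. Qed.

Lemma crv_is_derive_tau tau (xi : R -> M) c (U : set R) l : Ck 1 U (crv tau xi c) -> U l ->
  is_derive l 1 tau ('D_1 (crv tau xi c) l 0 (lshift n 0)).
Proof.
move=> CU Ul; have := is_derive_entry 0 (lshift n 0) (Ck_derivable1 CU Ul).
rewrite (_ : (fun s => crv tau xi c s 0 (lshift n 0)) = tau); first exact: id.
by apply/funext => s; exact: crv_tau.
Qed.

Section FromRay.
Context (a : R) (b : \bar R) (tau : R -> R) (xi : R -> M).
Hypothesis fcg : future_causal_geodesic MM t0 k a b tau xi.

Lemma fcg_crv (l : R) c : a < l -> (l%:E < b)%E -> atlas MM c -> cdom c (xi l) ->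
  exists U : set R, [/\ open U, U l, forall j, Ck j U (crv tau xi c) & forall l', U l' ->
    [/\ ray a b l', cdom c (xi l'), velocity tau xi c l' = 'D_1 (crv tau xi c) l',
      acceleration tau xi c l' = 'D_1 ('D_1 (crv tau xi c)) l' &
      is_derive l' 1 tau (energy tau l')]].
Proof.
move=> al lb ac cl; have [ab [h1 h2 h3 h4] h5] := fcg.
have rl : ray a b l by split; [exact: ltW|].
have [U0 [F [oU0 U0l CF H]]] := ray_curve h2 (h3 c ac) rl cl.
have [V [oV Vl VH]] := near_shrink (ray_near al lb).
pose U : set R := U0 `&` V.
have oU : open U by exact: openI.
have rU l' : U l' -> ray a b l' by move=> [_ /VH[/ltW]].
have FE l' : U l' -> F l' = crv tau xi c l'.
  by move=> Ul'; have [_ -> _ _ _] := H l' (proj1 Ul') (rU _ Ul').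
have CU j : Ck j U (crv tau xi c).
  apply: (Ck_ext oU (f := F)); first by move=> x Ux; rewrite FE.
  by apply: Ck_subset (CF j) => x [].
have nU l' : U l' -> \forall s \near l', U s by move=> Ul'; exact: open_nbhs_nbhs.
have DE l' : U l' -> 'D_1 F l' = 'D_1 (crv tau xi c) l'.
  by move=> Ul'; apply: near_eq_derive; apply: filterS (nU _ Ul') => s; exact: FE.
exists U; split; [exact: oU|by split|exact: CU|move=> l' Ul'].
have [h6 h7 h8 h9 h10] := H l' (proj1 Ul') (rU _ Ul').
split; [exact: rU|exact: h6|by rewrite h8 DE| |].
  by rewrite h9; apply: near_eq_derive; apply: filterS (nU _ Ul') => s; exact: DE.
by rewrite h10 (DE _ Ul'); exact: crv_is_derive_tau (CU 1) Ul'.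
Qed.

Lemma fcg_tau (l : R) : a < l -> (l%:E < b)%E -> is_derive l 1 tau (energy tau l).
Proof.
move=> al lb; have [ac cl] := chart_atP MM (xi l).
by have [U [_ Ul _ /(_ l Ul)[]]] := fcg_crv al lb ac cl.
Qed.

Lemma fcg_energy_gt0 (l : R) : ray a b l -> 0 < energy tau l.
Proof.
move=> rl; have [ac cl] := chart_atP MM (xi l).
by have [_ _ h5] := fcg; have [] := h5 _ l ac rl cl.
Qed.

Lemma fcg_tau_gt (l : R) : a < l -> (l%:E < b)%E -> t0 < tau l.
Proof.
move=> al lb; have [_ [h1 _ _ _] _] := fcg.
(* The midpoint avoids [a], where [tau] has only a one-sided derivative; from a value at least [t0]
   at [l1], positive energy gives strict growth. *)
pose l1 := (a + l) / 2; have [al1 l1l] := midf_lt al.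
have d x : l1 <= x <= l -> is_derive x 1 tau (energy tau x).
  move=> /andP[h2 h3]; apply: fcg_tau; first exact: lt_le_trans h2.
  by apply: le_lt_trans lb; rewrite lee_fin.
have [x /andP[l1x xl] E] := MVT_open l1l d.
apply: (@le_lt_trans _ _ (tau l1)).
  by apply: h1; split; [exact: ltW|apply: lt_trans lb; rewrite lte_fin].
rewrite -subr_gt0 E mulr_gt0// ?subr_gt0//; apply: fcg_energy_gt0; split.
  by rewrite ltW// (lt_trans al1).
by apply: lt_trans lb; rewrite lte_fin.
Qed.

Lemma fcg_geo_int (l : R) : a < l -> (l%:E < b)%E -> geo_int MM t0 k tau xi l.
Proof.
move=> al lb; have [ab [h1 h2 h3 h4] h5] := fcg; split.
- exact: fcg_tau_gt.
- have rl : ray a b l by split; [exact: ltW|].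
  have c1 := iffLR (subspace_continuousP _ _) h2 l rl.
  move=> A HA; have := c1 A HA; rewrite nbhs_nearE => N.
  have : \forall x \near l, ray a b x -> A (xi x) := N.
  move=> N1; have : \forall x \near l, A (xi x); last by [].
  by apply: filterS2 N1 (ray_near al lb) => x; move=> f [/ltW g1 g2]; exact: f.
- move=> c ac cl; have [U [oU Ul CU H]] := fcg_crv al lb ac cl.
  exists U; split; [exact: oU|exact: Ul|exact: CU|].
  have [rl _ vE aE _] := H l Ul.
  rewrite -vE -aE; apply/geo_accelE => p; exact: h4.
Qed.

Lemma fcg_causal_int (l : R) : a < l -> (l%:E < b)%E -> causal_int MM k tau xi l.
Proof.
move=> al lb c ac cl; have [_ _ h5] := fcg.
have [U [oU Ul CU H]] := fcg_crv al lb ac cl; have [rl _ vE aE [_ tE]] := H l Ul.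
by rewrite tE -vE; exact: h5.
Qed.

End FromRay.

Lemma int_fcg (a b : R) (tau : R -> R) (xi : R -> M) (l0 : R) :
  (forall l, a < l < b -> geo_int MM t0 k tau xi l /\ causal_int MM k tau xi l) ->
  a < l0 < b -> future_causal_geodesic MM t0 k l0 b%:E tau xi.
Proof.
move=> H /andP[al0 l0b].
have rI l : ray l0 b%:E l -> a < l < b.
  by move=> [h1]; rewrite lte_fin => ->; rewrite (lt_le_trans al0).
have vE c l : atlas MM c -> a < l < b -> cdom c (xi l) ->
    velocity tau xi c l = 'D_1 (crv tau xi c) l.
  move=> ac lI cl; have [[_ _ /(_ c ac cl)[U [oU Ul CU _]]] _] := H l lI.
  by apply: rder_derive; have [] := Ck_derivable1 (CU 1) Ul.
have aE c l : atlas MM c -> a < l < b -> cdom c (xi l) ->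
    acceleration tau xi c l = 'D_1 ('D_1 (crv tau xi c)) l.
  move=> ac lI cl; have [[_ cx /(_ c ac cl)[U [oU Ul CU _]]] _] := H l lI.
  rewrite /acceleration (@rder_near R R _ _ ('D_1 (crv tau xi c))).
  - exact: erefl.
  - have N1 : \forall s \near l, cdom c (xi s).
      by apply: cx; apply: open_nbhs_nbhs; split; [exact: cdom_open|exact: cl].
    have N2 : \forall s \near l, s \in `]a, b[ by exact: near_in_itvoo.
    by apply: filterS2 N1 N2 => s cs; rewrite in_itv => sI; apply/esym; exact: vE.
  - by have [] := Ck_derivable1 (Ck_derive1 (CU 2)) Ul.
split; first by rewrite lte_fin.
- split.
  + by move=> l /rI/H[[/ltW]].
  + apply/subspace_continuousP => l /rI/H[[_ cx _] _].
    exact: cvg_within_filter cx.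
  + move=> c ac l [/rI/H[[_ _ /(_ c ac) E] _] cl].
    have [U [oU Ul CU _]] := E cl.
    by exists U, (crv tau xi c); split.
  + move=> c l p ac rl cl; have lI := rI l rl.
    rewrite vE// aE//; have [[_ _ /(_ c ac cl)[U [_ _ _ E]]] _] := H l lI.
    exact: (iffRL (geo_accelE _ _ _ _) E).
- move=> c l ac rl cl; have lI := rI l rl.
  have [[_ _ /(_ c ac cl)[U [oU Ul CU _]]] ci] := H l lI.
  have [h1 h2] := ci c ac cl; rewrite vE//; split; last exact: h2.
  rewrite /energy rder_derive//.
  by have [] := crv_is_derive_tau (CU 1) Ul.
Qed.

End InteriorEquivalence.

(** * Model geodesics and local isometries *)

(** Compactness of the box in its near-covering form turns local existence times into one time. The
    set [B] and the constant [L] are returned so that [ode_unique] can be applied to the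
    solutions. *)
Lemma ode_uniform (R : realType) n (f : 'rV[R]_n -> 'rV[R]_n) (D : set 'rV[R]_n) (lo hi : 'rV[R]_n) :
  open D -> Ck 1 D f -> (forall p : 'rV[R]_n, (forall i, lo 0 i <= p 0 i <= hi 0 i) -> D p) ->
  exists2 e : R, 0 < e & forall p : 'rV[R]_n, (forall i, lo 0 i <= p 0 i <= hi 0 i) ->
    exists (u : R -> 'rV[R]_n) (B : set 'rV[R]_n) (L : R), [/\ u 0 = p, B `<=` D, 0 <= L,
      (forall x y, B x -> B y -> `|f x - f y| <= L * `|x - y|) &
      forall s, - e < s < e -> B (u s) /\ is_derive s 1 u (f (u s))].
Proof.
move=> oD Cf boxD.
pose P (d : R) (p : 'rV[R]_n) := exists (u : R -> 'rV[R]_n) (B : set 'rV[R]_n) (L : R),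
  [/\ u 0 = p, B `<=` D, 0 <= L, (forall x y, B x -> B y -> `|f x - f y| <= L * `|x - y|) &
      forall s, - d < s < d -> B (u s) /\ is_derive s 1 u (f (u s))].
pose K := [set p : 'rV[R]_n | forall i, p ord0 i \in `[lo 0 i, hi 0 i]].
have KE (p : 'rV[R]_n) : K p <-> forall i, lo 0 i <= p 0 i <= hi 0 i.
  by split=> H i; have := H i; rewrite in_itv.
have cK : compact K.
  by apply: (@rV_compact _ _ (fun i => `[lo 0 i, hi 0 i]%classic)) => i; exact: segment_compact.
have /(_ R (0^'+) P) H := iffLR (compact_near_coveringP _) cK.
have N : \forall d \near (0 : R)^'+, K `<=` P d.
  apply: H => p Kp.
  have [r [L [e [r0 L0 e0 [rD fl] ex]]]] := ode_local oD Cf (boxD _ (iffLR (KE p) Kp)).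
  have N1 : \forall x \near p, `|x - p| <= r / 2.
    have r2 : 0 < r / 2 by rewrite divr_gt0.
    exact: (near_norm_le r2 (u := fun x : 'rV[R]_n => x) (x := p) (fun A HA => HA)).
  have N2 : \forall d \near 0^'+, 0 < d <= e.
    near=> d; apply/andP; split; first by near: d; exact: nbhs_right_gt.
    by near: d; exact: nbhs_right_le.
  near=> x d.
  have d0 : 0 < d <= e by near: d; exact: N2.
  have xr : `|x - p| <= r / 2 by near: x; exact: N1.
  have [u u0 uP] := ex d d0 x xr.
  exists u, [set y | `|y - p| <= r], L; split; [exact: u0|exact: rD|exact: L0|exact: fl|exact: uP].
have [e [e0 eP]] : exists e : R, 0 < e /\ K `<=` P e.
  near (0 : R)^'+ => e; exists e; split; first by near: e; exact: nbhs_right_gt.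
  by near: e; exact: N.
by exists e; [exact: e0|move=> p /KE Kp; exact: eP].
Unshelve. all: by end_near. Qed.

Lemma derive_comp_curve (R : realType) (V W : normedModType R) (z : R -> V) (phi : V -> W) (s : R) (v : V) :
  is_derive s 1 z v -> differentiable phi (z s) -> is_derive s 1 (phi \o z) ('D_v phi (z s)).
Proof.
move=> [dz <-] dp; have dz' := iffLR (derivable1_diffP _ _) dz.
have dc : differentiable (phi \o z) s by exact: differentiable_comp.
split; first exact/derivable1_diffP.
by rewrite deriveE// diff_comp//= -!deriveE.
Qed.

Lemma jacobian_comp_curve (R : realType) p q (z : R -> 'rV[R]_p) (phi : 'rV[R]_p -> 'rV[R]_q)
  (s : R) (v : 'rV[R]_p) :
  is_derive s 1 z v -> differentiable phi (z s) -> is_derive s 1 (phi \o z) (v *m jacobian phi (z s)).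
Proof. by move=> dz dp; rewrite -(deriveEjacobian _ dp); exact: derive_comp_curve. Qed.

Lemma acceleration_comp (R : realType) p (D : set 'rV[R]_p) (I : set R) (z : R -> 'rV[R]_p)
  (phi : 'rV[R]_p -> 'rV[R]_p) : open D -> open I -> (forall k, Ck k D phi) -> (forall k, Ck k I z) ->
  (forall s, I s -> D (z s)) -> forall s, I s ->
  'D_1 (phi \o z) s = 'D_1 z s *m jacobian phi (z s) /\
  'D_1 ('D_1 (phi \o z)) s = 'D_1 ('D_1 z) s *m jacobian phi (z s) +
    'D_1 z s *m 'D_('D_1 z s) (jacobian phi) (z s).
Proof.
move=> oD oI Cp Cz zD; have d1 s : I s -> 'D_1 (phi \o z) s = 'D_1 z s *m jacobian phi (z s).
  move=> Is; have [+ _] := Cp 1; move=> /(_ _ (zD s Is)) dp.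
  by have [_ ->] := jacobian_comp_curve (Ck_derivable1 (Cz 1) Is) dp.
move=> s Is; split; first exact: d1.
have CJ := Ck_jacobian oD Cp 1.
have dJ : differentiable (jacobian phi) (z s) by have [+ _] := CJ; apply; exact: zD.
have -> : 'D_1 ('D_1 (phi \o z)) s = 'D_1 (fun s => 'D_1 z s *m (jacobian phi \o z) s) s.
  by apply: near_eq_derive; apply: filterS (open_nbhs_nbhs (conj oI Is)) => s'; exact: d1.
have [_ ->] := is_derive_mulmx (Ck_derivable1 (Ck_derive1 (Cz 2)) Is)
  (derive_comp_curve (Ck_derivable1 (Cz 1) Is) dJ).
by [].
Qed.

Lemma is_derive_linear (R : realType) (V W : normedModType R) (f : {linear V -> W}) (x v : V) :
  continuous f -> is_derive x v f (f v).
Proof.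
move=> cf; have df : differentiable f x by exact: linear_differentiable.
by split; [exact: diff_derivable|rewrite deriveE// diff_lin].
Qed.

Lemma mulmx_ext (R : pzRingType) m n (A B : 'M[R]_(m, n)) :
  (forall v : 'rV[R]_m, v *m A = v *m B) -> A = B.
Proof. by move=> AB; apply/row_matrixP => i; rewrite !rowE AB. Qed.

Lemma mul_row_diag (R : pzRingType) n (v : 'rV[R]_(1 + n)) (J : 'M[R]_n) :
  v *m block_mx 1%:M 0 0 J = row_mx (lsubmx v) (rsubmx v *m J).
Proof. by rewrite -[v in LHS]hsubmxK mul_row_block !mulmx0 mulmx1 addr0 add0r. Qed.

Section LocalIsometry.
Context (R : realType) (n : nat) (X : topologicalType) (MX : manifold R n X).
Context (t0 : R) (h : R -> tensor2 R n X) (hh : metric_family MX t0 h).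
Context (c0 : chart R n X) (ac0 : atlas MX c0).
Context (M : topologicalType) (MM : manifold R n M) (k : R -> tensor2 R n M).
Context (hk : metric_family MM t0 k).

Let Om : set 'rV[R]_n := cmap c0 @` cdom c0.

(** The source is the coordinate domain of the fixed chart [c0], so that all points of [M] are
    compared with one and the same model metric, the components of h_t in [c0]. *)
Definition local_isometry (psi : 'rV[R]_n -> M) := [/\ forall y, Om y -> {for y, continuous psi},
  forall d, atlas MM d -> forall j, Ck j [set y | Om y /\ cdom d (psi y)] (cmap d \o psi) &
  forall d t y, atlas MM d -> t0 <= t -> Om y -> cdom d (psi y) ->
    h t c0 (cinv c0 y) = jacobian (cmap d \o psi) y *m k t d (psi y) *m (jacobian (cmap d \o psi) y)^T].

Context (psi : 'rV[R]_n -> M) (li : local_isometry psi).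

Let dom (d : chart R n M) := [set y | Om y /\ cdom d (psi y)].

Lemma open_local_dom d : open (dom d).
Proof.
rewrite openE => y [Oy dy]; have [cp _ _] := li; apply: filterI.
  by apply: open_nbhs_nbhs; split; [exact: cimg_open|exact: Oy].
by apply: cp Oy _ _; apply: open_nbhs_nbhs; split; [exact: cdom_open|exact: dy].
Qed.

Definition st_map (d : chart R n M) (z : 'rV[R]_(1 + n)) : 'rV[R]_(1 + n) :=
  row_mx (lsubmx z) (cmap d (psi (rsubmx z))).

Let J (d : chart R n M) y := jacobian (cmap d \o psi) y.

Lemma st_map_derive d z v : atlas MM d -> half_dom t0 (dom d) z ->
  is_derive z v (st_map d) (v *m block_mx 1%:M 0 0 (J d (rsubmx z))).
Proof.
move=> ad [_ Dz]; have [_ Cp _] := li; rewrite mul_row_diag.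
apply: is_derive_row_mx.
  by apply: (is_derive_linear (f := lsubmx)); exact: continuous_lsubmx.
have [+ _] := Cp d ad 1; move=> /(_ _ Dz) dp.
rewrite /J -(deriveEjacobian _ dp).
have dr : differentiable (fun z : 'rV[R]_(1 + n) => rsubmx z) z.
  by apply: linear_differentiable; exact: continuous_rsubmx.
have dc : differentiable ((cmap d \o psi) \o (fun z : 'rV[R]_(1 + n) => rsubmx z)) z.
  exact: differentiable_comp.
have -> : 'D_(rsubmx v) (cmap d \o psi) (rsubmx z) =
    'D_v ((cmap d \o psi) \o (fun z : 'rV[R]_(1 + n) => rsubmx z)) z.
  rewrite (deriveE _ dc) (deriveE _ dp) diff_comp//= diff_lin//; exact: continuous_rsubmx.
by apply: derivableP; exact: diff_derivable.
Qed.

Lemma Ck_st_map d j : atlas MM d -> Ck j (half_dom t0 (dom d)) (st_map d).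
Proof.
move=> ad; have [_ Cp _] := li.
have oD : open (half_dom t0 (dom d)) by apply: open_half_dom; exact: open_local_dom.
apply: Ck_mx => // a b; rewrite (ord1 a); case: (split_ordP b) => i ->.
  apply: (@Ck_ext _ _ _ _ _ (fun z : 'rV[R]_(1 + n) => lsubmx z 0 i)) => //.
    by move=> z _; rewrite /st_map row_mxEl.
  apply: Ck_entry => //; apply: Ck_linear; exact: continuous_lsubmx.
apply: (@Ck_ext _ _ _ _ _ (((fun y => (cmap d \o psi) y 0 i) \o (fun z : 'rV[R]_(1 + n) => rsubmx z)))) => //.
  by move=> z _; rewrite /st_map row_mxEr.
have Cr : Ck j (half_dom t0 (dom d)) (fun z : 'rV[R]_(1 + n) => rsubmx z).
  by apply: Ck_linear; exact: continuous_rsubmx.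
have Ci := Ck_entry 0 i (@open_local_dom d) (Cp d ad j).
apply: (Ck_comp_scalar oD (@open_local_dom d) _ Cr Ci).
by move=> z [].
Qed.

Lemma jacobian_st_map d z : atlas MM d -> half_dom t0 (dom d) z ->
  jacobian (st_map d) z = block_mx 1%:M 0 0 (J d (rsubmx z)).
Proof.
move=> ad Dz; apply: mulmx_ext => v; have [+ _] := Ck_st_map 1 ad.
by move=> /(_ _ Dz) df; rewrite -(deriveEjacobian _ df); have [_ ->] := st_map_derive v ad Dz.
Qed.

Lemma st_map_dom d z : half_dom t0 (dom d) z -> st_dom t0 d (st_map d z).
Proof.
by move=> [tz [_ dz]]; split; rewrite /st_map ?row_mxKl ?row_mxKr//; exists (psi (rsubmx z)).
Qed.

Lemma st_map_pullback d z : atlas MM d -> half_dom t0 (dom d) z ->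
  st_metric h c0 z = jacobian (st_map d) z *m st_metric k d (st_map d z) *m (jacobian (st_map d) z)^T.
Proof.
move=> ad Dz; rewrite jacobian_st_map//; have [/ltW tz [Oz dz]] := Dz; have [_ _ pull] := li.
rewrite /st_metric /st_map row_mxKl row_mxKr cmapK// (pull d _ _ ad tz Oz dz).
by rewrite tr_block_mx !mulmx_block !(trmx0, mulmx0, mul0mx, addr0, add0r) trmx1 mul1mx mulmx1.
Qed.

Section Push.
Context (I : set R) (z : R -> 'rV[R]_(1 + n)).
Hypotheses (oI : open I) (Cz : forall j, Ck j I z) (zD : forall s, I s -> st_dom t0 c0 (z s)).
Hypothesis zG : forall s, I s -> 'D_1 ('D_1 z) s = geo_accel (st_metric h c0) (z s) ('D_1 z s).

Definition push_time s : R := z s 0 (lshift n 0).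
Definition push_point s := psi (rsubmx (z s)).

Lemma crv_push d : crv push_time push_point d = st_map d \o z.
Proof.
apply/funext => s; rewrite /crv /st_coord /st_map /push_time /=; congr row_mx.
by rewrite [RHS]mx11_scalar mxE.
Qed.

Let Id d := I `&` [set s | dom d (rsubmx (z s))].

Lemma open_push_dom d : open (Id d).
Proof.
rewrite openE => s [Is ds]; apply: filterI.
  by apply: open_nbhs_nbhs.
have cz : {for s, continuous z} by exact: (Cz 0) Is.
have cr : {for s, continuous (fun s => rsubmx (z s))}.
  by apply: continuous_comp cz _; exact: continuous_rsubmx.
by apply: cr; apply: open_nbhs_nbhs; split; [exact: open_local_dom|exact: ds].
Qed.

(** By covariance, the Euler-Lagrange covector of the image curve times the transposed Jacobian
    vanishes. The Jacobian is invertible because the pulled back metric is nondegenerate, and can be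
    cancelled. *)
Lemma push_facts d s : atlas MM d -> I s -> cdom d (push_point s) ->
  [/\ Id d s, forall j, Ck j (Id d) (crv push_time push_point d),
   'D_1 (crv push_time push_point d) s = 'D_1 z s *m jacobian (st_map d) (z s),
   half_dom t0 (dom d) (z s) &
   'D_1 ('D_1 (crv push_time push_point d)) s = geo_accel (st_metric k d)
     (crv push_time push_point d s) ('D_1 (crv push_time push_point d) s)].
Proof.
move=> ad Is ds; have [t1 O1] := zD Is.
have Ids : Id d s by split.
have oD : open (half_dom t0 (dom d)) by apply: open_half_dom; exact: open_local_dom.
have ID s' : Id d s' -> half_dom t0 (dom d) (z s') by move=> [Is' d']; have [] := zD Is'.
have CI j : Ck j (Id d) z by apply: Ck_subset (Cz j) => s' [].
have CP j := Ck_st_map j ad.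
have [E1 E2] := acceleration_comp oD (@open_push_dom d) CP CI ID Ids.
rewrite crv_push; split; [exact: Ids|by move=> j; exact: (Ck_comp (@open_push_dom d) oD ID (CI j) (CP j))|exact: E1|exact: ID|].
have Dz := ID _ Ids.
have oD2 : open (st_dom t0 d) by exact: open_st_dom.
have el := el_covariant oD oD2 CP (fun j => Ck_st_metric hk j ad) (@st_map_dom d)
  (fun y => st_metric_sym hk ad) (fun y => st_map_pullback ad) ('D_1 z s) ('D_1 ('D_1 z) s) Dz.
apply: (iffLR (el_geodesic oD2 (fun j => Ck_st_metric hk j ad) (fun y => st_metric_unit hk ad)
  (fun y => st_metric_sym hk ad) _ _ (st_map_dom Dz))).
rewrite E2 E1.
have oD0 : open (st_dom t0 c0) by exact: open_st_dom.
have E0 := iffRL (el_geodesic oD0 (fun j => Ck_st_metric hh j ac0) (fun y => st_metric_unit hh ac0)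
  (fun y => st_metric_sym hh ac0) _ _ (zD Is)) (zG Is).
move: el; rewrite E0 => /esym/(congr1 (mulmx^~ (invmx (jacobian (st_map d) (z s))^T))).
rewrite mul0mx mulmxK //.
have := st_metric_unit hh ac0 (zD Is); rewrite (st_map_pullback ad Dz).
by rewrite !unitmx_mul => /andP[_ ->].
Qed.

Lemma push_geo_int s : I s -> geo_int MM t0 k push_time push_point s.
Proof.
move=> Is; have [t1 O1] := zD Is; split.
- by move: t1; rewrite mxE.
- have [cp _ _] := li; have cz : {for s, continuous z} by exact: (Cz 0) Is.
  have cr : {for s, continuous (fun s => rsubmx (z s))}.
    by apply: continuous_comp cz _; exact: continuous_rsubmx.
  by apply: continuous_comp cr _; exact: cp.
- move=> d ad ds; have [h1 h2 h3 _ h4] := push_facts ad Is ds.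
  by exists (Id d); split; [exact: open_push_dom|exact: h1|exact: h2|exact: h4].
Qed.

Lemma push_causal_int s : I s -> 0 < 'D_1 z s 0 (lshift n 0) ->
  ('D_1 z s *m st_metric h c0 (z s) *m ('D_1 z s)^T) 0 0 <= 0 -> causal_int MM k push_time push_point s.
Proof.
move=> Is z0 zq d ad ds; have [h1 h2 h3 h4 _] := push_facts ad Is ds.
have [_ ->] := crv_is_derive_tau (h2 1) h1.
rewrite h3; split.
  by rewrite (jacobian_st_map ad h4) mul_row_diag row_mxEl mxE.
rewrite crv_push /= trmx_mul; move: zq; rewrite (st_map_pullback ad h4) !mulmxA; exact: id.
Qed.

End Push.
End LocalIsometry.

Lemma is_derive_shift (R : realType) (W : normedModType R) (u : R -> W) (l s : R) (w : W) :
  is_derive (s - l) 1 u w -> is_derive s 1 (fun s => u (s - l)) w.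
Proof.
move=> du; have ds : is_derive s (1 : R) (fun s : R => s - l) (1 : R).
  by apply: (is_derive_eq (is_deriveB (is_derive_id s (1 : R)) (is_derive_cst l s (1 : R)))); rewrite subr0.
have [d1 d2] := du.
have := derive_comp_curve ds (iffLR (derivable1_diffP _ _) d1).
by rewrite d2.
Qed.

Lemma derive0_constant (R : realType) (f : R -> R) (a b s s' : R) :
  (forall x, a < x < b -> is_derive x 1 f 0) -> a < s < b -> a < s' < b -> f s = f s'.
Proof.
move=> df; have mono x y : a < x < b -> a < y < b -> x <= y -> f x = f y.
  move=> /andP[ax _] /andP[_ yb]; rewrite le_eqVlt => /predU1P[-> //|xy].
  have [c _] : exists2 c, x < c < y & f y - f x = 0 * (y - x).
    apply: (MVT_open (df := fun _ => 0) xy) => c /andP[xc cy].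
    by apply: df; rewrite (lt_le_trans ax)//= (le_lt_trans cy).
  by rewrite mul0r => /eqP; rewrite subr_eq0 => /eqP.
move=> Is Is'; have [ss'|/ltW ss'] := leP s s'; first exact: mono.
by apply/esym; exact: mono.
Qed.

Lemma quad_form_sym (R : realType) n (G : 'M[R]_n) (v w : 'rV[R]_n) : G^T = G ->
  (v *m G *m w^T) 0 0 = (w *m G *m v^T) 0 0.
Proof. by move=> Gs; rewrite mx11_tr !trmx_mul trmxK Gs mulmxA. Qed.

(** Cauchy-Schwarz for [G] and [u i] = e_i G^-1: the product of [w] and [u i] is w_i, and the
    squared norm of [u i] is a diagonal entry of G^-1, at most the trace since the other entries are
    nonnegative. *)
Lemma posdef_coord_sqr (R : realType) n (G : 'M[R]_n) (w : 'rV[R]_n) i : G^T = G -> posdef G ->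
  w 0 i ^+ 2 <= \tr (invmx G) * (w *m G *m w^T) 0 0.
Proof.
move=> Gs pd; have uG := posdef_unitmx pd.
pose u j : 'rV[R]_n := delta_mx 0 j *m invmx G.
have uGE j : u j *m G = delta_mx 0 j by rewrite /u mulmxKV.
have GT (x y : 'rV[R]_n) : x *m G *m y^T = x *m (y *m G)^T by rewrite trmx_mul Gs mulmxA.
have wu (x : 'rV[R]_n) j : (x *m G *m (u j)^T) 0 0 = x 0 j.
  by rewrite GT uGE trmx_delta -colE mxE.
have uw (x : 'rV[R]_n) j : (u j *m G *m x^T) 0 0 = x 0 j by rewrite uGE mx_rowE mxE.
have uu j : u j 0 j = invmx G j j by rewrite /u mx_rowE.
have psd (x : 'rV[R]_n) : 0 <= (x *m G *m x^T) 0 0.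
  by have [->|/pd/ltW//] := eqVneq x 0; rewrite !mul0mx mxE.
have a0 : 0 < u i 0 i.
  rewrite -wu; apply: pd; apply/eqP => ui; have := uGE i; rewrite ui mul0mx.
  by move/matrixP/(_ 0 i)/eqP; rewrite !mxE !eqxx eq_sym oner_eq0.
have atr : u i 0 i <= \tr (invmx G).
  rewrite /mxtrace (bigD1 i)//= uu lerDl; apply: sumr_ge0 => j _.
  by rewrite -uu -wu.
set q := (w *m G *m w^T) 0 0; set a := u i 0 i in a0 atr *.
have := psd (w - (w 0 i / a) *: u i).
have -> : ((w - (w 0 i / a) *: u i) *m G *m (w - (w 0 i / a) *: u i)^T) 0 0 =
    q - w 0 i / a * w 0 i - w 0 i / a * (w 0 i - w 0 i / a * a).
  rewrite !mulmxBl -!scalemxAl mx_subZE linearB linearZ /= mulmxBr mulmxBr -!scalemxAr.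
  by rewrite !mx_subZE wu uw wu.
rewrite divfK ?gt_eqF// subrr mulr0 subr0 subr_ge0 mulrAC ler_pdivrMr// -expr2 mulrC => h.
by apply: le_trans h _; rewrite ler_wpM2r// psd.
Qed.

Section ModelGeodesics.
Context (R : realType) (N : nat) (G : 'rV[R]_N -> 'M[R]_N) (D : set 'rV[R]_N).
Hypotheses (oD : open D) (CG : forall k, Ck k D G) (uG : forall z, D z -> G z \in unitmx).

Lemma geodesic_uniform (lo hi : 'rV[R]_(N + N)) :
  (forall p : 'rV[R]_(N + N), (forall i, lo 0 i <= p 0 i <= hi 0 i) -> D (lsubmx p)) ->
  exists2 e : R, 0 < e & forall (p : 'rV[R]_(N + N)) (l : R), (forall i, lo 0 i <= p 0 i <= hi 0 i) ->
    rsubmx p != 0 -> exists z : R -> 'rV[R]_N, [/\ z l = lsubmx p, 'D_1 z l = rsubmx p,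
      forall j, Ck j [set s | l - e < s < l + e] z &
      forall s, l - e < s < l + e ->
        [/\ D (z s), 'D_1 z s != 0 & 'D_1 ('D_1 z) s = geo_accel G (z s) ('D_1 z s)]].
Proof.
move=> box; pose f := geo_field G.
have Cf k : Ck k (geo_domain D) f by exact: Ck_geo_field.
have [e e0 H] := ode_uniform (open_geo_domain oD) (Cf 1) box.
exists e; [exact: e0|move=> p l pb pr].
have [u [B [L [u0 BD L0 fl uP]]]] := H p pb.
pose I := [set s | l - e < s < l + e].
have oI : open I.
  have -> : I = `]l - e, l + e[%classic by apply/funext => s; rewrite /I /= in_itv.
  exact: interval_open.
pose U s := u (s - l).
have shift s : I s -> - e < s - l < e by move=> /andP[h1 h2]; apply/andP; split; lra.
have dU s : I s -> is_derive s 1 U (f (U s)).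
  by move=> /shift/uP[_ d]; exact: is_derive_shift.
have CU j : Ck j I U.
  apply: (Ck_ode (open_geo_domain oD) oI Cf _ dU) => s /shift/uP[/BD]; exact.
pose z s := lsubmx (U s).
have Cz j : Ck j I z.
  apply: Ck_mx => // a b; apply: (@Ck_ext _ _ _ _ _ (fun s => U s a (lshift N b))) => //.
    by move=> s _; rewrite /z mxE.
  exact: Ck_entry.
have dz s : I s -> 'D_1 z s = rsubmx (U s).
  move=> Is; suff [_ ->] : is_derive s 1 z (rsubmx (U s)) by [].
  apply: is_derive_mx => a b; have := is_derive_entry a (lshift N b) (dU s Is).
  rewrite /f /geo_field row_mxEl (_ : (fun s => U s a (lshift N b)) = fun s => z s a b); first exact: id.
  by apply/funext => x; rewrite /z mxE.
have ddz s : I s -> 'D_1 ('D_1 z) s = geo_accel G (z s) ('D_1 z s).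
  move=> Is; rewrite (dz s Is).
  transitivity ('D_1 (fun s => rsubmx (U s)) s).
    by apply: near_eq_derive; apply: filterS (open_nbhs_nbhs (conj oI Is)) => s'; exact: dz.
  suff [_ ->] : is_derive s 1 (fun s => rsubmx (U s)) (geo_accel G (z s) (rsubmx (U s))) by [].
  apply: is_derive_mx => a b; have := is_derive_entry a (rshift N b) (dU s Is).
  rewrite /f /geo_field row_mxEr (_ : (fun s => U s a (rshift N b)) = fun s => rsubmx (U s) a b); first exact: id.
  by apply/funext => x; rewrite mxE.
have Il : I l by apply/andP; split; lra.
have Ul : U l = p by rewrite /U subrr.
exists z; split; [by rewrite /z Ul|by rewrite dz// Ul|exact: Cz|move=> s Is].
have [Bs _] := uP _ (shift s Is).
split; [exact: BD Bs| |exact: ddz].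
(* A solution with zero velocity somewhere is constant. *)
apply/eqP; rewrite dz// => v0.
have fs : f (U s) = 0.
  rewrite /f /geo_field v0 (_ : geo_accel G (lsubmx (U s)) 0 = 0) ?row_mx0//.
  apply/rowP => i; rewrite !mxE big1 ?oppr0// => a _; rewrite big1// => b _.
  by rewrite !mxE mulr0.
have E := @ode_unique R _ f B L (l - e) (l + e) s U (fun _ => U s) L0 fl _ Is erefl.
have {}E : forall s', I s' -> U s' = U s.
  apply: E => s' Is'; have [Bs' _] := uP _ (shift s' Is').
  by split; [exact: Bs'|exact: Bs|exact: dU|rewrite fs; exact: is_derive_cst].
by move: pr; rewrite -Ul (E l Il) v0 eqxx.
Qed.

Lemma geodesic_norm (z : R -> 'rV[R]_N) (a b : R) :
  (forall z, D z -> (G z)^T = G z) ->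
  (forall j, Ck j [set s | a < s < b] z) ->
  (forall s, a < s < b -> D (z s) /\ 'D_1 ('D_1 z) s = geo_accel G (z s) ('D_1 z s)) ->
  forall s s', a < s < b -> a < s' < b ->
   ('D_1 z s *m G (z s) *m ('D_1 z s)^T) 0 0 = ('D_1 z s' *m G (z s') *m ('D_1 z s')^T) 0 0.
Proof.
move=> sG Cz zD.
pose q s := ('D_1 z s *m G (z s) *m ('D_1 z s)^T) 0 0.
have dq s : a < s < b -> is_derive s 1 q 0.
  move=> Is; have [Dz zz] := zD s Is.
  have dv := Ck_derivable1 (Ck_derive1 (Cz 2)) Is.
  have dG : is_derive s 1 (G \o z) ('D_('D_1 z s) G (z s)).
    apply: derive_comp_curve (Ck_derivable1 (Cz 1) Is) _.
    by have [+ _] := CG 1; exact.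
  have dvT : is_derive s 1 (fun s => ('D_1 z s)^T) ('D_1 ('D_1 z) s)^T.
    apply: is_derive_mx => i j; have := is_derive_entry j i dv.
    rewrite mxE (_ : (fun s => 'D_1 z s j i) = fun s => ('D_1 z s)^T i j); first exact: id.
    by apply/funext => x; rewrite mxE.
  have := is_derive_entry 0 0 (is_derive_mulmx (is_derive_mulmx dv dG) dvT).
  move=> /is_derive_eq; apply; rewrite mulmxDl !mx_addE.
  have := el_conserved CG Dz (iffRL (el_geodesic oD CG uG sG _ _ Dz) zz).
  rewrite /comp (quad_form_sym _ _ (sG _ Dz)).
  have aux (A B : R) : 2 * A + B = 0 -> A + B + A = 0 by move=> h; lra.
  exact: aux.
move=> s s' Is Is'; exact: (derive0_constant dq Is Is').
Qed.

End ModelGeodesics.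

(** * Energy along geodesics *)

Lemma near_eq_is_derive (R : realType) (V W : normedModType R) (f g : V -> W) (x v : V) (d : W) :
  (\forall y \near x, f y = g y) -> is_derive x v f d -> is_derive x v g d.
Proof.
move=> fg [d1 <-]; split; first exact: near_eq_derivable fg d1.
by apply: near_eq_derive; apply: filterS fg => y ->.
Qed.

Section MetricTime.
Context (R : realType) (n : nat) (M : topologicalType) (MM : manifold R n M).
Context (t0 : R) (k : R -> tensor2 R n M) (hk : metric_family MM t0 k).

Lemma Ck_st_line (y : 'rV[R]_n) j (U : set R) : open U -> Ck j U (fun s : R => row_mx (s%:M : 'M[R]_1) y).
Proof.
move=> oU; apply: Ck_mx => // a b; rewrite (ord1 a); case: (split_ordP b) => i ->.
  apply: (Ck_ext oU (f := fun s => s)); last exact: Ck_id.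
  by move=> s _; rewrite row_mxEl (ord1 i) mxE mulr1n.
apply: (Ck_ext oU (f := fun s => y 0 i)); last exact: Ck_cst.
by move=> s _; rewrite row_mxEr.
Qed.

Lemma Ck_metric_time d x j : atlas MM d -> cdom d x -> Ck j [set s | t0 < s] (fun s => k s d x).
Proof.
move=> ad dx.
have oU : open [set s | t0 < s] by exact: open_gt.
apply: (Ck_ext oU (f := (fun z => chart_metric k d (lsubmx z 0 0) (rsubmx z)) \o
  (fun s : R => row_mx (s%:M : 'M[R]_1) (cmap d x)))).
  by move=> s _; rewrite /= /chart_metric row_mxKl row_mxKr mxE mulr1n cmapK.
apply: (Ck_comp oU (@open_st_dom _ _ _ t0 d)) (Ck_st_line _ j oU) (Ck_chart_metric hk j ad).
by move=> s s0; exact: st_coord_dom.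
Qed.

(** Of the Christoffel symbols with upper time index only the purely spatial ones survive, and they
    are the components of K. *)
Lemma geo_accel_time d x t (v : 'rV[R]_(1 + n)) : atlas MM d -> cdom d x -> t0 < t ->
  geo_accel (st_metric k d) (st_coord d t x) v 0 (lshift n 0) =
  - (rsubmx v *m second_form (fun s => k s d x) t *m (rsubmx v)^T) 0 0.
Proof.
move=> ad dx tt; rewrite /geo_accel mxE mxE quad_formE; congr (- _).
rewrite big_split_ord /= big_ord1 [X in X + _]big_split_ord /= big_ord1.
rewrite st_metricE christoffel_000 !mul0r add0r big1 ?add0r; last first.
  by move=> i _; rewrite christoffel_00r !mul0r.
apply: eq_bigr => i _; rewrite big_split_ord /= big_ord1 christoffel_0r0 !mul0r add0r.
apply: eq_bigr => j _; rewrite christoffel_0rr.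
have oU : open [set s | t0 < s] by exact: open_gt.
have E : (fun s => k s d x) = fun s => chart_metric k d s (cmap d x).
  by apply/funext => s; rewrite /chart_metric cmapK.
have CH l : Ck l [set s | t0 < s] (fun s => chart_metric k d s (cmap d x)).
  by rewrite -E; exact: Ck_metric_time.
by rewrite (time_pdE CH i j tt) -E [rsubmx v 0 i]mxE [rsubmx v 0 j]mxE.
Qed.

Lemma fcg_energy_derive (a : R) (b : \bar R) (tau : R -> R) (xi : R -> M) (l : R) d :
  future_causal_geodesic MM t0 k a b tau xi -> a < l -> (l%:E < b)%E -> atlas MM d -> cdom d (xi l) ->
  is_derive l 1 (energy tau)
    (- (rsubmx ('D_1 (crv tau xi d) l) *m second_form (fun s => k s d (xi l)) (tau l) *m
      (rsubmx ('D_1 (crv tau xi d) l))^T) 0 0).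
Proof.
move=> g al lb ad dl; have [U [oU Ul CU H]] := fcg_crv g al lb ad dl.
have [t1 _ /(_ d ad dl)[U' [_ _ _ E]]] := fcg_geo_int g al lb.
rewrite -(geo_accel_time _ ad dl t1) -[st_coord _ _ _]/(crv tau xi d l) -E.
apply: near_eq_is_derive (is_derive_entry 0 (lshift n 0) (Ck_derivable1 (Ck_derive1 (CU 2)) Ul)).
apply: filterS (open_nbhs_nbhs (conj oU Ul)) => l' Ul'.
by have [_ _ _ _ [_ <-]] := H l' Ul'; have [_ ->] := crv_is_derive_tau (CU 1) Ul'.
Qed.

Lemma fcg_quad_le (a : R) (b : \bar R) (tau : R -> R) (xi : R -> M) (l : R) d :
  future_causal_geodesic MM t0 k a b tau xi -> a < l -> (l%:E < b)%E -> atlas MM d -> cdom d (xi l) ->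
  (rsubmx ('D_1 (crv tau xi d) l) *m k (tau l) d (xi l) *m (rsubmx ('D_1 (crv tau xi d) l))^T) 0 0
   <= energy tau l ^+ 2.
Proof.
move=> g al lb ad dl; have [U [oU Ul CU H]] := fcg_crv g al lb ad dl.
have [_] := fcg_causal_int g al lb ad dl.
have q := block_metric_quad (chart_metric k d) (crv tau xi d l) ('D_1 (crv tau xi d) l).
rewrite [X in X <= 0 -> _]q {q} /chart_metric.
have -> : lsubmx (crv tau xi d l) 0 0 = tau l by rewrite row_mxKl mxE mulr1n.
have -> : cinv d (rsubmx (crv tau xi d l)) = xi l by rewrite row_mxKr cmapK.
have -> : energy tau l = 'D_1 (crv tau xi d) l 0 (lshift n 0).
  by have [_ _ _ _ [_ <-]] := H l Ul; have [_ ->] := crv_is_derive_tau (CU 1) Ul.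
by rewrite addrC subr_le0.
Qed.

End MetricTime.

Lemma derive_congr_mx (R : realType) n (U : set R) (G H : R -> 'M[R]_n) (B : 'M[R]_n) t : open U -> U t ->
  Ck 1 U G -> (forall s, U s -> H s = B *m G s *m B^T) ->
  second_form H t = B *m second_form G t *m B^T.
Proof.
move=> oU Ut CG HE; rewrite /second_form -scalemxAr -scalemxAl; congr (_ *: _).
have dB : is_derive t 1 (fun _ : R => B) 0 by exact: is_derive_cst.
have dBT : is_derive t 1 (fun _ : R => B^T) 0 by exact: is_derive_cst.
have [_ E] := is_derive_mulmx (is_derive_mulmx dB (Ck_derivable1 CG Ut)) dBT.
rewrite mul0mx add0r mulmx0 addr0 in E; rewrite -E.
by apply: near_eq_derive; apply: filterS (open_nbhs_nbhs (conj oU Ut)) => s; exact: HE.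
Qed.

Section EnergyEstimate.
Context (R : realType) (n : nat) (X : topologicalType) (MX : manifold R n X).
Context (t0 : R) (h : R -> tensor2 R n X) (hh : metric_family MX t0 h).
Context (c0 : chart R n X) (ac0 : atlas MX c0) (x0 : X) (cx0 : cdom c0 x0).
Context (M : topologicalType) (MM : manifold R n M) (k : R -> tensor2 R n M).
Context (hk : metric_family MM t0 k).

Let y0 := cmap c0 x0.
Let Gm t := h t c0 x0.

Hypothesis cover : forall x : M, exists2 psi, local_isometry t0 h c0 MM k psi & psi y0 = x.

Context (th dth : R -> R) (cn : R) (cn0 : 0 <= cn).
Hypotheses (th_right : th x @[x --> t0^'+] --> th t0)
  (dthP : forall t, t0 < t -> is_derive t 1 th (dth t))
  (dth_ge : forall t, t0 < t -> - th t ^+ 2 <= dth t)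
  (dth_le : forall t, t0 < t -> dth t <= 0) (th0 : 0 < th t0).
Hypothesis rate_bound : forall t (u : 'rV[R]_n), t0 < t ->
  - (u *m second_form Gm t *m u^T) 0 0 * th t <= cn * (- dth t) * (u *m Gm t *m u^T) 0 0.

Lemma local_isometry_metric psi d : local_isometry t0 h c0 MM k psi -> atlas MM d -> cdom d (psi y0) ->
  jacobian (cmap d \o psi) y0 \in unitmx /\ forall t, t0 <= t ->
  k t d (psi y0) = invmx (jacobian (cmap d \o psi) y0) *m Gm t *m (invmx (jacobian (cmap d \o psi) y0))^T.
Proof.
move=> [_ _ pull] ad dy; have Oy : (cmap c0 @` cdom c0) y0 by exists x0.
have E t : t0 <= t -> Gm t = jacobian (cmap d \o psi) y0 *m k t d (psi y0) *m (jacobian (cmap d \o psi) y0)^T.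
  by move=> tt; rewrite -(pull d t y0 ad tt Oy dy) /y0 cmapK.
have uJ : jacobian (cmap d \o psi) y0 \in unitmx.
  have : Gm t0 \in unitmx by apply: posdef_unitmx; exact: (chart_metric_posdef hh ac0 (lexx t0) cx0).
  by rewrite (E t0 (lexx t0)) !unitmx_mul => /andP[/andP[]].
split=> // t tt; rewrite E// !mulmxA mulVmx// mul1mx -mulmxA -trmx_mul mulVmx// trmx1 mulmx1.
by [].
Qed.

(** The inequality concerns one point, so it is pulled back to the base point [y0]. The matrix [B]
    of the pull-back does not depend on time and therefore transports K as it does the metric. *)
Lemma energy_rate (a : R) (b : \bar R) (tau : R -> R) (xi : R -> M) (l : R) :
  future_causal_geodesic MM t0 k a b tau xi -> a < l -> (l%:E < b)%E ->
  is_derive l 1 (energy tau) ('D_1 (energy tau : R -> R) l) /\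
  'D_1 (energy tau : R -> R) l * th (tau l) <= cn * (- dth (tau l)) * energy tau l ^+ 2.
Proof.
move=> g al lb; have [psi li px] := cover (xi l).
pose d := chart_at MM (xi l); have [ad dl] := chart_atP MM (xi l).
have t1 := fcg_tau_gt g al lb.
have [dE dEE] := fcg_energy_derive hk g al lb ad dl.
split; first exact: derivableP.
have dy : cdom d (psi y0) by rewrite px.
have [uJ kE] := local_isometry_metric li ad dy; rewrite px in kE.
set B := invmx _ in kE.
have oU : open [set s | t0 < s] by exact: open_gt.
have kE' : forall s, [set s | t0 < s] s -> k s d (xi l) = B *m Gm s *m B^T by move=> s /ltW; exact: kE.
have KE := derive_congr_mx oU t1 (Ck_metric_time hh 1 ac0 cx0) kE'.
rewrite [X in X * _]dEE KE.
have := fcg_quad_le g al lb ad dl; rewrite kE ?(ltW t1)//.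
set w := rsubmx _; move=> qE.
have assoc (P : 'M[R]_n) : w *m (B *m P *m B^T) *m w^T = (w *m B) *m P *m (w *m B)^T.
  by rewrite trmx_mul !mulmxA.
rewrite assoc in qE; rewrite assoc.
apply: le_trans (rate_bound (w *m B) t1) _.
by apply: ler_wpM2l qE; rewrite mulr_ge0// oppr_ge0 dth_le.
Qed.

Lemma geodesic_time_bounded (a b : R) (tau : R -> R) (xi : R -> M) (l0 : R) : cn <= 1 ->
  future_causal_geodesic MM t0 k a b%:E tau xi -> a < l0 < b ->
  exists T B, forall l, l0 <= l < b -> tau l <= T /\ energy tau l <= B.
Proof.
move=> cn1 g lI.
have J l : a < l < b -> a < l /\ (l%:E < b%:E)%E by rewrite lte_fin => /andP[].
apply: (@energy_time_bounded R th dth t0 th_right dthP dth_ge dth_le th0 cn [set l | a < l < b]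
  tau (energy tau) (fun l => 'D_1 (energy tau : R -> R) l)) => //.
- move=> x y z /andP[ax _] /andP[_ zb] /andP[xy yz].
  by rewrite /= (lt_le_trans ax xy) (le_lt_trans yz zb).
- by move=> l /J[h1 h2]; exact: (fcg_tau g h1 h2).
- by move=> l /J[h1 h2]; have [] := energy_rate g h1 h2.
- by move=> l /J[h1 h2]; apply: (fcg_energy_gt0 g); split; [exact: ltW|].
- by move=> l /J[h1 h2]; exact: (fcg_tau_gt g h1 h2).
- by move=> l /J[h1 h2]; have [] := energy_rate g h1 h2.
- move=> l /andP[h1 h2]; have /andP[h3 _] := lI.
  by rewrite /= h2 (lt_le_trans h3).
Qed.

Lemma tau_nondecreasing (a b : R) (tau : R -> R) (xi : R -> M) (l0 l : R) :
  future_causal_geodesic MM t0 k a b%:E tau xi -> a < l0 -> l0 <= l -> l < b -> tau l0 <= tau l.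
Proof.
move=> g al0 l0l lb; rewrite -lerN2.
apply: (le_of_derive_le0 (f := fun x => - tau x) (df := fun x => - energy tau x) l0l).
  move=> x /andP[h1 h2]; apply: is_deriveN; apply: (fcg_tau g); first exact: lt_le_trans h1.
  by rewrite lte_fin (le_lt_trans h2).
move=> x /andP[h1 h2]; rewrite oppr_le0 ltW//; apply: (fcg_energy_gt0 g).
split; first by rewrite (le_trans (ltW al0)).
by rewrite lte_fin (le_lt_trans h2).
Qed.

(** Through [posdef_coord_sqr] and h(v,v) <= E^2 this bounds the coordinates of spatial velocities
    at the base point. *)
Lemma inverse_metric_bounded (t1 T : R) : t0 < t1 -> t1 <= T ->
  exists V, forall t, t1 <= t <= T -> \tr (invmx (Gm t)) <= V.
Proof.
move=> t01 t1T; have oU : open [set s | t0 < s] by exact: open_gt.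
have C : Ck 0 [set s | t0 < s] (fun t => \tr (invmx (Gm t))).
  apply: Ck_trace => //; apply: Ck_invmx => //; last exact: (Ck_metric_time hh 0 ac0 cx0).
  by move=> s /ltW st; apply: posdef_unitmx; exact: (chart_metric_posdef hh ac0 st cx0).
have [|c _ H] := @EVT_max R (fun t => \tr (invmx (Gm t))) t1 T t1T.
  apply: continuous_in_subspaceT => x; rewrite inE/= in_itv/= => /andP[h1 _].
  by apply: C; exact: lt_le_trans h1.
by exists (\tr (invmx (Gm c))) => t tI; apply: H; rewrite in_itv.
Qed.

End EnergyEstimate.

(** * Extension of geodesics *)

Lemma nonvanishing_gt0 (R : realType) (E : R -> R) (a b l s : R) :
  (forall x, a < x < b -> {for x, continuous E}) -> (forall x, a < x < b -> E x != 0) ->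
  a < l < b -> 0 < E l -> a < s < b -> 0 < E s.
Proof.
move=> cE E0 lI El sI; rewrite ltNge; apply/negP => Es.
have itvI x y w : a < x < b -> a < y < b -> w \in `[x, y] -> a < w < b.
  move=> /andP[ax _] /andP[_ yb]; rewrite in_itv/= => /andP[h1 h2].
  by rewrite (lt_le_trans ax)//= (le_lt_trans h2).
have cw x y : a < x < b -> a < y < b -> {within `[x, y], continuous E}.
  move=> xI yI; apply: continuous_in_subspaceT => w; rewrite inE => wI.
  by apply: cE; exact: itvI wI.
have [ls|/ltW sl] := leP l s.
  have [w wI Ew] : exists2 c, c \in `[l, s] & E c = 0.
    by apply: IVT; [exact: ls|exact: cw|rewrite ge_min le_max Es (ltW El) orbT].
  by have := E0 w (itvI _ _ _ lI sI wI); rewrite Ew eqxx.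
have [w wI Ew] : exists2 c, c \in `[s, l] & E c = 0.
  by apply: IVT; [exact: sl|exact: cw|rewrite ge_min le_max Es (ltW El) orbT].
by have := E0 w (itvI _ _ _ sI lI wI); rewrite Ew eqxx.
Qed.

Section Extension.
Context (R : realType) (n : nat) (X : topologicalType) (MX : manifold R n X).
Context (t0 : R) (h : R -> tensor2 R n X) (hh : metric_family MX t0 h).
Context (c0 : chart R n X) (ac0 : atlas MX c0) (x0 : X) (cx0 : cdom c0 x0).
Context (M : topologicalType) (MM : manifold R n M) (k : R -> tensor2 R n M).
Context (hk : metric_family MM t0 k).

Let y0 := cmap c0 x0.
Let Gm t := h t c0 x0.

Hypothesis cover : forall x : M, exists2 psi, local_isometry t0 h c0 MM k psi & psi y0 = x.

Lemma model_quad (t : R) (v : 'rV[R]_(1 + n)) :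
  (v *m st_metric h c0 (row_mx t%:M y0) *m v^T) 0 0 =
  - (v 0 (lshift n 0)) ^+ 2 + (rsubmx v *m Gm t *m (rsubmx v)^T) 0 0.
Proof.
have -> := block_metric_quad (chart_metric h c0) (row_mx t%:M y0) v.
rewrite /chart_metric; have -> : lsubmx (row_mx t%:M y0) 0 0 = t by rewrite row_mxKl mxE mulr1n.
by rewrite row_mxKr /y0 cmapK.
Qed.

Lemma causal_nonzero (z v : 'rV[R]_(1 + n)) : st_dom t0 c0 z ->
  (v *m st_metric h c0 z *m v^T) 0 0 <= 0 -> v != 0 -> v 0 (lshift n 0) != 0.
Proof.
move=> [tz zO] q v0; apply/eqP => vt; move: q.
have -> := block_metric_quad (chart_metric h c0) z v.
rewrite vt expr0n oppr0 add0r leNgt => /negP; apply.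
have [cz _] := cinv_in zO.
apply: (chart_metric_posdef hh ac0 (ltW tz) cz).
apply: contraNneq v0 => v0; rewrite -[v]hsubmxK v0.
suff -> : lsubmx v = 0 by rewrite row_mx0.
by apply/rowP => i; rewrite (ord1 i) !mxE.
Qed.

(** The squared norm of the velocity is conserved, so causality persists. A nonzero causal vector
    has a nonzero time component, whose sign is kept by continuity. *)
Lemma model_future_causal (z : R -> 'rV[R]_(1 + n)) (a b l : R) : a < l < b ->
  (forall j, Ck j [set s | a < s < b] z) ->
  (forall s, a < s < b -> [/\ st_dom t0 c0 (z s), 'D_1 z s != 0 &
     'D_1 ('D_1 z) s = geo_accel (st_metric h c0) (z s) ('D_1 z s)]) ->
  0 < 'D_1 z l 0 (lshift n 0) ->
  ('D_1 z l *m st_metric h c0 (z l) *m ('D_1 z l)^T) 0 0 <= 0 ->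
  forall s, a < s < b -> 0 < 'D_1 z s 0 (lshift n 0) /\
    ('D_1 z s *m st_metric h c0 (z s) *m ('D_1 z s)^T) 0 0 <= 0.
Proof.
move=> lI Cz zG El ql.
have oD : open (st_dom t0 c0) by exact: open_st_dom.
have qs s : a < s < b -> ('D_1 z s *m st_metric h c0 (z s) *m ('D_1 z s)^T) 0 0 <= 0.
  move=> sI; rewrite (geodesic_norm oD (fun j => Ck_st_metric hh j ac0) (fun z => st_metric_unit hh ac0)
    (fun z => st_metric_sym hh ac0) Cz _ sI lI)// => s' /zG[h1 _ h2].
  by split.
move=> s sI; split; last exact: qs.
pose E s := 'D_1 z s 0 (lshift n 0).
have E0 x : a < x < b -> E x != 0.
  by move=> xI; have [h1 h2 _] := zG x xI; exact: causal_nonzero h1 (qs x xI) h2.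
have cE x : a < x < b -> {for x, continuous E}.
  move=> xI; have d := is_derive_entry 0 (lshift n 0) (Ck_derivable1 (Ck_derive1 (Cz 2)) xI).
  exact: is_derive_continuous d.
exact: (nonvanishing_gt0 cE E0 lI El).
Qed.

Lemma model_uniform (t1 T C : R) : t0 < t1 ->
  exists2 e : R, 0 < e & forall (t l : R) (v : 'rV[R]_(1 + n)), t1 <= t <= T -> (forall i, `|v 0 i| <= C) ->
    0 < v 0 (lshift n 0) -> (v *m st_metric h c0 (row_mx t%:M y0) *m v^T) 0 0 <= 0 ->
    exists z : R -> 'rV[R]_(1 + n), [/\ z l = row_mx t%:M y0, 'D_1 z l = v,
      forall j, Ck j [set s | l - e < s < l + e] z,
      forall s, l - e < s < l + e -> st_dom t0 c0 (z s) /\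
        'D_1 ('D_1 z) s = geo_accel (st_metric h c0) (z s) ('D_1 z s) &
      forall s, l - e < s < l + e -> 0 < 'D_1 z s 0 (lshift n 0) /\
        ('D_1 z s *m st_metric h c0 (z s) *m ('D_1 z s)^T) 0 0 <= 0].
Proof.
move=> t01.
have oD : open (st_dom t0 c0) by exact: open_st_dom.
(* The box is degenerate in the spatial directions: the position is pinned at [y0], and only the
   time and the velocity vary. *)
pose lo : 'rV[R]_((1 + n) + (1 + n)) := row_mx (row_mx t1%:M y0) (const_mx (- C)).
pose hi : 'rV[R]_((1 + n) + (1 + n)) := row_mx (row_mx T%:M y0) (const_mx C).
have box (p : 'rV[R]_((1 + n) + (1 + n))) : (forall i, lo 0 i <= p 0 i <= hi 0 i) -> st_dom t0 c0 (lsubmx p).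
  move=> H; split.
    have := H (lshift _ (lshift n 0)); rewrite !row_mxEl !mxE !mulr1n => /andP[h1 _].
    exact: lt_le_trans h1.
  exists x0; first exact: cx0.
  apply/rowP => i; have := H (lshift _ (rshift 1 i)).
  by rewrite !row_mxEl !row_mxEr => /le_anti; rewrite !mxE.
have [e e0 H] := geodesic_uniform oD (fun j => Ck_st_metric hh j ac0) (fun z => st_metric_unit hh ac0) box.
exists e; [exact: e0|move=> t l v tI vC vt vq].
have [||z [zl dzl Cz zG]] := H (row_mx (row_mx t%:M y0) v) l.
- move=> i; case: (split_ordP i) => j ->.
    rewrite !row_mxEl; case: (split_ordP j) => j' ->; last by rewrite !row_mxEr lexx.
    by rewrite !row_mxEl (ord1 j') !mxE !mulr1n.
  by rewrite !row_mxEr !mxE -ler_norml.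
- rewrite row_mxKr; apply: contraTneq vt => ->; by rewrite mxE ltxx.
rewrite row_mxKl in zl; rewrite row_mxKr in dzl.
have lI : l - e < l < l + e by apply/andP; split; lra.
exists z; split; [exact: zl|exact: dzl|exact: Cz|by move=> s /zG[]|].
by apply: (model_future_causal lI Cz zG); rewrite ?zl dzl.
Qed.

Hypothesis bounded : forall (a b : R) (tau : R -> R) (xi : R -> M) (l0 : R),
  future_causal_geodesic MM t0 k a b%:E tau xi -> a < l0 < b ->
  exists T B, forall l, l0 <= l < b -> tau l <= T /\ energy tau l <= B.

(* The initial data at [l1] is carried to the fixed base point [y0] of the
   model chart, where the existence time of [model_uniform] applies. *)
Lemma model_restart (a b : R) (tau : R -> R) (xi : R -> M) (l0 : R) :
  future_causal_geodesic MM t0 k a b%:E tau xi -> a < l0 < b ->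
  exists2 e : R, 0 < e & forall l1, l0 <= l1 < b -> exists (tau2 : R -> R) (xi2 : R -> M),
    (forall s, l1 - e < s < l1 + e -> geo_int MM t0 k tau2 xi2 s /\ causal_int MM k tau2 xi2 s) /\
    same_state MM tau xi tau2 xi2 l1.
Proof.
move=> g /[dup] l0I /andP[al0 l0b]; have [T [B TB]] := bounded g l0I.
have t01 : t0 < tau l0 by exact: (fcg_tau_gt g).
have [tT _] : tau l0 <= T /\ energy tau l0 <= B by apply: TB; rewrite lexx.
have [V VP] := inverse_metric_bounded hh ac0 cx0 t01 tT.
(* A bound for every coordinate of the transported velocity: the square of the time component is at
   most B^2, those of the spatial ones at most |V| B^2, and |x| <= 1 + x^2. *)
pose C := 1 + B ^+ 2 + `|V| * B ^+ 2.
have C1 : 1 + B ^+ 2 <= C by rewrite lerDl mulr_ge0 ?sqr_ge0.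
have [e e0 H] := model_uniform T C t01.
exists e; [exact: e0|move=> l1 /[dup] l1I /andP[l01 l1b]].
have al1 : a < l1 := lt_le_trans al0 l01.
have l1b' : (l1%:E < b%:E)%E by rewrite lte_fin.
have [psi li px] := cover (xi l1).
pose d := chart_at MM (xi l1); have [ad dl] := chart_atP MM (xi l1).
have dy : cdom d (psi y0) by rewrite px.
have [uJ kE] := local_isometry_metric hh ac0 cx0 li ad dy.
have [U [oU Ul CU UH]] := fcg_crv g al1 l1b' ad dl.
set v := 'D_1 (crv tau xi d) l1; set J := jacobian _ _ in uJ kE.
have tl1 := fcg_tau_gt g al1 l1b'.
pose w : 'rV[R]_(1 + n) := row_mx (lsubmx v) (rsubmx v *m invmx J).
have [E0 vq] : 0 < v 0 (lshift n 0) /\ (v *m st_metric k d (crv tau xi d l1) *m v^T) 0 0 <= 0.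
  have [h1 h2] := fcg_causal_int g al1 l1b' ad dl; split; last exact: h2.
  by have [_ <-] := crv_is_derive_tau (CU 1) Ul.
have EB : v 0 (lshift n 0) <= B.
  have [_ Eb] := TB l1 l1I; apply: le_trans Eb.
  by have [_ <-] := fcg_tau g al1 l1b'; have [_ <-] := crv_is_derive_tau (CU 1) Ul.
have sv : (rsubmx v *m k (tau l1) d (xi l1) *m (rsubmx v)^T) 0 0 <= v 0 (lshift n 0) ^+ 2.
  have := fcg_quad_le g al1 l1b' ad dl; rewrite -/d -/v.
  suff -> : energy tau l1 = v 0 (lshift n 0) by [].
  by have [_ <-] := fcg_tau g al1 l1b'; have [_ <-] := crv_is_derive_tau (CU 1) Ul.
have w0 : w 0 (lshift n 0) = v 0 (lshift n 0) by rewrite row_mxEl mxE.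
have sw : (rsubmx w *m Gm (tau l1) *m (rsubmx w)^T) 0 0 <= v 0 (lshift n 0) ^+ 2.
  rewrite row_mxKr trmx_mul !mulmxA; move: sv.
  by rewrite -px (kE _ (ltW tl1)) !mulmxA.
have wq : (w *m st_metric h c0 (row_mx (tau l1)%:M y0) *m w^T) 0 0 <= 0.
  by rewrite model_quad w0 addrC subr_le0.
have E2B : v 0 (lshift n 0) ^+ 2 <= B ^+ 2.
  by rewrite lerXn2r ?nnegrE ?(ltW E0)//; apply: le_trans EB; exact: ltW.
have abs_le (x : R) : x ^+ 2 <= B ^+ 2 + `|V| * B ^+ 2 -> `|x| <= C.
  move=> xx; rewrite /C -addrA; apply: (@le_trans _ _ (1 + `|x| ^+ 2)); last first.
    by rewrite lerD2l real_normK ?num_real.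
  have := sqr_ge0 (`|x| - 1); have := normr_ge0 x; nra.
have wC i : `|w 0 i| <= C.
  apply: abs_le; case: (split_ordP i) => j ->.
    by rewrite (ord1 j) w0; apply: le_trans E2B _; rewrite lerDl mulr_ge0 ?sqr_ge0.
  have -> : w 0 (rshift 1 j) = rsubmx w 0 j by rewrite row_mxEr row_mxKr.
  have pd := chart_metric_posdef hh ac0 (ltW tl1) cx0.
  have sy := chart_metric_sym hh ac0 (ltW tl1) cx0.
  apply: le_trans (posdef_coord_sqr (rsubmx w) j sy pd) _.
  apply: (@le_trans _ _ (`|V| * B ^+ 2)); last by rewrite lerDr sqr_ge0.
  have q0 : 0 <= (rsubmx w *m Gm (tau l1) *m (rsubmx w)^T) 0 0.
    have [->|/pd/ltW//] := eqVneq (rsubmx w) 0; by rewrite !mul0mx mxE.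
  apply: (@le_trans _ _ (`|V| * (rsubmx w *m Gm (tau l1) *m (rsubmx w)^T) 0 0)).
    apply: ler_wpM2r; first exact: q0.
    apply: le_trans (ler_norm V); apply: VP.
    by rewrite (tau_nondecreasing g al0 l01 l1b) (proj1 (TB l1 l1I)).
  by rewrite ler_wpM2l// (le_trans sw).
have [||||z [zl dzl Cz zG zc]] := H (tau l1) l1 w.
- by rewrite (tau_nondecreasing g al0 l01 l1b) (proj1 (TB l1 l1I)).
- exact: wC.
- by rewrite w0.
- exact: wq.
have oI : open [set s | l1 - e < s < l1 + e].
  have -> : [set s | l1 - e < s < l1 + e] = `]l1 - e, l1 + e[%classic by apply/funext => s; rewrite /= in_itv.
  exact: interval_open.
have zD s : l1 - e < s < l1 + e -> st_dom t0 c0 (z s) by move=> /zG[].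
have zG' s : l1 - e < s < l1 + e -> 'D_1 ('D_1 z) s = geo_accel (st_metric h c0) (z s) ('D_1 z s) by move=> /zG[].
exists (push_time z), (push_point psi z); split.
  move=> s sI; split; first exact: (push_geo_int hh ac0 hk li oI Cz zD zG' sI).
  by have [h1 h2] := zc s sI; exact: (push_causal_int hh ac0 hk li oI Cz zD zG' sI h1 h2).
have l1I' : l1 - e < l1 < l1 + e by apply/andP; split; lra.
have xE : push_point psi z l1 = xi l1 by rewrite /push_point zl row_mxKr px.
split; [by rewrite /push_time zl row_mxEl mxE mulr1n|exact/esym|].
exists d; split; [exact: ad|exact: dl|].
have dp : cdom d (push_point psi z l1) by rewrite xE.
have [_ _ -> Dz _] := push_facts hh ac0 hk li oI Cz zD zG' ad l1I' dp.
rewrite (jacobian_st_map li ad Dz) mul_row_diag zl row_mxKr dzl -/J row_mxKl row_mxKr mulmxKV//.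
by rewrite hsubmxK.
Qed.

Lemma geodesic_extend (a b : R) (tau : R -> R) (xi : R -> M) :
  future_causal_geodesic MM t0 k a b%:E tau xi ->
  exists b' tau' xi', [/\ b < b', future_causal_geodesic MM t0 k a b'%:E tau' xi' &
    forall l, ray a b%:E l -> tau' l = tau l /\ xi' l = xi l].
Proof.
move=> g; have ab : a < b by have [] := g; rewrite lte_fin.
pose l0 := (a + b) / 2; have [al0 l0b] := midf_lt ab.
have [e e0 H] := model_restart g (introT andP (conj al0 l0b)).
(* As [e] does not depend on the restarting parameter, a restart within e / 2 of [b] yields a
   geodesic defined beyond [b]. *)
pose l1 := Num.max l0 (b - e / 2).
have l01 : l0 <= l1 by rewrite le_max lexx.
have bl1 : b - e / 2 <= l1 by rewrite le_max lexx orbT.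
have l1b : l1 < b by rewrite gt_max l0b; lra.
clearbody l1; have [tau2 [xi2 [g2 S]]] := H l1 (introT andP (conj l01 l1b)).
have al1 : a < l1 := lt_le_trans al0 l01.
pose A := Num.max a (l1 - e).
have Al1 : A < l1 by rewrite gt_max al1; lra.
have agree l : l1 <= l < b -> tau l = tau2 l /\ xi l = xi2 l.
  apply: (@geodesic_unique R n M MM t0 k hk A b tau xi tau2 xi2 l1); last exact: S.
  - move=> s /andP[As sb]; apply: (fcg_geo_int g); last by rewrite lte_fin.
    by apply: le_lt_trans As; rewrite le_max lexx.
  - move=> s /andP[As sb]; have [] // := g2 s; apply/andP; split; last by lra.
    by apply: le_lt_trans As; rewrite le_max lexx orbT.
  - by rewrite Al1.
(* The second piece starts at [l2], strictly between [l1] and [b]: it contains a neighbourhood of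
   [b], and on the overlap before [b] both geodesics agree. *)
have [l2 [l12 l2b]] : exists l2, l1 < l2 /\ l2 < b.
  by have [m1 m2] := midf_lt l1b; exists ((l1 + b) / 2).
have g3 : future_causal_geodesic MM t0 k l2 (l1 + e)%:E tau2 xi2.
  by apply: (int_fcg (a := l1 - e)); [exact: g2|apply/andP; split; lra].
exists (l1 + e), (fun l => if l < b then tau l else tau2 l), (fun l => if l < b then xi l else xi2 l).
split; first by lra.
  apply: fcg_local; first by rewrite lte_fin; lra.
  move=> l [al]; rewrite lte_fin => lb'; have [lb|bl] := ltP l b.
    exists a, b%:E, tau, xi; split; [exact: g|by split; rewrite ?lte_fin|].
    have : \forall l' \near l, l' < b by apply: open_nbhs_nbhs; split; [exact: open_lt|exact: lb].
    by apply: filterS => l' l'b [al' _]; rewrite l'b; split=> //; split=> //; rewrite lte_fin.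
  exists l2, (l1 + e)%:E, tau2, xi2; split; [exact: g3|split; [lra|by rewrite lte_fin]|].
  have : \forall l' \near l, l2 < l'.
    by apply: open_nbhs_nbhs; split; [exact: open_gt|rewrite /=; lra].
  apply: filterS => l' l2l' [al' l'b]; split; first by split; [exact: ltW|].
    by case: ifP => // l'b1; have [] := agree l'; rewrite // l'b1 (le_trans (ltW l12))// ltW.
  by case: ifP => // l'b1; have [] := agree l'; rewrite // l'b1 (le_trans (ltW l12))// ltW.
by move=> l [_]; rewrite lte_fin => ->.
Qed.

Lemma causally_complete : future_causally_complete MM t0 k.
Proof.
move=> a b tau xi g; have [ab _ _] := g.
pose ext (b' : \bar R) p := [/\ (b <= b')%E, future_causal_geodesic MM t0 k a b' p.1 p.2 &
  forall l, ray a b l -> p.1 l = tau l /\ p.2 l = xi l].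
have ext0 : ext b (tau, xi) by split.
(* Two extensions agree on their common interval, hence all of them glue to one
   defined up to the supremum of the endpoints. *)
have uniq b1 p1 b2 p2 l : ext b1 p1 -> ext b2 p2 -> ray a b1 l -> ray a b2 l -> p1.1 l = p2.1 l /\ p1.2 l = p2.2 l.
  move=> [bb1 g1 e1] [bb2 g2 e2] [al l1] [_ l2].
  have [lb|bl] := ltP l%:E b.
    by have [-> ->] := e1 l (conj al lb); have [-> ->] := e2 l (conj al lb).
  (* Around [r], interior to the original ray, both extensions coincide with the given geodesic; [r]
     provides the common state from which uniqueness propagates. *)
  have [r [ar rb]] : exists r : R, a < r /\ (r%:E < b)%E.
    case: b ab bl {g ext ext0 bb1 bb2 e1 e2} => [r0| |] //= ab bl.
    exists ((a + r0) / 2); rewrite lte_fin in ab; rewrite lte_fin; have [] := midf_lt ab; split=> //.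
  have rl : r < l by rewrite -lte_fin (lt_le_trans rb).
  have N := filterI (near_right (ray_near (lt_trans ar rl) l1)) (near_right (ray_near (lt_trans ar rl) l2)).
  have [L [lL L1 L2]] : exists L : R, [/\ l < L, (L%:E < b1)%E & (L%:E < b2)%E].
    near (0 : R)^'+ => s; exists (l + s).
    have s0 : 0 < s by near: s; exact: nbhs_right_gt.
    have [[_ N1] [_ N2]] : (a < l + s /\ ((l + s)%:E < b1)%E) /\ (a < l + s /\ ((l + s)%:E < b2)%E).
      by near: s; exact: N.
    by split; [rewrite ltrDl|exact: N1|exact: N2].
  apply: (@geodesic_unique R n M MM t0 k hk a L p1.1 p1.2 p2.1 p2.2 r).
  - move=> s /andP[sa sL]; apply: (fcg_geo_int g1 sa).
    by apply: lt_trans L1; rewrite lte_fin.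
  - move=> s /andP[sa sL]; apply: (fcg_geo_int g2 sa).
    by apply: lt_trans L2; rewrite lte_fin.
  - by rewrite ar (lt_trans rl).
  - apply: same_state_near; apply: filterS (ray_near ar rb) => s [/ltW sa sb].
    by have [-> ->] := e1 s (conj sa sb); have [-> ->] := e2 s (conj sa sb).
  - by rewrite (ltW rl).
pose S := [set b' | exists p, ext b' p].
pose bs := ereal_sup S.
have bbs : (b <= bs)%E by apply: ereal_sup_ubound; exists (tau, xi).
have pick l : exists p, ray a bs l -> exists2 b', ext b' p & ray a b' l.
  have [rl|] := pselect (ray a bs l); last by exists (tau, xi).
  have [al lbs] := rl; have [b' [p eb'] lb'] := ereal_sup_gt lbs.
  by exists p => _; exists b'.
have [P HP] := choice pick.
pose tau' l := (P l).1 l; pose xi' l := (P l).2 l.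
have agree l : ray a b l -> tau' l = tau l /\ xi' l = xi l.
  move=> [al lb]; have [b' e' r'] := HP l (conj al (lt_le_trans lb bbs)).
  exact: (uniq b' (P l) b (tau, xi) l e' ext0 r' (conj al lb)).
have g' : future_causal_geodesic MM t0 k a bs tau' xi'.
  apply: fcg_local; first exact: lt_le_trans bbs.
  move=> l rl; have [b' e' r'] := HP l rl.
  exists a, b', (P l).1, (P l).2; split; [by case: e'|exact: r'|].
  have N : \forall l' \near l, (l'%:E < b')%E.
    have [_ lb'] := r'; have l1 : l - 1 < l by rewrite ltrBlDr ltrDl.
    by apply: filterS (ray_near l1 lb') => s [].
  apply: filterS N => s sb' [as' sbs]; have rs : ray a b' s by split.
  have [b2 e2 r2] := HP s (conj as' sbs).
  have [E1 E2] := uniq b2 (P s) b' (P l) s e2 e' r2 rs.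
  by split; [exact: rs|exact: E1|exact: E2].
(* At a real supremum the glued geodesic could still be extended by [geodesic_extend], against the
   choice of [bs]. *)
suff E : bs = +oo%E by exists tau', xi'; rewrite E in g'.
case E : bs => [r| |]; [|exact: erefl|].
  rewrite E in g'; have [b' [tau2 [xi2 [rb' g2 a2]]]] := geodesic_extend g'.
  have : (b'%:E <= bs)%E.
    apply: ereal_sup_ubound; exists (tau2, xi2); split.
    - by apply: (le_trans bbs); rewrite E lee_fin ltW.
    - exact: g2.
    - move=> l rl; have [<- <-] := agree l rl; apply: a2.
      by have [al lb] := rl; split; [exact: al|rewrite -E; exact: lt_le_trans bbs].
  by rewrite E lee_fin leNgt rb'.
by move: (lt_le_trans ab bbs); rewrite E.
Unshelve. all: by end_near. Qed.

End Extension.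

(** * Homogeneous spacetimes *)

Lemma jacobian_comp (R : realType) p q r (B : 'rV[R]_p -> 'rV[R]_q) (A : 'rV[R]_q -> 'rV[R]_r) y :
  differentiable B y -> differentiable A (B y) ->
  jacobian (A \o B) y = jacobian B y *m jacobian A (B y).
Proof.
move=> dB dA; have dc : differentiable (A \o B) y by exact: differentiable_comp.
apply: mulmx_ext => v; rewrite -(deriveEjacobian _ dc) deriveE// diff_comp//=.
by rewrite mulmxA -(deriveEjacobian _ dB) -(deriveEjacobian _ dA) !deriveE.
Qed.

Section IsometricMaps.
Context (R : realType) (n : nat) (X : topologicalType) (MX : manifold R n X).
Context (t0 : R) (h : R -> tensor2 R n X) (c0 : chart R n X) (ac0 : atlas MX c0).
Context (M : topologicalType) (MM : manifold R n M) (k : R -> tensor2 R n M).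
Context (F : X -> X) (f : X -> M).
Hypotheses (sF : smooth_map MX MX F) (sf : smooth_map MX MM f).
Hypotheses (pF : forall t, t0 <= t -> is_pullback MX MX F (h t) (h t))
  (pf : forall t, t0 <= t -> is_pullback MX MM f (k t) (h t)).

Lemma open_chart_preimage (c : chart R n X) (Z : topologicalType) (g : X -> Z) (U : set Z) :
  continuous g -> open U -> open [set y | (cmap c @` cdom c) y /\ U (g (cinv c y))].
Proof.
move=> cg oU; rewrite openE => y [Oy Uy]; apply: filterI.
  by apply: open_nbhs_nbhs; split; [exact: cimg_open|exact: Oy].
have cgc : {for y, continuous (g \o cinv c)}.
  by apply: continuous_comp (cinv_cont Oy) _; exact: cg.
by apply: cgc; apply: open_nbhs_nbhs; split.
Qed.

(** A chart [c1] at the intermediate point [F (cinv c0 y)] factors the coordinate expression near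
    [y] into those of [F] and [f], to which the smoothness hypotheses and the chain rule apply. *)
Lemma isometric_map_chart d y : atlas MM d -> (cmap c0 @` cdom c0) y -> cdom d (f (F (cinv c0 y))) ->
  exists c1 V, [/\ atlas MX c1, cdom c1 (F (cinv c0 y)), open V, V y &
   [/\ forall j, Ck j V (cmap d \o (f \o F \o cinv c0)) &
    jacobian (cmap d \o (f \o F \o cinv c0)) y =
      jac c0 c1 F (cinv c0 y) *m jac c1 d f (F (cinv c0 y))]].
Proof.
move=> ad Oy dy; have [cF smF] := sF; have [cf smf] := sf.
pose c1 := chart_at MX (F (cinv c0 y)); have [a1 c1y] := chart_atP MX (F (cinv c0 y)).
pose V := [set y | (cmap c0 @` cdom c0) y /\ (cdom c1 `&` f @^-1` cdom d) (F (cinv c0 y))].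
have oU : open (cdom c1 `&` f @^-1` cdom d).
  by apply: openI; [exact: cdom_open|apply: open_comp; [move=> x _; exact: cf|exact: cdom_open]].
have oV : open V by exact: open_chart_preimage.
pose W := [set w | (cmap c1 @` cdom c1) w /\ cdom d (f (cinv c1 w))].
have oW : open W by apply: open_chart_preimage => //; exact: cdom_open.
pose B := cmap c1 \o F \o cinv c0; pose A := cmap d \o f \o cinv c1.
have CB j : Ck j V B.
  apply: smooth_on_Ck => //; apply: smooth_on_subset (smF c0 c1 ac0 a1) => _ [[x cx <-] [Ux _]].
  by exists x => //; split=> //; rewrite cmapK in Ux.
have CA j : Ck j W A.
  apply: smooth_on_Ck => //; apply: smooth_on_subset (smf c1 d a1 ad) => _ [[x cx <-] Ux].
  by exists x => //; split=> //; rewrite cmapK in Ux.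
have VW x : V x -> W (B x).
  by move=> [Ox [h1 h2]]; split; [exists (F (cinv c0 x))|rewrite /B /= cmapK].
have E x : V x -> (A \o B) x = (cmap d \o (f \o F \o cinv c0)) x.
  by move=> [Ox [h1 h2]]; rewrite /A /B /= cmapK.
have Vy : V y by split=> //; split.
have CAB j : Ck j V (cmap d \o (f \o F \o cinv c0)).
  by apply: (Ck_ext oV (f := A \o B)); [exact: E|exact: (Ck_comp oV oW VW (CB j) (CA j))].
exists c1, V; split; [exact: a1|exact: c1y|exact: oV|exact: Vy|split; first exact: CAB].
have dAB : differentiable (cmap d \o (f \o F \o cinv c0)) y by have [+ _] := CAB 1; exact.
have dB : differentiable B y by have [+ _] := CB 1; exact.
have dA : differentiable A (B y) by have [+ _] := CA 1; apply; exact: VW.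
have [_ yE] := cinv_in Oy.
apply: mulmx_ext => v; rewrite -(deriveEjacobian _ dAB).
transitivity ('D_v (A \o B) y).
  by apply: near_eq_derive; apply: filterS (open_nbhs_nbhs (conj oV Vy)) => x Vx; exact/esym/E.
have dc : differentiable (A \o B) y by exact: differentiable_comp.
by rewrite (deriveEjacobian _ dc) (jacobian_comp dB dA) /jac yE mulmxA.
Qed.

Lemma local_isometry_map : local_isometry t0 h c0 MM k (f \o F \o cinv c0).
Proof.
have [cF _] := sF; have [cf _] := sf; split.
- move=> y Oy; apply: continuous_comp (cinv_cont Oy) _.
  by apply: continuous_comp; [exact: cF|exact: cf].
- move=> d ad j; apply: Ck_local => y [Oy dy].
  by have [c1 [V [_ _ oV Vy [CV _]]]] := isometric_map_chart ad Oy dy; exists V.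
- move=> d t y ad tt Oy dy.
  have [c1 [V [a1 c1y oV Vy [_ ->]]]] := isometric_map_chart ad Oy dy.
  have [cy yE] := cinv_in Oy.
  rewrite (pF tt ac0 a1 cy c1y) (pf tt a1 ad c1y dy) trmx_mul !mulmxA.
  by [].
Qed.

End IsometricMaps.

Lemma homogeneous_transitive (R : realType) (m n : nat) (L : topGroupType) (ML : manifold R m L)
  (H : set L) (X : topologicalType) (MX : manifold R n X) (proj : L -> X) (act : L -> X -> X) (x y : X) :
  homogeneous_space ML H MX proj act -> exists a, act a x = y.
Proof.
move=> [_ _ _ [_ surj _] actE]; have [a <-] := surj x; have [b <-] := surj y.
by exists (b * a^-1)%g; rewrite actE -mulgA mulVg mulg1.
Qed.

Lemma smooth_map_id (R : realType) n (X : topologicalType) (MX : manifold R n X) : smooth_map MX MX id.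
Proof.
split; first by move=> x; exact: cvg_id.
by move=> c d ac ad; exact: (atlas_smooth ac ad).
Qed.

Lemma trace_congr (R : fieldType) n (J P Q : 'M[R]_n) : J \in unitmx -> P \in unitmx ->
  \tr (invmx (J *m P *m J^T) *m (J *m Q *m J^T)) = \tr (invmx P *m Q).
Proof.
move=> uJ uP; have uJT : J^T \in unitmx by rewrite unitmx_tr.
have -> : invmx (J *m P *m J^T) = invmx J^T *m invmx P *m invmx J.
  have u : J *m P *m J^T \in unitmx by rewrite !unitmx_mul uJ uP uJT.
  rewrite -[LHS]mulmx1 -[RHS](mulKmx u); congr (_ *m _); apply/esym.
  by rewrite !mulmxA !mulmxK// mulmxV.
rewrite -!mulmxA mulKmx// mxtrace_mulC -!mulmxA mulmxV// mulmx1.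
by rewrite mxtrace_mulC.
Qed.

Section Expansion.
Context (R : realType) (n : nat) (X : topologicalType) (MX : manifold R n X).
Context (t0 : R) (h : R -> tensor2 R n X) (hh : metric_family MX t0 h).

Definition chart_expansion (c : chart R n X) (x : X) (t : R) :=
  2^-1 * \tr (invmx (h t c x) *m rder (fun s : R^o => h s c x) t 1).

(** At t = t0 the metric is given on one side only. Its smooth extension in spacetime is restricted
    to the time line through [x], and [U] is shrunk until the determinant stays nonzero. *)
Lemma metric_time_extend c x t : atlas MX c -> cdom c x -> t0 <= t ->
  exists (U : set R) (F : R -> 'M[R]_n), [/\ open U, U t, forall j, Ck j U F,
    forall s, U s -> F s \in unitmx & forall s, U s -> t0 <= s -> F s = h s c x].
Proof.
move=> ac cx tt; have [_ _ _ sm] := hh.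
have [|U0 [F0 [oU0 U0t CF0 FE0]]] := sm c ac (row_mx (t%:M : 'M[R]_1) (cmap c x)).
  by split; [rewrite row_mxKl mxE mulr1n|rewrite row_mxKr; exists x].
pose ln (s : R) : 'rV[R]_(1 + n) := row_mx (s%:M : 'M[R]_1) (cmap c x).
have cl (s : R) : {for s, continuous ln}.
  have C0 : Ck 0 [set: R] ln by apply: Ck_st_line; exact: openT.
  exact: C0.
pose U1 : set R := [set s | U0 (ln s)].
have oU1 : open U1 by apply: open_comp oU0 => s _; exact: cl.
have Cln j : Ck j U1 ln by exact: Ck_st_line.
pose F := F0 \o ln.
have CF j : Ck j U1 F by apply: (Ck_comp oU1 oU0 _ (Cln j) (CF0 j)) => s.
have FE s : U1 s -> t0 <= s -> F s = h s c x.
  move=> Us ts; rewrite /F /= FE0//.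
    by rewrite /ln row_mxKl row_mxKr mxE mulr1n cmapK.
  by split; [rewrite /ln row_mxKl mxE mulr1n|rewrite /ln row_mxKr; exists x].
have Cd : Ck 0 U1 (fun s => \det (F s)) by exact: Ck_det.
pose U : set R := U1 `&` [set s | \det (F s) != 0].
have oU : open U.
  rewrite openE => s [Us ds]; apply: filterI; first exact: open_nbhs_nbhs.
  have cd : {for s, continuous (fun s => \det (F s))} by exact: Cd.
  apply: (cd [set r | r != 0]); apply: open_nbhs_nbhs; split; last exact: ds.
  exact: open_neq.
exists U, F; split; [exact: oU| |by move=> j; apply: Ck_subset (CF j) => s []| |by move=> s [Us _]; exact: FE].
  split; first exact: U0t.
  have := posdef_unitmx (chart_metric_posdef hh ac tt cx).
  by rewrite unitmxE unitfE /= FE.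
by move=> s [_ ds]; rewrite unitmxE unitfE.
Qed.

Lemma rder_metric (U : set R) (F : R -> 'M[R]_n) c x s : open U -> Ck 1 U F -> U s -> t0 <= s ->
  (forall s, U s -> t0 <= s -> F s = h s c x) ->
  rder (fun s : R^o => h s c x) s 1 = 'D_1 F s.
Proof.
move=> oU CF Us ts FE; rewrite (@rder_right_ext R _ _ F).
- by apply: rder_derive; have [] := Ck_derivable1 CF Us.
- have N : \forall r \near 0^'+, 0 < r :> R by exact: nbhs_right_gt.
  apply: filterS2 (open_right oU Us) N => r Ur r0; rewrite FE//.
  by rewrite (le_trans ts)// lerDl ltW.
- by rewrite FE.
Qed.

Lemma chart_expansionE (U : set R) (F : R -> 'M[R]_n) c x s : open U -> Ck 1 U F -> U s -> t0 <= s ->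
  (forall s, U s -> t0 <= s -> F s = h s c x) -> chart_expansion c x s = mean_curvature F s.
Proof.
move=> oU CF Us ts FE; rewrite /chart_expansion (rder_metric oU CF Us ts FE) -FE//.
by rewrite /mean_curvature /second_form -scalemxAr mxtraceZ.
Qed.

Lemma chart_expansion_right c x : atlas MX c -> cdom c x ->
  exists (U : set R) (th : R -> R), [/\ open U, U t0, {for t0, continuous th} &
    forall s, U s -> t0 <= s -> chart_expansion c x s = th s].
Proof.
move=> ac cx; have [U [F [oU Ut CF uF FE]]] := metric_time_extend ac cx (lexx t0).
exists U, (mean_curvature F); split; [exact: oU|exact: Ut| |].
  exact: is_derive_continuous (is_derive_mean_curvature oU CF uF Ut).
by move=> s Us ts; exact: chart_expansionE oU (CF 1) Us ts FE.
Qed.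

Lemma chart_expansion_interior c x s : atlas MX c -> cdom c x -> t0 < s ->
  chart_expansion c x s = mean_curvature (fun s => h s c x) s.
Proof.
move=> ac cx ts; have oU : open [set s | t0 < s] by exact: open_gt.
rewrite /chart_expansion /mean_curvature /second_form -scalemxAr mxtraceZ.
rewrite (@rder_derive R R _ (fun s => h s c x))//.
by have [] := Ck_derivable1 (Ck_metric_time hh 1 ac cx) ts.
Qed.

(** The Jacobian of [F] is independent of time, so the metric and its time derivative are congruent
    by the same matrix, and the trace is unchanged. *)
Lemma expansion_isometry (F : X -> X) x t : smooth_map MX MX F ->
  (forall s, t0 <= s -> is_pullback MX MX F (h s) (h s)) -> t0 <= t ->
  expansion MX h t (F x) = expansion MX h t x.
Proof.
move=> sF pF tt; have [ac cx] := chart_atP MX x; have [ad dx] := chart_atP MX (F x).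
set c := chart_at MX x in ac cx; set d := chart_at MX (F x) in ad dx.
have [U [G [oU Ut CG uG GE]]] := metric_time_extend ad dx tt.
set J := jac c d F x.
have E s : t0 <= s -> h s c x = J *m h s d (F x) *m J^T by move=> ts; exact: pF.
have uJ : J \in unitmx.
  have := posdef_unitmx (chart_metric_posdef hh ac tt cx).
  by rewrite E// !unitmx_mul => /andP[/andP[]].
pose H s := J *m G s *m J^T.
have HE s : U s -> t0 <= s -> H s = h s c x by move=> Us ts; rewrite /H GE// E.
have dJ : is_derive t 1 (fun _ : R => J) 0 by exact: is_derive_cst.
have dJT : is_derive t 1 (fun _ : R => J^T) 0 by exact: is_derive_cst.
have CJ : Ck 1 U H by apply: Ck_mulmx => //; [apply: Ck_mulmx => //; exact: Ck_cst|exact: Ck_cst].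
have [_ D] := is_derive_mulmx (is_derive_mulmx dJ (Ck_derivable1 (CG 1) Ut)) dJT.
rewrite mul0mx add0r mulmx0 addr0 in D.
rewrite /expansion -/c -/d (rder_metric oU CJ Ut tt HE) (rder_metric oU (CG 1) Ut tt GE) D.
rewrite -(HE _ Ut tt) -(GE _ Ut tt) /H trace_congr//; exact: uG.
Qed.

End Expansion.

Section HomogeneousSpacetime.
Context (R : realType) (n : nat) (hn : (1 < n)%N) (X : topologicalType) (MX : manifold R n X).
Context (t0 : R) (h : R -> tensor2 R n X) (hh : metric_family MX t0 h).
Context (T : R -> chart R n X -> X -> 'M[R]_(1 + n)) (hEin : einstein_equation MX t0 h T).
Hypotheses (htheta : forall x, 0 < expansion MX h t0 x)
  (hscal : forall t x, t0 <= t -> space_scalar_curvature MX (h t) x <= 0)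
  (hq : forall t x, t0 <= t -> 0 <= qfrak MX h T t x <= 2 * energy_density MX T t x).
Context (x0 : X).

Let c0 := chart_at MX x0.
Let ac0 : atlas MX c0. Proof. by have [] := chart_atP MX x0. Qed.
Let cx0 : cdom c0 x0. Proof. by have [] := chart_atP MX x0. Qed.
Let Gm t := h t c0 x0.
Let th t := expansion MX h t x0.
Let dth t := 'D_1 (mean_curvature Gm) t.
Let N t := \tr (invmx (Gm t) *m second_form Gm t *m (invmx (Gm t) *m second_form Gm t)).

Let oU : open [set s : R | t0 < s]. Proof. exact: open_gt. Qed.
Let CG j : Ck j [set s | t0 < s] Gm. Proof. exact: (Ck_metric_time hh j ac0 cx0). Qed.
Let Gsym s : t0 <= s -> (Gm s)^T = Gm s. Proof. by move=> ts; exact: (chart_metric_sym hh ac0 ts cx0). Qed.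
Let Gpos s : t0 <= s -> posdef (Gm s). Proof. by move=> ts; exact: (chart_metric_posdef hh ac0 ts cx0). Qed.
Let Gunit s : t0 < s -> Gm s \in unitmx. Proof. by move=> /ltW ts; exact: posdef_unitmx (Gpos ts). Qed.

Let thE s : t0 < s -> th s = mean_curvature Gm s.
Proof. exact: (chart_expansion_interior hh ac0 cx0). Qed.

Lemma raychaudhuri t : t0 < t -> exists q, [/\ 0 <= q, dth t = - (N t + q) & N t + q <= th t ^+ 2].
Proof.
move=> tt; have E : (fun s => chart_metric h c0 s (cmap c0 x0)) = Gm.
  by apply/funext => s; rewrite /chart_metric cmapK.
have CH j : Ck j [set s | t0 < s] (fun s => chart_metric h c0 s (cmap c0 x0)) by rewrite E.
have Hsym s : t0 < s -> (chart_metric h c0 s (cmap c0 x0))^T = chart_metric h c0 s (cmap c0 x0).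
  by move=> /ltW ts; have /(congr1 (fun f => f s)) /= -> := E; exact: Gsym.
have Hunit s : t0 < s -> chart_metric h c0 s (cmap c0 x0) \in unitmx.
  by move=> ts; have /(congr1 (fun f => f s)) /= -> := E; exact: Gunit.
have := einstein_block oU CH Hsym Hunit hn tt.
have -> : einstein (block_metric (chart_metric h c0)) (row_mx t%:M (cmap c0 x0)) = T t c0 x0.
  exact: hEin (ltW tt) ac0 cx0.
rewrite E /= -[chart_metric h c0 t (cmap c0 x0)]/((fun s => chart_metric h c0 s (cmap c0 x0)) t) E.
move=> [q1 q2]; have /andP[q0 q3] := hq x0 (ltW tt).
have qE : qfrak MX h T t x0 = - dth t - N t by exact: q1.
have rE : 2 * energy_density MX T t x0 = space_scalar_curvature MX (h t) x0 + th t ^+ 2 - N t.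
  by rewrite thE//; exact: q2.
have sc := hscal x0 (ltW tt).
exists (qfrak MX h T t x0); split; [exact: q0|by rewrite qE; ring|].
by move: q3; rewrite rE; lra.
Qed.

Lemma rate_nonneg t : t0 < t -> 0 <= N t.
Proof.
move=> tt; apply: mxtrace_sqr_ge0; [exact: Gsym (ltW tt)|exact: Gpos (ltW tt)|].
by apply: (second_form_sym oU CG _ tt) => s /ltW; exact: Gsym.
Qed.

Lemma expansion_right : th x @[x --> t0^'+] --> th t0.
Proof.
have [U [f [oV Ut cf E]]] := chart_expansion_right hh ac0 cx0.
have E' s : U s -> t0 <= s -> th s = f s by exact: E.
rewrite (E' _ Ut (lexx t0)).
have cf' : f x @[x --> t0^'+] --> f t0 by exact: cvg_at_right_filter.
apply: cvg_trans cf'; apply: near_eq_cvg; near=> s.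
apply/esym/E'; last by near: s; exact: nbhs_right_ge.
near: s; have : \forall s \near t0, U s by exact: open_nbhs_nbhs.
exact: cvg_within.
Unshelve. all: by end_near. Qed.

Lemma expansion_derive t : t0 < t -> is_derive t 1 th (dth t).
Proof.
move=> tt; have d := is_derive_mean_curvature oU CG Gunit tt.
apply: (near_eq_is_derive (f := mean_curvature Gm)); last by apply: derivableP; have [] := d.
by apply: filterS (open_nbhs_nbhs (conj oU tt)) => s ts; rewrite thE.
Qed.

Lemma expansion_derive_ge t : t0 < t -> - th t ^+ 2 <= dth t.
Proof. by move=> /raychaudhuri[q [_ -> h1]]; rewrite lerN2. Qed.

Lemma expansion_derive_le0 t : t0 < t -> dth t <= 0.
Proof. by move=> tt; have [q [q0 -> _]] := raychaudhuri tt; rewrite oppr_le0 addr_ge0// rate_nonneg. Qed.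

Lemma expansion_gt0 t : t0 <= t -> 0 < th t.
Proof.
exact: (riccati_gt0 expansion_right expansion_derive expansion_derive_ge expansion_derive_le0 (htheta x0)).
Qed.

Lemma expansion_rate t (u : 'rV[R]_n) : t0 < t ->
  - (u *m second_form Gm t *m u^T) 0 0 * th t <= cexp R n * (- dth t) * (u *m Gm t *m u^T) 0 0.
Proof.
move=> tt; have [q [q0 dE Nq]] := raychaudhuri tt; rewrite dE opprK.
have ths : th t = \tr (invmx (Gm t) *m second_form Gm t) by exact: thE.
rewrite ths; apply: (energy_rate_bound u hn) => //.
- exact: Gsym (ltW tt).
- exact: Gpos (ltW tt).
- by apply: (second_form_sym oU CG _ tt) => s /ltW; exact: Gsym.
- by rewrite -ths; exact: expansion_gt0 (ltW tt).
- by rewrite -ths; exact: Nq.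
Qed.

Lemma homogeneous_complete (M : topologicalType) (MM : manifold R n M) (k : R -> tensor2 R n M) :
  (n <= 9)%N -> metric_family MM t0 k ->
  (forall x : M, exists2 psi, local_isometry t0 h c0 MM k psi & psi (cmap c0 x0) = x) ->
  future_causally_complete MM t0 k.
Proof.
move=> n9 hk cover; apply: (causally_complete hh ac0 cx0 hk cover) => a b tau xi l0 g l0I.
exact: (geodesic_time_bounded hh ac0 cx0 hk cover (cexp_ge0 R hn) expansion_right expansion_derive
  expansion_derive_ge expansion_derive_le0 (htheta x0) expansion_rate (cexp_le1 R hn n9) g l0I).
Qed.

Lemma homogeneous_energy_le (a : R) (b : \bar R) (tau : R -> R) (xi : R -> X) (l : R) :
  (forall x : X, exists2 psi, local_isometry t0 h c0 MX h psi & psi (cmap c0 x0) = x) ->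
  future_causal_geodesic MX t0 h a b tau xi -> tau a = t0 -> ray a b l ->
  energy tau l <= energy tau a * (th t0 / th (tau l)) `^ cexp R n.
Proof.
move=> cover g ta rl; have [al lb] := rl; have [ab [h1 h2 h3 h4] h5] := g.
have Ia x : a < x <= l -> a < x /\ (x%:E < b)%E.
  by move=> /andP[ax xl]; split=> //; apply: le_lt_trans lb; rewrite lee_fin.
have ra : ray a b a by split.
have [aa ca] := chart_atP MX (xi a).
have [U [F [oV Ua CF H]]] := ray_curve h2 (h3 _ aa) ra ca.
have nU : \forall x \near a^'+, U x.
  have : \forall s \near a, U s by exact: open_nbhs_nbhs.
  exact: cvg_within.
have nr : \forall x \near a^'+, ray a b x.
  case: b {g h1 h2 h3 h4 h5 H Ia} ab rl lb ra => [r| |] ab rl lb ra //.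
    near=> x; split; first by near: x; exact: nbhs_right_ge.
    by rewrite lte_fin; near: x; apply: nbhs_right_lt; rewrite -lte_fin.
  by near=> x; split; [near: x; exact: nbhs_right_ge|exact: ltry].
move: al; rewrite le_eqVlt => /predU1P[<-|al].
  by rewrite ta divff ?gt_eqF ?expansion_gt0// powR1 mulr1.
(* The right limits at [a] of the energy and of [tau] are read off the smooth extension [F] of the
   curve. *)
have cE : energy tau x @[x --> a^'+] --> energy tau a.
  have [_ _ _ _ ->] := H a Ua ra.
  have c1 : 'D_1 F x 0 (lshift n 0) @[x --> a^'+] --> 'D_1 F a 0 (lshift n 0).
    apply: cvg_at_right_filter.
    exact: is_derive_continuous (is_derive_entry 0 (lshift n 0) (Ck_derivable1 (Ck_derive1 (CF 2)) Ua)).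
  apply: cvg_trans c1; apply: near_eq_cvg; near=> x.
  by have [||_ _ _ _ ->] := H x; [near: x; exact: nU|near: x; exact: nr|].
have ct : tau x @[x --> a^'+] --> tau a.
  have tE x : U x -> ray a b x -> tau x = F x 0 (lshift n 0).
    by move=> Ux rx; have [_ -> _ _ _] := H x Ux rx; rewrite /st_curve /st_coord row_mxEl mxE mulr1n.
  rewrite (tE a Ua ra).
  have c1 : F x 0 (lshift n 0) @[x --> a^'+] --> F a 0 (lshift n 0).
    apply: cvg_at_right_filter.
    exact: is_derive_continuous (is_derive_entry 0 (lshift n 0) (Ck_derivable1 (CF 1) Ua)).
  apply: cvg_trans c1; apply: near_eq_cvg; near=> x.
  by apply/esym/tE; [near: x; exact: nU|near: x; exact: nr].
have cth : th (tau x) @[x --> a^'+] --> th (tau a).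
  have [V [f [oW Vt cf E]]] := chart_expansion_right hh ac0 cx0.
  have E' s : V s -> t0 <= s -> th s = f s by exact: E.
  rewrite ta (E' _ Vt (lexx t0)); rewrite ta in ct.
  have c1 : f (tau x) @[x --> a^'+] --> f t0 by apply: continuous_cvg ct; exact: cf.
  apply: cvg_trans c1; apply: near_eq_cvg; near=> x.
  apply/esym/E'; last by apply: h1; near: x; exact: nr.
  near: x; apply: ct; exact: open_nbhs_nbhs.
pose I := [set x | a < x /\ (x%:E < b)%E].
have Icc x y z : I x -> I z -> x <= y <= z -> I y.
  move=> [ax _] [_ zb] /andP[xy yz]; split; first exact: lt_le_trans xy.
  by apply: le_lt_trans zb; rewrite lee_fin.
have rate x : I x -> is_derive x 1 (energy tau) ('D_1 (energy tau : R -> R) x) /\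
    'D_1 (energy tau : R -> R) x * th (tau x) <= cexp R n * (- dth (tau x)) * energy tau x ^+ 2.
  by move=> [ax xb]; exact: (energy_rate hh ac0 cx0 hh cover (cexp_ge0 R hn) expansion_derive_le0 expansion_rate g ax xb).
have I1 x : I x -> is_derive x 1 tau (energy tau x) by move=> [ax xb]; exact: (fcg_tau g ax xb).
have I2 x : I x -> is_derive x 1 (energy tau) ('D_1 (energy tau : R -> R) x) by move=> /rate[].
have I3 x : I x -> 0 < energy tau x.
  by move=> [ax xb]; apply: (fcg_energy_gt0 g); split; [exact: ltW|exact: xb].
have I4 x : I x -> t0 < tau x by move=> [ax xb]; exact: (fcg_tau_gt g ax xb).
have I5 x : I x -> 'D_1 (energy tau : R -> R) x * th (tau x) <= cexp R n * (- dth (tau x)) * energy tau x ^+ 2.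
  by move=> /rate[].
have ta' : t0 <= tau a by rewrite ta.
have Ea := fcg_energy_gt0 g ra.
rewrite -ta; exact: (energy_le_right expansion_right expansion_derive expansion_derive_ge
  expansion_derive_le0 (htheta x0) Icc I1 I2 I3 I4 I5 (conj al lb) al Ia Ea ta' cE cth).
Unshelve. all: by end_near. Qed.

End HomogeneousSpacetime.

(** * Perfect fluids and the theorem *)

Lemma perfect_fluid_condition (R : realFieldType) (n : nat) (r p : R) : (1 < n)%N ->
  0 <= ((n%:R - 2) * r + p * n%:R) / (n%:R - 1) <= 2 * r <-> - ((n%:R - 2) / n%:R) * r <= p /\ p <= r.
Proof.
move=> n1; have n1R : 1 < n%:R :> R by rewrite ltr1n.
have m0 : 0 < n%:R - 1 :> R by rewrite subr_gt0.
have n0 : 0 < n%:R :> R by apply: lt_trans n1R.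
have E1 : 0 <= ((n%:R - 2) * r + p * n%:R) / (n%:R - 1) <-> - ((n%:R - 2) / n%:R) * r <= p.
  rewrite pmulr_lge0 ?invr_gt0// mulNr lerNl mulrAC ler_pdivlMr// mulNr.
  by split; lra.
(* After multiplication by n - 1 the terms in [r] combine to n r, and the condition becomes n p <= n
   r. *)
have E2 : ((n%:R - 2) * r + p * n%:R) / (n%:R - 1) <= 2 * r <-> p <= r.
  rewrite ler_pdivrMr// -[p <= r](ler_pM2r n0); split; nra.
by split=> [/andP[/E1 h1 /E2 h2]|[/E1 h1 /E2 h2]]; [|apply/andP].
Qed.

Theorem proposition2p5
  (R : realType) (m n : nat) (hn : (2 <= n)%N)
  (L : topGroupType) (ML : manifold R m L) (H : set L)
  (X : topologicalType) (MX : manifold R n X)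
  (proj : L -> X) (act : L -> X -> X)
  (hX : homogeneous_space ML H MX proj act)
  (t0 : R) (h : R -> tensor2 R n X)
  (hmetric : metric_family MX t0 h)
  (hinvariant : forall t a, t0 <= t -> is_isometry MX (h t) (act a))
  (T : R -> chart R n X -> X -> 'M[R]_(1 + n))
  (hT : sym_st_tensor MX t0 T)
  (hEin : einstein_equation MX t0 h T)
  (htheta : forall x, 0 < expansion MX h t0 x)
  (hscal : forall t x, t0 <= t -> space_scalar_curvature MX (h t) x <= 0) :
  ((forall t x, t0 <= t ->
      0 <= qfrak MX h T t x <= 2 * energy_density MX T t x) ->
   (forall a b tau xi,
      future_causal_geodesic MX t0 h a b tau xi -> tau a = t0 ->
      forall l, ray a b l ->
        0 < expansion MX h (tau l) (xi l) /\
        energy tau l <=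
          energy tau a *
          (expansion MX h t0 (xi a) / expansion MX h (tau l) (xi l))
            `^ cexp R n) /\
   ((n <= 9)%N ->
      future_causally_complete MX t0 h /\
      forall (Gam : set (X -> X)) (Y : topologicalType) (MY : manifold R n Y)
        (prY : X -> Y) (k : R -> tensor2 R n Y),
        common_isometry_group MX t0 h Gam ->
        free_action Gam -> properly_discontinuous Gam ->
        quotient_manifold MX MY (orbit_rel Gam) prY ->
        metric_family MY t0 k ->
        (forall t, t0 <= t -> is_pullback MX MY prY (k t) (h t)) ->
        future_causally_complete MY t0 k)) /\
  (forall t x (p : R), t0 <= t ->
     stress T t (chart_at MX x) x = p *: h t (chart_at MX x) x ->
     (0 <= qfrak MX h T t x <= 2 * energy_density MX T t x
      <-> - ((n%:R - 2) / n%:R) * energy_density MX T t x <= p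
          /\ p <= energy_density MX T t x)).

Proof.
have sact a : smooth_map MX MX (act a) by have [] := hinvariant t0 a (lexx t0).
have pact a t : t0 <= t -> is_pullback MX MX (act a) (h t) (h t).
  by move=> tt; have [] := hinvariant t a tt.
have trans x y : exists a, act a x = y := homogeneous_transitive x y hX.
have thE t x y : t0 <= t -> expansion MX h t x = expansion MX h t y.
  move=> tt; have [a <-] := trans y x.
  exact: (@expansion_isometry R n X MX t0 h hmetric (act a) y t (sact a) (pact a) tt).
have cover (x0 : X) (M : topologicalType) (MM : manifold R n M) (k : R -> tensor2 R n M) (f : X -> M) :
    smooth_map MX MM f -> (forall y, exists x, f x = y) ->
    (forall t, t0 <= t -> is_pullback MX MM f (k t) (h t)) -> forall y : M,
    exists2 psi, local_isometry t0 h (chart_at MX x0) MM k psi & psi (cmap (chart_at MX x0) x0) = y.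
  move=> sf surj pf y; have [x <-] := surj y; have [a <-] := trans x0 x.
  have [ac cx] := chart_atP MX x0.
  exists (f \o act a \o cinv (chart_at MX x0)); last by rewrite /= cmapK.
  exact: (local_isometry_map ac (sact a) sf (pact a) pf).
have pid t : t0 <= t -> is_pullback MX MX id (h t) (h t) by have [] := hmetric; move=> + _ _ _; exact.
have surj_id (y : X) : exists x, id x = y by exists y.
split; [move=> hq; split; [|move=> n9; split]|].
- move=> a b tau xi g ta l rl; have [_ [/(_ l rl) tl _ _ _] _] := g.
  pose x0 := xi a.
  have E t x : t0 <= t -> expansion MX h t x = expansion MX h t x0 by exact: thE.
  rewrite (E _ (xi l) tl); split.
    exact: (expansion_gt0 hn hmetric hEin htheta hscal hq x0 tl).
  exact: (homogeneous_energy_le hn hmetric hEin htheta hscal hq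
    (cover x0 X MX h id (smooth_map_id MX) surj_id pid) g ta rl).
- move=> a b tau xi g.
  exact: (homogeneous_complete hn hmetric hEin htheta hscal hq n9 hmetric
    (cover (xi a) X MX h id (smooth_map_id MX) surj_id pid) g).
- move=> Gam Y MY prY k _ _ _ [[sY _] surj _] hk pY a b tau xi g.
  (* The geodesic itself provides a base point in [X]: any preimage of its initial point. *)
  have [x0 _] := surj (xi a).
  exact: (homogeneous_complete hn hmetric hEin htheta hscal hq n9 hk
    (cover x0 Y MY k prY sY surj pY) g).
- move=> t x p tt Sp.
  rewrite -(perfect_fluid_condition _ p hn).
  have [ac cx] := chart_atP MX x.
  have uh := posdef_unitmx (chart_metric_posdef hmetric ac tt cx).
  suff -> : qfrak MX h T t x = ((n%:R - 2) * energy_density MX T t x + p * n%:R) / (n%:R - 1) by [].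
  rewrite /qfrak /stress_trace Sp -scalemxAr mxtraceZ mulVmx// mxtrace1.
  by [].
Qed.
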